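(* Let $0<\alpha<1$ and $T>0$. Let $X$ be a real Hilbert space, let $A:X\supset\mathcal{D}(A)\to X$ be a closed densely defined linear operator such that $\{\lambda\in\mathbb{R};\ \lambda>0\}\subset\rho(A)$ and $\lambda\|(\lambda-A)^{-1}\|_{X\to X}\le 1$ for all $\lambda>0$, and let $B:X\to X$ be a bounded linear operator. Let $a\in X$. Then there exists a unique weak solution $u\in L^2(0,T;X)$ to $$\partial_t^\alpha(u(t)-a)=Au(t)+Bu(t)\quad\text{for }0<t<T,$$ and $$\|u\|_{L^2(0,T;X)}\le C\|a\|_X,$$ where the constant $C>0$ depends only on $\alpha$, $T$ and $\|B\|_{X\to X}$.
   Context: $L^2(0,T;X)$ is the Hilbert space of (classes of) strongly measurable, square-integrable functions $(0,T)\to X$ with scalar product $(v,w)_{L^2(0,T;X)}=\int_0^T (v(t),w(t))_X\,dt$. $\rho(A)$ denotes the resolvent set of $A$. $\mathcal{D}(A)$ carries the graph norm $\|u\|_X+\|Au\|_X$. For a closed densely defined operator $K$ in $X$ (here $K=A+B$ with $\mathcal{D}(A+B)=\mathcal{D}(A)$), the operator $\mathcal{K}$ in $L^2(0,T;X)$ has domain $\mathcal{D}(\mathcal{K})=L^2(0,T;\mathcal{D}(K))$ and acts by $(\mathcal{K}u)(t)=Ku(t)$; $\mathcal{K}^*$ is its adjoint with respect to the scalar product of $L^2(0,T;X)$. For $v\in L^2(0,T;X)$ set $J^\alpha v(t)=\frac{1}{\Gamma(\alpha)}\int_0^t (t-s)^{\alpha-1}v(s)\,ds$; $J^\alpha$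 is bounded and injective on $L^2(0,T;X)$. Define $\partial_t^\alpha:=(J^\alpha)^{-1}$ with domain $\mathcal{D}(\partial_t^\alpha)=J^\alpha L^2(0,T;X)$, which is dense in $L^2(0,T;X)$; $(\partial_t^\alpha)^*$ is its adjoint with respect to the scalar product of $L^2(0,T;X)$. Weak solution: $u\in L^2(0,T;X)$ is a weak solution to $\partial_t^\alpha(u-a)=Ku$ with $K=A+B$ if $$(u-a,(\partial_t^\alpha)^*\varphi)_{L^2(0,T;X)}=(u,\mathcal{K}^*\varphi)_{L^2(0,T;X)}\quad\text{for all }\varphi\in\mathcal{D}((\partial_t^\alpha)^* )\cap\mathcal{D}(\mathcal{K}^* ),$$ where $a$ is regarded as a constant function of $t$. *)

(* Defs.v *)
From HB Require Import structures.
From mathcomp Require Import all_boot all_order all_algebra.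
From mathcomp Require Import all_classical all_reals all_analysis.
Import Order.TTheory GRing.Theory Num.Theory.
Import numFieldNormedType.Exports.

Set Implicit Arguments.
Unset Strict Implicit.
Unset Printing Implicit Defensive.

Local Open Scope classical_set_scope.
Local Open Scope ring_scope.

(* An operator in X is a total function together with a domain; its values
   outside the domain are junk and play no role. *)
Record operator (R : realType) (X : normedModType R) :=
  Operator { dom : set X ; op_val :> X -> X }.

Section Operators.
Context {R : realType} {X : normedModType R}.
Implicit Types (A : operator X) (B : X -> X) (S : set X).

Definition linear_operator A : Prop :=
  dom A 0 /\
  forall (k : R) (x y : X), dom A x -> dom A y ->
    dom A (k *: x + y) /\ A (k *: x + y) = k *: A x + A y.

Definition closed_operator A : Prop :=
  closed [set p : X * X | dom A p.1 /\ p.2 = A p.1].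

Definition densely_defined A : Prop := dense (dom A).

Definition graph_norm A (x : X) : R := `|x| + `|A x|.

Definition perturb A B : operator X := Operator (dom A) (fun x => A x + B x).

Definition bounded_map B : Prop := exists M : R, forall x, `|B x| <= M * `|x|.

Definition opnorm B : R := sup [set `|B x| | x in [set x : X | `|x| <= 1]].

(* (l - A)^-1 *)
Definition resolvent A (l : R) (y : X) : X :=
  xget 0 [set x | dom A x /\ l *: x - A x = y].

Definition resolvent_set A : set R :=
  [set l | (forall y, exists! x, dom A x /\ l *: x - A x = y) /\
           bounded_map (resolvent A l)].

End Operators.

Section BochnerSpaces.
Context {R : realType} {X : normedModType R}.
Let mu := @lebesgue_measure R.
Implicit Types (S : set X) (N : X -> R) (I : set R) (f s v w : R -> X).

Definition simple_function S s : Prop :=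
  [/\ finite_set (range s), range s `<=` S &
      forall x, measurable (s @^-1` [set x] : set (measurableTypeR R))].

(* S is a subspace of X and N a norm on S; S = setT with the norm of X gives
   X itself, S = dom A with the graph norm gives D(A).  Measurability is Borel
   measurability and the limit is taken at every point: every class of
   Lebesgue a.e. limits of simple functions has such a representative. *)
Definition strongly_measurable S N I f : Prop :=
  exists s_ : nat -> R -> X, (forall n, simple_function S (s_ n)) /\
    forall t, I t -> N (s_ n t - f t) @[n --> \oo] --> (0 : R).

Definition L2_fun S N (T : R) f : Prop :=
  [/\ forall t, `]0, T[%classic t -> S (f t),
      strongly_measurable S N `]0, T[ f &
      (\int[mu]_(t in `]0%R, T[) ((N (f t)) ^+ 2)%:E < +oo)%E].

(* Elements of L^2(0,T;X) are represented by functions R -> X, of which only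
   the restriction to (0,T), up to a.e. equality, matters. *)
Definition L2 (T : R) : set (R -> X) := L2_fun setT (fun x => `|x|) T.

Definition L2_dom (K : operator X) (T : R) : set (R -> X) :=
  L2_fun (dom K) (graph_norm K) T.

Definition simple_integral I s : X :=
  \sum_(x \in range s)
    fine (mu ((s @^-1` [set x] : set (measurableTypeR R)) `&` I)) *: x.

Definition has_bochner_integral I f (z : X) : Prop :=
  strongly_measurable setT (fun x => `|x|) I f /\
  exists s_ : nat -> R -> X,
    [/\ forall n, simple_function setT (s_ n) /\
                  (\int[mu]_(t in I) (`|s_ n t|)%:E < +oo)%E,
        (\int[mu]_(t in I) (`|f t - s_ n t|)%:E)%E @[n --> \oo] --> 0%E &
        simple_integral I (s_ n) @[n --> \oo] --> z].

Definition bochner_integral I f : X := xget 0 (has_bochner_integral I f).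

Definition Gamma (a : R) : R :=
  \int[mu]_(t in `]0, +oo[) (t `^ (a - 1) * expR (- t)).

(* J^alpha *)
Definition frac_int (alpha : R) v (t : R) : X :=
  (Gamma alpha)^-1 *:
    bochner_integral `]0, t[ (fun s : R => (t - s) `^ (alpha - 1) *: v s).

(* Operators in L^2(0,T;X) are given by their graphs, as relations between
   representatives. *)

(* (v, w) with w = (J^alpha)^-1 v *)
Definition frac_deriv (alpha T : R) v w : Prop :=
  [/\ L2 T v, L2 T w & v = frac_int alpha w %[ae mu in `]0, T[%classic]].

Definition lifted (K : operator X) (T : R) v w : Prop :=
  [/\ L2_dom K T v, L2 T w & w = (fun t => K (v t)) %[ae mu in `]0, T[%classic]].

Variable dot : {dot X for @idfun R}.

Definition L2_dot (T : R) v w : R :=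
  \int[mu]_(t in `]0, T[) dot (v t) (w t).

Definition L2_norm (T : R) v : R := Num.sqrt (L2_dot T v v).

(* (phi, psi) with psi = G^* phi *)
Definition adjoint (T : R) (G : (R -> X) -> (R -> X) -> Prop)
    (phi psi : R -> X) : Prop :=
  [/\ L2 T phi, L2 T psi &
      forall v w, G v w -> L2_dot T w phi = L2_dot T v psi].

Definition weak_solution (alpha T : R) (K : operator X) (a : X) u : Prop :=
  L2 T u /\
  forall phi psi1 psi2 : R -> X,
    adjoint T (frac_deriv alpha T) phi psi1 ->
    adjoint T (lifted K T) phi psi2 ->
    L2_dot T (fun t => u t - a) psi1 = L2_dot T u psi2.

End BochnerSpaces.

(* Main.v *)
(* Write c = 1 / Gamma(alpha).

   Existence.  For the Yosida approximations A_n = n A (n - A)^-1 the Volterra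
   equation u_n = a + c k * (A_n + B) u_n, k(t) = t^(alpha-1), has bounded
   right-hand side and is solved by a power series.  If d = a + c k * f then
   |d|^2 <= |a|^2 + 2 c k * (f, d): after discretisation this is convexity of
   the square, because the kernel k is log-convex and decreasing (Kaluza).
   With the dissipativity of A_n and a Gronwall argument this bounds u_n, and
   u_n - u_m for a in D(A), uniformly on [0, T].  The limit u satisfies the weak
   formulation because (A_n + B) u_n = (A + B) P_n u_n + B (u_n - P_n u_n) with
   P_n = n (n - A)^-1, and P_n u_n lies in D(A).

   Uniqueness.  The test functions c (tau - t)_+^alpha / alpha * R' y, with R'
   the adjoint of R = (1 - A)^-1, lie in both adjoint domains.  For a difference w of
   weak solutions, W = int_0^tau w and V = c int_0^tau (tau-t)^alpha/alpha w they
   give R W = (R (A + B)) V, hence V in D(A), W = (A + B) V and V = c k * W; the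
   inequality above forces V = 0, W = 0 and w = 0 a.e.

   Integrals of X-valued functions are only ever used tested against vectors
   (Riesz). *)
Require Import Defs.
From HB Require Import structures.
From mathcomp Require Import all_boot all_order all_algebra.
From mathcomp Require Import all_classical all_reals all_analysis measurable_realfun.
From mathcomp Require Import finmap ring lra.
Import Order.TTheory GRing.Theory Num.Theory.
Import numFieldNormedType.Exports.

Set Implicit Arguments.
Unset Strict Implicit.
Unset Printing Implicit Defensive.

Local Open Scope classical_set_scope.
Local Open Scope ring_scope.

(** * Hilbert spaces *)

(** The quadratic inequality is the only energy estimate and serves three times: for the
    approximations u_n, for their differences, and for the integrated difference of two weak
    solutions. Hence the slack e in its a priori form: it is zero except for u_n - u_m, where it
    absorbs an error of order 1/n + 1/m. This is why bounded generators are solved first, and why a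
    difference w of weak solutions, merely square integrable, is replaced by its primitive W.

    The test functions carry R' because R' maps X into the domain of the adjoint of A; in time they
    are chosen so that the adjoint of the fractional derivative turns them into the indicator of ]0,
    tau[, and pairing w with that indicator produces W.

    The constant comes from a Gronwall argument with weight exp(om t), fixed before the space X is
    chosen, so that it can depend on alpha, T and the norm of B alone. *)

Lemma cvg_dist_squeeze {R : realType} {V : normedModType R} (u : nat -> V) l
    (v : nat -> R) : (forall n, `|u n - l| <= v n) -> v n @[n --> \oo] --> 0 ->
  u n @[n --> \oo] --> l.
Proof.
move=> uv v0; apply/cvgrPdist_le => e e0.
move/cvgrPdist_le : v0 => /(_ _ e0); apply: filterS => n; rewrite sub0r normrN.
by rewrite distrC => h; apply: le_trans (uv n) (le_trans (ler_norm _) h).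
Qed.

Section Completeness.
Context {R : realType} {X : completeNormedModType R}.
Implicit Types u : nat -> X.

Lemma cauchy_seq_cvg u :
  (forall e : R, 0 < e -> exists N, forall n m,
     (N <= n)%N -> (N <= m)%N -> `|u n - u m| <= e) ->
  exists l : X, u n @[n --> \oo] --> l.
Proof.
move=> h; suff /cvg_ex[l hl] : cvg (u n @[n --> \oo]) by exists l.
apply/cauchy_cvgP/cauchy_exP => e e0.
have [N hN] := h _ (divr_gt0 e0 (ltr0Sn R 1)).
exists (u N); exists N => // n /= Nn.
rewrite -ball_normE /=; apply: (le_lt_trans (hN _ _ (leqnn N) Nn)).
by rewrite ltr_pdivrMr// ltr_pMr// ltr1n.
Qed.

End Completeness.

Section Hilbert.
Context {R : realType} {X : completeNormedModType R}.
Context (dot : {dot X for @idfun R}) (hdot : forall x, dot x x = `|x| ^+ 2).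
Implicit Types x y z : X.

Lemma dotC x y : dot x y = dot y x.
Proof. by rewrite hermC expr0 mul1r. Qed.

Lemma dotDl x y z : dot (x + y) z = dot x z + dot y z.
Proof. by rewrite linearDl. Qed.

Lemma dotDr x y z : dot z (x + y) = dot z x + dot z y.
Proof. by rewrite linearDr. Qed.

Lemma dotZl k x z : dot (k *: x) z = k * dot x z.
Proof. by rewrite linearZl. Qed.

Lemma dotZr k x z : dot z (k *: x) = k * dot z x.
Proof. by rewrite linearZr. Qed.

Lemma dotBl x y z : dot (x - y) z = dot x z - dot y z.
Proof. by rewrite linearBl. Qed.

Lemma normrD_dot x y (k : R) :
  `|x + k *: y| ^+ 2 = `|x| ^+ 2 + 2 * k * dot x y + k ^+ 2 * `|y| ^+ 2.
Proof.
rewrite -!hdot dotDl !dotDr !dotZl !dotZr.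
rewrite (dotC y x); ring.
Qed.

Lemma normrB_dot x y : `|x - y| ^+ 2 = `|x| ^+ 2 - 2 * dot x y + `|y| ^+ 2.
Proof. by rewrite -scaleN1r normrD_dot; ring. Qed.

Lemma dot_AMGM x y : 2 * dot x y <= `|x| ^+ 2 + `|y| ^+ 2.
Proof. by have := sqr_ge0 (`|x - y|); rewrite normrB_dot; lra. Qed.

Lemma dot_CS x y : `|dot x y| <= `|x| * `|y|.
Proof.
wlog h : y / 0 <= dot x y.
  move=> H; have [/H//|h] := leP 0 (dot x y).
  have := H (- y); rewrite linearNr /= !normrN; apply; lra.
rewrite ger0_norm//.
have [->|y0] := eqVneq y 0; first by rewrite linear0r normr0 mulr0.
have {}y0 : 0 < `|y| by rewrite normr_gt0.
have [x0|x0] := leP (`|x|) 0.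
  have -> : x = 0 by apply/eqP; rewrite -normr_le0.
  by rewrite linear0l normr0 mul0r.
have := sqr_ge0 (`|x + (- (`|x| / `|y|)) *: y|).
rewrite normrD_dot.
have -> : `|x| ^+ 2 + 2 * - (`|x| / `|y|) * dot x y + (- (`|x| / `|y|)) ^+ 2 * `|y| ^+ 2
  = 2 * (`|x| / `|y|) * (`|x| * `|y| - dot x y) by field; rewrite gt_eqF.
by rewrite pmulr_rge0 ?subr_ge0// mulr_gt0// divr_gt0.
Qed.

Lemma dot_le x y : dot x y <= `|x| * `|y|.
Proof. exact: le_trans (ler_norm _) (dot_CS x y). Qed.

Lemma dot_eqP x y : (forall z, dot x z = dot y z) -> x = y.
Proof.
move=> h; apply/eqP; rewrite -subr_eq0 -normr_eq0 -sqrf_eq0 -hdot.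
by rewrite dotBl h subrr.
Qed.

Lemma norm_le_dot x (M : R) : 0 <= M -> (forall z, dot x z <= M * `|z|) ->
  `|x| <= M.
Proof.
move=> M0 /(_ x); rewrite hdot expr2.
have [->|x0] := eqVneq x 0; last by rewrite ler_pM2r// normr_gt0.
by rewrite normr0.
Qed.

Lemma dot_cvgl (u : nat -> X) x y : u n @[n --> \oo] --> x ->
  dot (u n) y @[n --> \oo] --> dot x y.
Proof.
move=> ux; apply/cvgrPdist_le => e e0.
have e1 : 0 < e / (`|y| + 1) by rewrite divr_gt0// ltr_wpDl.
move/cvgrPdist_le : ux => /(_ _ e1); apply: filterS => n h.
rewrite -dotBl; apply: le_trans (dot_CS _ _) _.
apply: le_trans (ler_wpM2r _ h) _; first exact: normr_ge0.
rewrite -mulrA ler_piMr//; first exact: ltW.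
by rewrite ler_pdivrMl ?mulr1 ?lerDl// ltr_wpDl.
Qed.

(** The representing vector is the minimiser of |y|^2 / 2 - l y, which is bounded below because l is
    bounded. The parallelogram identity makes minimising sequences Cauchy, and the first-order
    condition at the limit is the representation. *)
Lemma riesz (l : X -> R) (M : R) :
  (forall x y, l (x + y) = l x + l y) -> (forall k x, l (k *: x) = k * l x) ->
  (forall x, `|l x| <= M * `|x|) -> exists z, forall y, l y = dot z y.
Proof.
move=> lD lZ lM.
pose F y := `|y| ^+ 2 / 2 - l y.
have Fge y : - (M ^+ 2) / 2 <= F y.
  have /(le_trans (ler_norm _)) := lM y.
  have := sqr_ge0 (M - `|y|); rewrite /F; lra.
have hi : has_inf (range F).
  by split; [exists (F 0); exists 0|exists (- (M ^+ 2) / 2) => _ [y _ <-]].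
pose m := inf (range F).
have mF y : m <= F y by apply: ge_inf; [exact: hi.2|exists y].
have ex n : exists y, F y < m + n.+1%:R^-1.
  have [|_ [y _ <-] h] := @inf_adherent _ _ n.+1%:R^-1 _ hi.
    by rewrite invr_gt0 ltr0n.
  by exists y.
have [y Fy] := choice ex.
(* Parallelogram identity: two almost minimal values force the points to be close, since the value
   at the midpoint is at least [m]. *)
have par a b : `|a - b| ^+ 2 / 4 = F a + F b - 2 * F (2^-1 *: (a + b)).
  rewrite /F lZ lD normrZ exprMn (_ : `|2^-1| ^+ 2 = 4^-1 :> R); last first.
    by rewrite ger0_norm//; field.
  by rewrite -[in a + b](scale1r b) normrB_dot normrD_dot; field.
have [] := @cauchy_seq_cvg R X y.
  move=> e e0.
  have [N hN] : exists N : nat, 8 / e ^+ 2 <= N%:R.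
    exists (Num.truncn (8 / e ^+ 2)).+1; apply/ltW/truncnS_gt.
  exists N => i j Ni Nj.
  rewrite -(@ler_pXn2r _ 2)// ?nnegrE//; last exact: ltW.
  have inv k : (N <= k)%N -> k.+1%:R^-1 <= e ^+ 2 / 8.
    move=> Nk; rewrite -[leRHS]invrK lef_pV2 ?posrE ?ltr0n//; last first.
      by rewrite invr_gt0 divr_gt0// exprn_gt0.
    rewrite invf_div (le_trans hN)// ler_nat; exact: leqW.
  have := par (y i) (y j); have := Fy i; have := Fy j.
  have := inv _ Ni; have := inv _ Nj; have := mF (2^-1 *: (y i + y j)).
  move: (i.+1%:R^-1) (j.+1%:R^-1) => p q; lra.
move=> z yz; exists z => w.
have key (t : R) : 0 <= t ^+ 2 * `|w| ^+ 2 / 2 + t * (dot z w - l w).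
  have h n : - n.+1%:R^-1 <= t ^+ 2 * `|w| ^+ 2 / 2 + t * (dot (y n) w - l w).
    have := mF (y n + t *: w); have := Fy n.
    rewrite /F lD lZ normrD_dot; move: (n.+1%:R^-1) => p; lra.
  have c1 : - n.+1%:R^-1 @[n --> \oo] --> (0 : R).
    by rewrite -oppr0; apply: cvgN; exact: cvg_harmonic.
  have c2 : t ^+ 2 * `|w| ^+ 2 / 2 + t * (dot (y n) w - l w) @[n --> \oo] -->
      t ^+ 2 * `|w| ^+ 2 / 2 + t * (dot z w - l w).
    apply: cvgD; first exact: cvg_cst.
    apply: cvgM; first exact: cvg_cst.
    by apply: cvgB; [exact: dot_cvgl|exact: cvg_cst].
  by apply: (ler_cvg_to c1 c2); exact: nearW.
(* A quadratic without constant term that stays nonnegative has no linear term. It is tested at -q /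
   (2 (p + 1)), where the added 1 covers p = 0. *)
have aux (p q : R) : 0 <= p -> (forall t, 0 <= t ^+ 2 * p + t * q) -> q = 0.
  move=> p0 ht.
  have p1 : 0 < p + 1 by rewrite ltr_wpDl.
  have := ht (- q / (2 * (p + 1))).
  have -> : (- q / (2 * (p + 1))) ^+ 2 * p + - q / (2 * (p + 1)) * q =
     - (q ^+ 2 * (p + 2) / (4 * (p + 1) ^+ 2)) by field; rewrite gt_eqF.
  rewrite oppr_ge0 pmulr_lle0; last by rewrite invr_gt0 mulr_gt0// exprn_gt0.
  rewrite pmulr_lle0; last by lra.
  by move=> h; apply/eqP; rewrite -sqrf_eq0 eq_le h sqr_ge0.
apply/esym/subr0_eq/(@aux (`|w| ^+ 2 / 2)); first by rewrite divr_ge0// sqr_ge0.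
by move=> t; rewrite mulrA; exact: key.
Qed.

Lemma adjoint_map (S : X -> X) (M : R) :
  (forall x y, S (x + y) = S x + S y) -> (forall k x, S (k *: x) = k *: S x) ->
  (forall x, `|S x| <= M * `|x|) ->
  exists S' : X -> X, forall x y, dot (S x) y = dot x (S' y).
Proof.
move=> SD SZ SM.
suff /choice[S' h] : forall y, exists z, forall x, dot (S x) y = dot z x.
  by exists S' => x y; rewrite h dotC.
move=> y; apply: (@riesz _ (M * `|y|)) => [x x'|k x|x].
- by rewrite SD dotDl.
- by rewrite SZ dotZl.
- apply: le_trans (dot_CS _ _) _.
  by rewrite mulrAC ler_wpM2r.
Qed.

End Hilbert.

(** * Strongly measurable functions *)

Section FiniteValued.
Context {R : realType}.
Notation mu := (@lebesgue_measure R).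

(** The target is an arbitrary type, so that pairs, truth values and grid indices obey the same
    closure rules as vectors; over X it is [simple_function] for the whole space. *)
Definition finite_valued {U : Type} (s : R -> U) :=
  finite_set (range s) /\
  forall x, measurable (s @^-1` [set x] : set (measurableTypeR R)).

Lemma finite_valued_preimage {U : Type} (s : R -> U) (Y : set U) :
  finite_valued s -> measurable (s @^-1` Y : set (measurableTypeR R)).
Proof.
move=> [fs ms].
have -> : s @^-1` Y = \bigcup_(x in range s `&` Y) (s @^-1` [set x]).
  apply/seteqP; split => t /=; first by move=> Yt; exists (s t).
  by move=> [x [_ Yx] ->].
apply: fin_bigcup_measurable => [|x _]; last exact: ms.
by apply: sub_finite_set fs => x [].
Qed.

Lemma finite_valued_comp {U V : Type} (F : U -> V) (s : R -> U) :
  finite_valued s -> finite_valued (fun t => F (s t)).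
Proof.
move=> hs; split.
  apply: sub_finite_set (finite_image F hs.1) => _ [t _ <-].
  by exists (s t) => //; exists t.
move=> x; exact: (finite_valued_preimage (F @^-1` [set x]) hs).
Qed.

Lemma finite_valued_pair {U V W : Type} (F : U -> V -> W) (s : R -> U) (r : R -> V) :
  finite_valued s -> finite_valued r -> finite_valued (fun t => F (s t) (r t)).
Proof.
move=> hs hr.
apply: (@finite_valued_comp (U * V)%type W (fun p => F p.1 p.2) (fun t => (s t, r t))).
split.
  apply: sub_finite_set (finite_setX hs.1 hr.1) => _ [t _ <-] /=.
  by split; exists t.
move=> [x y].
have -> : (fun t => (s t, r t)) @^-1` [set (x, y)] =
    s @^-1` [set x] `&` r @^-1` [set y].
  by apply/seteqP; split => t /= [-> ->].
by apply: measurableI; [exact: hs.2|exact: hr.2].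
Qed.

Lemma finite_valued_cst {U : Type} (x : U) : finite_valued (fun _ : R => x).
Proof.
split; first exact: finite_image_cst.
move=> y; have [->|xy] := pselect (x = y).
  by rewrite (_ : _ @^-1` _ = setT)//; apply/seteqP; split.
by rewrite (_ : _ @^-1` _ = set0)//; apply/seteqP; split.
Qed.

Lemma finite_valued_mem (D : set R) : measurable (D : set (measurableTypeR R)) ->
  finite_valued (fun t => t \in D).
Proof.
move=> mD; split; first exact: sub_finite_set (@finite_finset _ setT).
move=> [].
  rewrite (_ : _ @^-1` _ = D)//; apply/seteqP; split => t /=; first by move/set_mem.
  by move/mem_set.
rewrite (_ : _ @^-1` _ = ~` D); first exact: measurableC.
apply/seteqP; split => t /=; first by move/negbT; rewrite notin_setE.
by move=> h; apply/negbTE; rewrite notin_setE.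
Qed.

Lemma finite_valued_nat (j : R -> nat) (N : nat) : (forall t, (j t <= N)%N) ->
  (forall n, measurable (j @^-1` [set n] : set (measurableTypeR R))) ->
  finite_valued j.
Proof.
move=> jN mj; split => //; apply: sub_finite_set (finite_II N.+1).
by move=> _ [t _ <-] /=; rewrite ltnS.
Qed.

Lemma finite_valued_measurable (s : R -> R) (D : set R) : finite_valued s ->
  measurable_fun (D : set (measurableTypeR R)) s.
Proof.
move=> hs mD Y mY; apply: measurableI => //; exact: finite_valued_preimage.
Qed.

End FiniteValued.

Section StronglyMeasurable.
Context {R : realType}.
Notation mu := (@lebesgue_measure R).

Definition smeas {X : normedModType R} (I : set R) (f : R -> X) :=
  strongly_measurable setT (fun x => `|x|) I f.

Lemma smeasP {X : normedModType R} (I : set R) (f : R -> X) :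
  smeas I f <-> exists s_ : nat -> R -> X, (forall n, finite_valued (s_ n)) /\
    forall t, I t -> s_ n t @[n --> \oo] --> f t.
Proof.
split=> -[s_ [hs cs]]; exists s_; split.
- by move=> n; have [] := hs n.
- move=> t It; apply/subr_cvg0/norm_cvg0P; exact: cs.
- by move=> n; have [] := hs n; split.
- by move=> t It; apply/norm_cvg0P/subr_cvg0; exact: cs.
Qed.

Lemma smeas_subset {X : normedModType R} (I J : set R) (f : R -> X) :
  J `<=` I -> smeas I f -> smeas J f.
Proof. by move=> JI [s_ [h1 h2]]; exists s_; split => // t /JI; exact: h2. Qed.

(** Approximations by simple functions are combined pointwise, so sequential continuity of the
    operation is enough. Differences, scalar multiples and inner products are instances. *)
Lemma smeas_pair {X Y Z : normedModType R} (F : X -> Y -> Z) (I : set R) f g :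
  (forall (u : nat -> X) (v : nat -> Y) x y, u n @[n --> \oo] --> x ->
     v n @[n --> \oo] --> y -> F (u n) (v n) @[n --> \oo] --> F x y) ->
  smeas I f -> smeas I g -> smeas I (fun t => F (f t) (g t)).
Proof.
move=> cF /smeasP[s [hs cs]] /smeasP[r [hr cr]]; apply/smeasP.
exists (fun n t => F (s n t) (r n t)); split.
  by move=> n; exact: finite_valued_pair.
by move=> t It; apply: cF; [exact: cs|exact: cr].
Qed.

Lemma smeas_comp {X Z : normedModType R} (F : X -> Z) (I : set R) f :
  (forall (u : nat -> X) x, u n @[n --> \oo] --> x ->
     F (u n) @[n --> \oo] --> F x) ->
  smeas I f -> smeas I (fun t => F (f t)).
Proof.
move=> cF hf; apply: (@smeas_pair X X Z (fun x _ => F x) I f f) => //.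
by move=> u _ x _ ux _; exact: cF.
Qed.

Lemma finite_valued_smeas {X : normedModType R} (I : set R) (s : R -> X) :
  finite_valued s -> smeas I s.
Proof.
by move=> hs; apply/smeasP; exists (fun=> s); split => // t _; exact: cvg_cst.
Qed.

Lemma smeas_cst {X : normedModType R} (I : set R) (x : X) : smeas I (fun=> x).
Proof. by apply: finite_valued_smeas; exact: finite_valued_cst. Qed.

Lemma smeasB {X : normedModType R} (I : set R) (f g : R -> X) :
  smeas I f -> smeas I g -> smeas I (fun t => f t - g t).
Proof. by apply: (@smeas_pair X X X (fun x y => x - y)) => u v x y; exact: cvgB. Qed.

Import HBSimple.

Lemma measurable_smeas (I : set R) (f : R -> R) :
  measurable (I : set (measurableTypeR R)) ->
  measurable_fun (I : set (measurableTypeR R)) f -> smeas I (f : R -> R^o).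
Proof.
move=> mI mf; apply/smeasP.
have [g hg] := approximation_sfun mI ((measurable_EFinP I f).2 mf).
exists (fun n t => g n t); split.
  move=> n; split; first exact: (@fimfunP _ _ (g n)).
  move=> x; rewrite -[X in measurable X]setTI.
  apply: (@measurable_funPT _ _ _ _ (g n)) => //; exact: measurable_set1.
move=> t It; have := hg t It; exact: fine_cvg.
Qed.

Lemma smeas_measurable (I : set R) (f : R -> R) :
  smeas I (f : R -> R^o) -> measurable_fun (I : set (measurableTypeR R)) f.
Proof.
move=> /smeasP[s [hs cs]]; apply: (@measurable_fun_cvg _ _ _ _ s) => //.
by move=> n; exact: finite_valued_measurable.
Qed.

Lemma smeas_scale {X : normedModType R} (I : set R) (p : R -> R) (f : R -> X) :
  measurable (I : set (measurableTypeR R)) ->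
  measurable_fun (I : set (measurableTypeR R)) p ->
  smeas I f -> smeas I (fun t => p t *: f t).
Proof.
move=> mI /measurable_smeas => /(_ mI).
apply: (@smeas_pair R^o X X (fun k x => k *: x)) => u v x y; exact: cvgZ.
Qed.

Lemma smeas_norm {X : normedModType R} (I : set R) (f : R -> X) :
  smeas I f -> measurable_fun (I : set (measurableTypeR R)) (fun t => `|f t|).
Proof.
move=> hf; apply: smeas_measurable.
by apply: (@smeas_comp X R^o (fun x => `|x|)) hf => u x; exact: cvg_norm.
Qed.

End StronglyMeasurable.

Section Dot.
Context {R : realType} {X : completeNormedModType R}.
Context (dot : {dot X for @idfun R}) (hdot : forall x, dot x x = `|x| ^+ 2).

Lemma smeas_dot (I : set R) (f g : R -> X) : smeas I f -> smeas I g ->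
  measurable_fun (I : set (measurableTypeR R)) (fun t => dot (f t) (g t)).
Proof.
move=> hf hg; apply: smeas_measurable.
apply: (@smeas_pair R X X R^o dot I f g) hf hg => u v x y ux vy.
(* Polarisation reduces the joint continuity of [dot] to continuity of the norm. *)
have e (a b : X) : dot a b = (`|a + b| ^+ 2 - `|a - b| ^+ 2) / 4.
  by rewrite (normrB_dot hdot) -[in a + b](scale1r b) (normrD_dot hdot); field.
under eq_fun do rewrite e.
rewrite e; apply: cvgM; last exact: cvg_cst.
have sq (w : nat -> X) z : w n @[n --> \oo] --> z ->
    `|w n| ^+ 2 @[n --> \oo] --> `|z| ^+ 2.
  by move=> wz; under eq_fun do rewrite expr2; rewrite expr2; apply: cvgM; exact: cvg_norm.
by apply: cvgB; apply: sq; [exact: cvgD|exact: cvgB].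
Qed.

Lemma smeas_dotl (I : set R) (f : R -> X) (y : X) : smeas I f ->
  measurable_fun (I : set (measurableTypeR R)) (fun t => dot (f t) y).
Proof. by move=> hf; apply: smeas_dot => //; exact: smeas_cst. Qed.

End Dot.

(** * Weak integrals *)

Section RealIntegrals.
Context {R : realType}.
Notation mu := (@lebesgue_measure R).
Implicit Types (D : set (measurableTypeR R)) (f g : R -> R).

Lemma integrable_dominated D f g : measurable D -> measurable_fun D f ->
  (forall t, D t -> `|f t| <= g t) -> mu.-integrable D (EFin \o g) ->
  mu.-integrable D (EFin \o f).
Proof.
move=> mD mf fg; apply: le_integrable => //; first exact/measurable_EFinP.
by move=> t Dt; rewrite /= lee_fin; apply: le_trans (fg _ Dt) (ler_norm _).
Qed.

Lemma integrable_bounded D f (M : R) : measurable D -> (mu D < +oo)%E ->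
  measurable_fun D f -> (forall t, D t -> `|f t| <= M) ->
  mu.-integrable D (EFin \o f).
Proof.
move=> mD Doo mf fM; apply: measurable_bounded_integrable => //.
exists M; split; first by rewrite num_real.
by move=> x Mx t Dt; apply: le_trans (fM _ Dt) (ltW Mx).
Qed.

Lemma integrable_add D f g : measurable D -> mu.-integrable D (EFin \o f) ->
  mu.-integrable D (EFin \o g) ->
  mu.-integrable D (EFin \o (fun t => f t + g t)).
Proof. by move=> mD hf hg; exact: (integrableD mD hf hg). Qed.

Lemma integrable_sub D f g : measurable D -> mu.-integrable D (EFin \o f) ->
  mu.-integrable D (EFin \o g) ->
  mu.-integrable D (EFin \o (fun t => f t - g t)).
Proof. by move=> mD hf hg; exact: (integrableB mD hf hg). Qed.

Lemma integrable_scale D f (k : R) : measurable D ->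
  mu.-integrable D (EFin \o f) ->
  mu.-integrable D (EFin \o (fun t => k * f t)).
Proof.
move=> mD hf; apply: (eq_integrable mD _ _ _ (integrableZl mD k hf)).
by move=> t _ /=; rewrite EFinM.
Qed.

Lemma integrable_measurable D f : mu.-integrable D (EFin \o f) ->
  measurable_fun D f.
Proof. by move=> /integrableP[/measurable_EFinP]. Qed.

Lemma Rintegral_EFin D f : measurable D -> mu.-integrable D (EFin \o f) ->
  (\int[mu]_(t in D) (f t)%:E)%E = (\int[mu]_(t in D) f t)%:E.
Proof. by move=> mD hf; rewrite fineK//; exact: integrable_fin_num. Qed.

Lemma Rintegral_big_sum (I : Type) (s : seq I) D (F : I -> R -> R) :
  measurable D -> (forall i, mu.-integrable D (EFin \o F i)) ->
  \int[mu]_(t in D) (\sum_(i <- s) F i t) = \sum_(i <- s) \int[mu]_(t in D) F i t.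
Proof.
move=> mD hF; elim: s => [|i s ih].
  rewrite big_nil; under eq_Rintegral do rewrite big_nil.
  by rewrite Rintegral_cst// mul0r.
rewrite big_cons -ih -RintegralD//.
  by apply: eq_Rintegral => t _; rewrite big_cons.
have := @integrable_sum _ _ _ mu _ mD _ s xpredT (fun i t => (F i t)%:E) (fun i _ => hF i).
by apply: eq_integrable => // t _ /=; rewrite sumEFin.
Qed.

Lemma Rintegral_dominated_cvg D (f_ : nat -> R -> R) f g : measurable D ->
  (forall n, measurable_fun D (f_ n)) ->
  (forall t, D t -> f_ n t @[n --> \oo] --> f t) ->
  (forall n t, D t -> `|f_ n t| <= g t) -> mu.-integrable D (EFin \o g) ->
  \int[mu]_(t in D) f_ n t @[n --> \oo] --> \int[mu]_(t in D) f t.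
Proof.
move=> mD mf cf fg ig.
have mf0 : measurable_fun D f by exact: measurable_fun_cvg mf cf.
have fg0 t : D t -> `|f t| <= g t.
  move=> Dt; apply: (ler_cvg_to (cvg_norm (cf t Dt)) (cvg_cst (g t))).
  by apply: nearW => n; exact: fg.
have if0 := integrable_dominated mD mf0 fg0 ig.
have ifn n := integrable_dominated mD (mf n) (fg n) ig.
have h : (\int[mu]_(x in D) (f_ n x)%:E)%E @[n --> \oo] -->
    (\int[mu]_(x in D) (f x)%:E)%E.
  apply: (@dominated_cvg _ _ _ _ D mD (fun n t => (f_ n t)%:E) _ (EFin \o g)) => //.
  - by move=> n; exact/measurable_EFinP.
  - by move=> t Dt; apply: cvg_EFin; [exact: nearW|exact: cf].
by rewrite (Rintegral_EFin mD if0) in h; exact: (fine_cvg h).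
Qed.

Lemma Rintegral_ae_eq D f g : measurable D -> measurable_fun D f ->
  measurable_fun D g -> f = g %[ae mu in D] ->
  \int[mu]_(t in D) f t = \int[mu]_(t in D) g t.
Proof.
move=> mD mf mg fg; congr fine; apply: ae_eq_integral => //.
- exact/measurable_EFinP.
- exact/measurable_EFinP.
- by apply: filterS fg => t h /h ->.
Qed.

End RealIntegrals.

(** * Bochner integrals tested against vectors *)

Section Bochner.
Context {R : realType} {X : completeNormedModType R}.
Context (dot : {dot X for @idfun R}) (hdot : forall x, dot x x = `|x| ^+ 2).
Notation mu := (@lebesgue_measure R).
Implicit Types (I : set (measurableTypeR R)) (f s : R -> X).

Lemma integrable_dot I f g (p : R -> R) : measurable I -> smeas I f -> smeas I g ->
  (forall t, I t -> `|f t| * `|g t| <= p t) -> mu.-integrable I (EFin \o p) ->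
  mu.-integrable I (fun t => (dot (f t) (g t))%:E).
Proof.
move=> mI hf hg fgp; apply: integrable_dominated => //; first exact: smeas_dot.
by move=> t It; apply: le_trans (dot_CS hdot _ _) (fgp _ It).
Qed.

Lemma integrable_dotl I f y : measurable I -> smeas I f ->
  mu.-integrable I (EFin \o (fun t => `|f t|)) ->
  mu.-integrable I (fun t => (dot (f t) y)%:E).
Proof.
move=> mI hf hi; apply: (@integrable_dot _ _ (fun=> y) (fun t => `|y| * `|f t|)) => //.
- exact: smeas_cst.
- by move=> t _; rewrite mulrC.
- exact: integrable_scale.
Qed.

Lemma finite_valued_bounded s : finite_valued s -> exists M : R, forall t, `|s t| <= M.
Proof.
move=> [fs _]; exists (\sum_(x <- fset_set (range s)) `|x|) => t.
have h : s t \in fset_set (range s) by rewrite in_fset_set// mem_set//; exists t.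
by rewrite (big_rem _ h)/= lerDl; apply: sumr_ge0.
Qed.

Lemma finite_valued_integrable I s : measurable I -> (mu I < +oo)%E ->
  finite_valued s -> mu.-integrable I (EFin \o (fun t => `|s t|)).
Proof.
move=> mI Ioo hs; have [M hM] := finite_valued_bounded hs.
apply: (@integrable_bounded _ _ _ M) => //.
  by apply: smeas_norm; exact: finite_valued_smeas.
by move=> t _; rewrite normr_id.
Qed.

Lemma simple_integral_dot I s y : measurable I -> (mu I < +oo)%E ->
  finite_valued s -> dot (simple_integral I s) y = \int[mu]_(t in I) dot (s t) y.
Proof.
move=> mI Ioo hs; rewrite /simple_integral fsbig_finite; last exact: hs.1.
set r := (X in \sum_(x <- X) _).
have iI x : mu.-integrable I (EFin \o (fun t => dot x y * \1_(s @^-1` [set x]) t)).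
  apply: integrable_scale => //.
  apply: (@integrable_bounded _ _ _ 1) => //.
    exact: (measurable_indic (hs.2 x)).
  by move=> t _; rewrite indicE; case: (_ \in _); rewrite ?normr1 ?normr0.
rewrite [RHS](_ : _ = \int[mu]_(t in I)
    (\sum_(x <- r) dot x y * \1_(s @^-1` [set x]) t)); last first.
  apply: eq_Rintegral => t _.
  have h : s t \in r.
    by rewrite /r (in_fset_set hs.1) mem_set//; exists t.
  rewrite (big_rem _ h)/= big_seq big1 ?addr0.
    by rewrite indicE mem_set// mulr1.
  move=> x; rewrite mem_rem_uniq ?fset_uniq// inE => /andP[xs _].
  rewrite indicE memNset ?mulr0//= => sx; by rewrite sx eqxx in xs.
rewrite Rintegral_big_sum//.
elim: r => [|x r ih]; first by rewrite !big_nil linear0l.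
rewrite !big_cons dotDl ih; congr (_ + _).
rewrite dotZl mulrC RintegralZl//.
  congr (_ * _); rewrite /Rintegral integral_indic//; exact: hs.2.
apply: (@integrable_bounded _ _ _ 1) => //.
  exact: (measurable_indic (hs.2 x)).
by move=> t _; rewrite indicE; case: (_ \in _); rewrite ?normr1 ?normr0.
Qed.

Lemma dot_simple_integral_dist I f s y : measurable I -> (mu I < +oo)%E ->
  finite_valued s -> smeas I f -> mu.-integrable I (EFin \o (fun t => `|f t|)) ->
  `|dot (simple_integral I s) y - \int[mu]_(t in I) dot (f t) y| <=
  fine (\int[mu]_(t in I) (`|f t - s t|)%:E)%E * `|y|.
Proof.
move=> mI Ioo hs hf hi; rewrite simple_integral_dot//.
have sms := finite_valued_smeas I hs.
have is_ := finite_valued_integrable mI Ioo hs.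
have ifs : mu.-integrable I (EFin \o (fun t => `|f t - s t|)).
  apply: (@integrable_dominated _ _ _ (fun t => `|f t| + `|s t|)) => //.
  - by apply: smeas_norm; exact: smeasB.
  - by move=> t _; rewrite normr_id ler_normB.
  - exact: integrable_add.
rewrite -RintegralB//; [|exact: integrable_dotl|exact: integrable_dotl].
rewrite mulrC -[fine _]/(\int[mu]_(t in I) `|f t - s t|) -RintegralZl//.
have iB : mu.-integrable I (EFin \o (fun t => dot (s t) y - dot (f t) y)).
  by apply: integrable_sub => //; exact: integrable_dotl.
apply: le_trans (le_normr_Rintegral mI iB) _.
apply: le_Rintegral => //; first exact: integrable_norm.
  exact: integrable_scale.
by move=> t _; rewrite -dotBl (le_trans (dot_CS hdot _ _))// mulrC distrC.
Qed.

Lemma has_bochner_integral_dot I f z y : measurable I -> (mu I < +oo)%E ->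
  mu.-integrable I (EFin \o (fun t => `|f t|)) ->
  has_bochner_integral I f z -> dot z y = \int[mu]_(t in I) dot (f t) y.
Proof.
move=> mI Ioo hi [hf [s [hs cs zs]]].
have c1 : dot (simple_integral I (s n)) y @[n --> \oo] --> dot z y.
  exact: dot_cvgl.
apply: (cvg_unique _ c1) => //.
apply: (@cvg_dist_squeeze _ R^o _ _
  (fun n => fine (\int[mu]_(t in I) (`|f t - s n t|)%:E)%E * `|y|)).
- move=> n; apply: dot_simple_integral_dist => //.
  by have [[]] := hs n.
- by rewrite -(mul0r `|y|); apply: cvgMr_tmp; exact: (fine_cvg cs).
Qed.

(** Strong measurability gives only pointwise approximation, whereas the Bochner integral asks for
    convergence in mean. Truncating the simple functions supplies the domination that bridges the
    two. *)
Lemma has_bochner_integral_weak I f z : measurable I -> (mu I < +oo)%E ->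
  smeas I f -> mu.-integrable I (EFin \o (fun t => `|f t|)) ->
  (forall y, dot z y = \int[mu]_(t in I) dot (f t) y) ->
  has_bochner_integral I f z.
Proof.
move=> mI Ioo hf hi hz; split => //.
have /smeasP[s [hs cs]] := hf.
(* Where |s n t| > 2 |f t| the approximation is replaced by 0. There |f t| < |f t - s n t|, so the
   error does not grow, and everywhere on I it is at most 3 |f t|. *)
pose D n := I `&` [set t | `|s n t| <= 2 * `|f t|].
have mD n : measurable (D n : set (measurableTypeR R)).
  apply: measurable_fun_le => //.
    by apply: smeas_norm; exact: finite_valued_smeas.
  by apply: measurable_funM => //; exact: smeas_norm.
pose r n t := if t \in D n then s n t else 0.
have hr n : finite_valued (r n).
  exact: (finite_valued_pair (fun x (b : bool) => if b then x else 0) (hs n)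
    (finite_valued_mem (mD n))).
have rs n t : I t -> `|f t - r n t| <= `|f t - s n t|.
  move=> It; rewrite /r; case: ifPn => //; rewrite notin_setE => nD.
  rewrite subr0; have {}nD : 2 * `|f t| < `|s n t|.
    by rewrite ltNge; apply/negP => h; apply: nD.
  have := ler_normB (f t) (f t - s n t); rewrite opprB addrCA subrr addr0; lra.
have rf n t : I t -> `|f t - r n t| <= 3 * `|f t|.
  move=> It; rewrite /r; case: ifPn => [/set_mem[_ /= h]|_].
    by have := ler_normB (f t) (s n t); lra.
  by rewrite subr0 ler_peMl// ler1n.
have cr : (\int[mu]_(t in I) (`|f t - r n t|)%:E)%E @[n --> \oo] --> 0%E.
  have -> : 0%E = (\int[mu]_(t in I) 0)%E :> \bar R by rewrite integral0.
  apply: (@dominated_cvg _ _ _ _ I mI _ _ (EFin \o (fun t => 3 * `|f t|))) => //.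
  - move=> n; apply/measurable_EFinP; apply: smeas_norm; apply: smeasB => //.
    exact: finite_valued_smeas.
  - move=> t It; apply: cvg_EFin; first exact: nearW.
    apply: (@cvg_dist_squeeze _ R^o _ _ (fun n => `|f t - s n t|)) => [n|].
    + by rewrite subr0 normr_id rs.
    + rewrite -(normr0 X); apply: cvg_norm; rewrite -(subrr (f t)).
      by apply: cvgB; [exact: cvg_cst|exact: cs].
  - exact: integrable_scale.
  - by move=> n t It /=; rewrite lee_fin normr_id rf.
exists r; split => //.
- move=> n; split; first by have [] := hr n.
  by have /integrableP[_] := finite_valued_integrable mI Ioo (hr n);
    under eq_integral do rewrite /= normr_id.
- apply: (cvg_dist_squeeze
    (v := fun n => fine (\int[mu]_(t in I) (`|f t - r n t|)%:E)%E)) => [n|].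
  + apply: (norm_le_dot hdot) => [|y]; first by rewrite fine_ge0// integral_ge0.
    rewrite dotBl hz (le_trans (ler_norm _))//.
    exact: dot_simple_integral_dist.
  + exact: (fine_cvg cr).
Qed.

Lemma weak_integral I f : measurable I ->
  smeas I f -> mu.-integrable I (EFin \o (fun t => `|f t|)) ->
  exists z, forall y, dot z y = \int[mu]_(t in I) dot (f t) y.
Proof.
move=> mI hf hi.
have [|||z hz] := riesz hdot (l := fun y => \int[mu]_(t in I) dot (f t) y)
  (M := \int[mu]_(t in I) `|f t|).
- move=> x y; rewrite -RintegralD//; [|exact: integrable_dotl|exact: integrable_dotl].
  by apply: eq_Rintegral => t _; rewrite dotDr.
- move=> k x; rewrite -RintegralZl//; last exact: integrable_dotl.
  by apply: eq_Rintegral => t _; rewrite dotZr.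
- move=> y; rewrite mulrC -RintegralZl//.
  apply: le_trans (le_normr_Rintegral mI (integrable_dotl y mI hf hi)) _.
  apply: le_Rintegral => //.
  + by apply: integrable_norm; exact: integrable_dotl.
  + exact: integrable_scale.
  + by move=> t _; rewrite mulrC dot_CS.
by exists z => y; rewrite hz.
Qed.

(** [bochner_integral] falls back on 0 when no integral exists; the vector supplied by Riesz is a
    Bochner integral, which excludes this case. *)
Lemma bochner_integral_dot I f y : measurable I -> (mu I < +oo)%E ->
  smeas I f -> mu.-integrable I (EFin \o (fun t => `|f t|)) ->
  dot (bochner_integral I f) y = \int[mu]_(t in I) dot (f t) y.
Proof.
move=> mI Ioo hf hi; apply: has_bochner_integral_dot => //.
have [z hz] := weak_integral mI hf hi.
by apply: xgetPex; exists z; exact: has_bochner_integral_weak.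
Qed.

End Bochner.

(** * Integrals of powers *)

Section SingularFTC.
Context {R : realType}.
Notation mu := (@lebesgue_measure R).

Lemma cvg_div_natS (c : R) k : c / (n + k).+1%:R @[n --> \oo] --> 0.
Proof.
rewrite -(mulr0 c); apply: cvgMl_tmp.
by have := @cvg_harmonic R; rewrite -(cvg_shiftn k).
Qed.

(** The integrand may blow up at an end point, so the fundamental theorem is used on compact
    subintervals. Nonnegativity lets monotone convergence pass to the open interval, and only
    one-sided limits of F are required. *)
Lemma FTC_itvoo (f F : R -> R) (a b la lb : R) : a < b ->
  (forall x, a < x < b -> 0 <= f x) ->
  (forall x, a < x < b -> {for x, continuous f}) ->
  (forall x, a < x < b -> is_derive x 1 F (f x)) ->
  F x @[x --> a^'+] --> la -> F x @[x --> b^'-] --> lb ->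
  (\int[mu]_(x in `]a, b[) (f x)%:E = (lb - la)%:E)%E.
Proof.
move=> ab f0 cf dF Fa Fb.
(* The denominator n + 3 keeps 2 [d n] below b - a already at n = 0, so every [D n] is a
   nondegenerate interval. *)
pose d n : R := (b - a) / (n + 2).+1%:R.
have d0 n : 0 < d n by rewrite divr_gt0 ?subr_gt0.
have dd n : d n + d n < b - a.
  rewrite -mulr2n -mulr_natr -mulrA gtr_pMr ?subr_gt0//.
  by rewrite mulrC ltr_pdivrMr// mul1r ltr_nat addn2.
have dc : d n @[n --> \oo] --> 0 by exact: cvg_div_natS.
pose D n := `[a + d n, b - d n]%classic.
have DS n : D n `<=` `]a, b[.
  move=> x; rewrite /D /= !in_itv/= => /andP[x1 x2].
  have := d0 n; lra.
have cD x : x \in `]a, b[%classic -> {for x, continuous f}.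
  by move=> /set_mem; rewrite /= in_itv/=; exact: cf.
have mf : measurable_fun `]a, b[ f.
  by apply: open_continuous_measurable_fun => //; exact: itv_open.
have Dcup : \bigcup_n D n = `]a, b[%classic.
  apply/seteqP; split=> [x [n _]|x]; first exact: DS.
  rewrite /= in_itv/= => /andP[ax xb].
  have e0 : 0 < Num.min (x - a) (b - x) by rewrite lt_min !subr_gt0 ax.
  move/cvgrPdist_lt : dc => /(_ _ e0)[N _ /(_ N (leqnn N))].
  rewrite sub0r normrN gtr0_norm// lt_min => /andP[h1 h2].
  by exists N => //; rewrite /D /= in_itv/=; lra.
have h1 : (\int[mu]_(x in D n) (f x)%:E)%E @[n --> \oo] -->
    (\int[mu]_(x in `]a, b[) (f x)%:E)%E.
  rewrite -Dcup; apply: ge0_nondecreasing_set_cvg_integral.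
  - move=> i j ij; apply/subsetPset => x; rewrite /D /= !in_itv/= => /andP[x1 x2].
    have : d j <= d i.
      rewrite ler_pM2l ?subr_gt0// lef_pV2 ?posrE ?ltr0n// ler_nat.
      by rewrite ltnS leq_add2r.
    lra.
  - by move=> i; exact: measurable_itv.
  - move=> i; apply/measurable_EFinP; exact: measurable_funS (DS i) mf.
  - by move=> i x /DS; rewrite /= in_itv/= lee_fin; exact: f0.
have h2 n : (\int[mu]_(x in D n) (f x)%:E = (F (b - d n) - F (a + d n))%:E)%E.
  rewrite EFinB; have dn := d0 n; have ddn := dd n.
  have cF x : a < x < b -> {for x, continuous F}.
    move=> /dF[h _]; exact/differentiable_continuous/derivable1_diffP.
  apply: continuous_FTC2.
  - lra.
  - apply: continuous_in_subspaceT => x /set_mem; rewrite /= in_itv/= => h.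
    by apply: cf; lra.
  - split.
    + move=> x; rewrite in_itv/= => h; apply: ex_derive.
      by apply: dF; lra.
    + by apply: cvg_at_right_filter; apply: cF; lra.
    + by apply: cvg_at_left_filter; apply: cF; lra.
  - move=> x; rewrite in_itv/= => h.
    by rewrite derive1E; apply: derive_val; apply: dF; lra.
rewrite (_ : (fun n => _) = fun n => (F (b - d n) - F (a + d n))%:E) in h1; last first.
  by apply/funext => n; exact: h2.
apply: (cvg_unique _ h1) => //.
apply: cvg_EFin; first exact: nearW.
apply: cvgB.
  move/cvg_at_leftP : Fb; apply; split.
    by move=> n; have := d0 n; lra.
  by rewrite -[X in _ --> X]subr0; apply: cvgB => //; exact: cvg_cst.
move/cvg_at_rightP : Fa; apply; split.
  by move=> n; have := d0 n; lra.
by rewrite -[X in _ --> X]addr0; apply: cvgD => //; exact: cvg_cst.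
Qed.

(** At l = 0 the power is not differentiable for p < 1, so this case rests on the one-sided limit at
    0; elsewhere differentiability gives continuity. *)
Lemma powR_cvg (p : R) (u : nat -> R) (l : R) : 0 < p -> 0 <= l ->
  (forall n, 0 < u n) -> u n @[n --> \oo] --> l ->
  u n `^ p @[n --> \oo] --> l `^ p.
Proof.
move=> p0; rewrite le_eqVlt => /predU1P[<-|l0] u0 ul.
  rewrite powR0 ?gt_eqF//.
  by have /cvg_at_rightP := powR_cvg0 p0; apply.
have : {for l, continuous (powR (R:=R) ^~ p)}.
  apply/differentiable_continuous/derivable1_diffP.
  by apply: ex_derive; exact: is_derive1_powR.
by move=> h; exact: (cvg_comp _ _ ul h).
Qed.

Lemma is_derive_powR_subl (a p x : R) : a < x -> p != 0 ->
  is_derive x 1 (fun s => (s - a) `^ p / p) ((x - a) `^ (p - 1)).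
Proof.
move=> ax p0.
have h1 : is_derive x 1 (fun s : R => s - a) 1.
  by apply: is_derive_eq; rewrite subr0.
have h2 : is_derive (x - a) 1 (powR (R:=R) ^~ p) (p * (x - a) `^ (p - 1)).
  by apply: is_derive1_powR; rewrite subr_gt0.
have h3 := @is_derive1_comp _ (powR (R:=R) ^~ p) (fun s => s - a) x _ _ h2 h1.
have h4 := is_deriveZ (p^-1) h3.
have -> : (fun s : R => (s - a) `^ p / p) =
    p^-1 \*: ((powR (R:=R) ^~ p) \o (fun s : R => s - a)).
  by apply/funext => s /=; rewrite mulrC.
apply: (is_derive_eq h4).
by rewrite mulr1 -[_ *: _]/(_ * _) mulKf.
Qed.

Lemma is_derive_powR_subr (c p x : R) : x < c -> p != 0 ->
  is_derive x 1 (fun s => - ((c - s) `^ p / p)) ((c - x) `^ (p - 1)).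
Proof.
move=> xc p0.
have h1 : is_derive x 1 (fun s : R => c - s) (-1).
  by apply: is_derive_eq; rewrite add0r mul1r.
have h2 : is_derive (c - x) 1 (powR (R:=R) ^~ p) (p * (c - x) `^ (p - 1)).
  by apply: is_derive1_powR; rewrite subr_gt0.
have h3 := @is_derive1_comp _ (powR (R:=R) ^~ p) (fun s => c - s) x _ _ h2 h1.
have h4 := is_deriveZ (- p^-1) h3.
have -> : (fun s : R => - ((c - s) `^ p / p)) =
    (- p^-1) \*: ((powR (R:=R) ^~ p) \o (fun s : R => c - s)).
  by apply/funext => s /=; rewrite scaleNr; congr (- _); exact: mulrC.
apply: (is_derive_eq h4).
by rewrite -[_ *: _]/(_ * _) mulrN1 mulrNN mulKf.
Qed.

Lemma continuous_powR_subr (c p x : R) : x < c ->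
  {for x, continuous (fun s => (c - s) `^ p)}.
Proof.
move=> xc; apply: (@continuous_comp _ _ _ (fun s => c - s) (powR (R:=R) ^~ p)).
  by apply: cvgB; [exact: cvg_cst|exact: cvg_id].
apply/differentiable_continuous/derivable1_diffP.
by apply: ex_derive; apply: is_derive1_powR; rewrite subr_gt0.
Qed.

Lemma continuous_powR_subl (c p x : R) : c < x ->
  {for x, continuous (fun s => (s - c) `^ p)}.
Proof.
move=> xc; apply: (@continuous_comp _ _ _ (fun s => s - c) (powR (R:=R) ^~ p)).
  by apply: cvgB; [exact: cvg_id|exact: cvg_cst].
apply/differentiable_continuous/derivable1_diffP.
by apply: ex_derive; apply: is_derive1_powR; rewrite subr_gt0.
Qed.

Lemma integral_powR_subr (a b c p : R) : 0 < p -> a <= b -> b <= c ->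
  (\int[mu]_(s in `]a, b[) ((c - s) `^ (p - 1))%:E =
   (((c - a) `^ p - (c - b) `^ p) / p)%:E)%E.
Proof.
move=> p0; rewrite le_eqVlt => /predU1P[-> _|ab bc].
  by rewrite set_itvoo0 integral_set0 subrr mul0r.
have pn0 : p != 0 by rewrite gt_eqF.
have -> : ((c - a) `^ p - (c - b) `^ p) / p =
    - ((c - b) `^ p / p) - (- ((c - a) `^ p / p)) by field.
apply: (@FTC_itvoo _ (fun s => - ((c - s) `^ p / p))) => //.
- by move=> x _; exact: powR_ge0.
- by move=> x xab; apply: continuous_powR_subr; lra.
- by move=> x xab; apply: is_derive_powR_subr => //; lra.
- apply: cvg_at_right_filter; apply: cvgN; apply: cvgMr_tmp.
  by apply: continuous_powR_subr; lra.
- apply: cvgN; apply: cvgMr_tmp; apply/cvg_at_leftP => u [ub uc].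
  apply: powR_cvg => //; first by rewrite subr_ge0.
    by move=> n; have := ub n; lra.
  by apply: cvgB => //; exact: cvg_cst.
Qed.

Lemma integral_powR_subl (a b p : R) : 0 < p -> a <= b ->
  (\int[mu]_(s in `]a, b[) ((s - a) `^ (p - 1))%:E = ((b - a) `^ p / p)%:E)%E.
Proof.
move=> p0; rewrite le_eqVlt => /predU1P[->|ab].
  by rewrite set_itvoo0 integral_set0 subrr powR0 ?gt_eqF// mul0r.
have pn0 : p != 0 by rewrite gt_eqF.
rewrite -[X in X%:E]subr0.
apply: (@FTC_itvoo _ (fun s => (s - a) `^ p / p)) => //.
- by move=> x _; exact: powR_ge0.
- by move=> x xab; apply: continuous_powR_subl; lra.
- by move=> x xab; apply: is_derive_powR_subl => //; lra.
- rewrite -(mul0r p^-1) -[X in X / _](powR0 pn0).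
  apply: cvgMr_tmp; apply/cvg_at_rightP => u [ub uc].
  apply: powR_cvg => //.
    by move=> n; have := ub n; lra.
  by rewrite -(subrr a); apply: cvgB => //; exact: cvg_cst.
- apply: cvg_at_left_filter; apply: cvgMr_tmp.
  by apply: continuous_powR_subl; lra.
Qed.

End SingularFTC.

(** * Power kernels and positivity of Gamma *)

Section PowerKernel.
Context {R : realType}.
Notation mu := (@lebesgue_measure R).
Implicit Types (a b c p t : R) (g : R -> R).

Lemma lebesgue_itvoo_lty a b : (mu `]a, b[%classic < +oo)%E.
Proof. by rewrite lebesgue_measure_itv/=; case: ifP => // _; rewrite -EFinB ltry. Qed.

Lemma measurable_powR_subr c p (D : set (measurableTypeR R)) :
  measurable_fun D (fun s => (c - s) `^ p).
Proof.
apply: measurable_funTS; apply: (measurableT_comp (measurable_powR p)).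
by apply: measurable_funB; [exact: measurable_cst|exact: measurable_id].
Qed.

Lemma integrable_powR_subr a b c p : 0 < p -> b <= c ->
  mu.-integrable `]a, b[ (EFin \o (fun s => (c - s) `^ (p - 1))).
Proof.
move=> p0 bc; apply/integrableP; split.
  by apply/measurable_EFinP; exact: measurable_powR_subr.
under eq_integral do rewrite /= ger0_norm ?powR_ge0//.
have [ab|ba] := leP a b; first by rewrite integral_powR_subr// ltry.
by rewrite set_itv_ge ?integral_set0// bnd_simp -leNgt ltW.
Qed.

Lemma Rintegral_powR_subr a b c p : 0 < p -> a <= b -> b <= c ->
  \int[mu]_(s in `]a, b[) ((c - s) `^ (p - 1)) = ((c - a) `^ p - (c - b) `^ p) / p.
Proof. by move=> *; rewrite /Rintegral integral_powR_subr. Qed.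

Lemma Rintegral_itvoo_split (f : R -> R) a b c : a <= b -> b <= c ->
  mu.-integrable `]a, c[ (EFin \o f) ->
  \int[mu]_(s in `]a, c[) f s =
  \int[mu]_(s in `]a, b[) f s + \int[mu]_(s in `]b, c[) f s.
Proof.
move=> ab; rewrite le_eqVlt => /predU1P[->|bc] hf.
  by rewrite set_itvoo0 Rintegral_set0 addr0.
have := @Rintegral_itvB R f (BRight a) (BLeft c) b hf.
rewrite !bnd_simp => /(_ ab bc) <-.
rewrite [X in _ = X + _](@Rintegral_itv_bndo_bndc R (BRight a) b f).
  by rewrite addrC subrK.
apply: (integrableS _ _ _ hf); [exact: measurable_itv|exact: measurable_itv|].
by apply: subset_itvl; rewrite bnd_simp; exact: ltW.
Qed.

Lemma powR_le_neg p x y : p <= 0 -> 0 < x -> x <= y -> y `^ p <= x `^ p.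
Proof.
move=> p0 x0 xy; rewrite -(opprK p) !(powRN _ (- p)).
rewrite lef_pV2 ?posrE ?powR_gt0 ?(lt_le_trans x0)//.
by apply: ge0_ler_powR; rewrite ?nnegrE ?oppr_ge0// ltW// (lt_le_trans x0).
Qed.

Lemma powR_le_pos p x y : 0 <= p -> 0 <= x -> x <= y -> x `^ p <= y `^ p.
Proof.
move=> p0 x0 xy; apply: ge0_ler_powR => //.
by rewrite nnegrE (le_trans x0).
Qed.

(** [Gamma] is a real-valued integral, which would read 0 if the extended integral were infinite, so
    finiteness has to be shown as well. The integrand is compared with t^(p-1) on ]0, 1[ and with
    exp(-t) on [1, +oo[; the first comparison also gives the positive lower bound, with factor
    exp(-1). *)
Lemma Gamma_gt0 p : 0 < p < 1 -> 0 < Gamma p.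
Proof.
move=> /andP[p0 p1]; rewrite /Gamma /Rintegral.
set f := fun t : R => t `^ (p - 1) * expR (- t).
have f0 t : 0 <= f t by rewrite mulr_ge0// ?powR_ge0// expR_ge0.
have mf (D : set (measurableTypeR R)) : measurable_fun D f.
  apply: measurable_funM; first exact: measurable_funTS (measurable_powR _).
  apply: measurable_funTS; apply: (measurableT_comp (@measurable_expR R)).
  exact: oppr_measurable.
have mEf (D : set (measurableTypeR R)) : measurable_fun D (EFin \o f).
  exact/measurable_EFinP.
have e1 : `]0, +oo[%classic = `]0, 1[%classic `|` `[1, +oo[%classic :> set R.
  by rewrite -itv_bndbnd_setU// bnd_simp.
have k01 : (\int[mu]_(t in `]0%R, 1%R[) (t `^ (p - 1))%:E = (p^-1)%:E)%E.
  have := @integral_powR_subl R 0 1 p p0 ler01; rewrite subr0 powR1 div1r => <-.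
  by apply: eq_integral => t _; rewrite subr0.
rewrite fine_gt0//; apply/andP; split.
  apply: (@lt_le_trans _ _ (\int[mu]_(t in `]0%R, 1%R[) (f t)%:E)%E); last first.
    apply: ge0_subset_integral => //; first by move=> t _; rewrite lee_fin.
    by apply: subset_itvl; rewrite bnd_simp.
  apply: (@lt_le_trans _ _ ((expR (-1) * p^-1)%:E)).
    by rewrite lte_fin mulr_gt0 ?expR_gt0// invr_gt0.
  rewrite EFinM -k01 -ge0_integralZl_EFin//=.
  - apply: ge0_le_integral => //=.
    + by move=> t _; rewrite lee_fin mulr_ge0 ?expR_ge0 ?powR_ge0.
    + apply/measurable_EFinP; apply: measurable_funM; first exact: measurable_cst.
      exact: measurable_funTS (measurable_powR _).
    + move=> t; rewrite /= in_itv/= => /andP[t0 t1].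
      rewrite lee_fin /f mulrC ler_wpM2l ?powR_ge0// ler_expR; lra.
  - by move=> t _; rewrite lee_fin powR_ge0.
  - by apply/measurable_EFinP; exact: measurable_funTS (measurable_powR _).
rewrite e1 ge0_integral_setU//=; last first.
  by apply/disj_setPS => t [/=]; rewrite !in_itv/= => /andP[_ h1] /andP[h2 _]; lra.
  by move=> t _; rewrite lee_fin; exact: f0.
apply: lte_add_pinfty.
  apply: (@le_lt_trans _ _ (p^-1)%:E); last exact: ltry.
  rewrite -k01; apply: ge0_le_integral => //=.
  - by move=> t _; rewrite lee_fin; exact: f0.
  - by apply/measurable_EFinP; exact: measurable_funTS (measurable_powR _).
  - move=> t; rewrite /= in_itv/= => /andP[t0 t1].
    rewrite lee_fin /f ler_piMr ?powR_ge0// -expR0 ler_expR; lra.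
apply: (@le_lt_trans _ _ (\int[mu]_(t in `[1%R, +oo[) (expR (- t))%:E)%E).
  apply: ge0_le_integral => //=.
  - by move=> t _; rewrite lee_fin; exact: f0.
  - apply/measurable_EFinP; apply: measurable_funTS.
    apply: (measurableT_comp (@measurable_expR R)); exact: oppr_measurable.
  - move=> t; rewrite /= in_itv/= => /andP[t1 _].
    rewrite lee_fin /f ler_piMl ?expR_ge0//.
    have := @powR_le_neg (p - 1) 1 t; rewrite powR1; apply => //; lra.
have dexp (x : R) : is_derive x 1 (fun t => - expR (- t)) (expR (- x)).
  have h1 : is_derive x 1 (-%R : R -> R) (-1) by apply: is_deriveNid.
  have h2 := is_deriveN (@is_derive1_comp _ expR -%R x _ _ (is_derive_expR (- x)) h1).
  by apply: (is_derive_eq h2); rewrite mulrN1 opprK.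
rewrite (@ge0_continuous_FTC2y _ _ (fun t => - expR (- t)) 1 0) ?ltry//.
- apply: continuous_subspaceT => x; apply: (@continuous_comp _ _ _ -%R).
    exact: opp_continuous.
  exact: continuous_expR.
- by rewrite -oppr0; apply: cvgN; exact: cvgr_expR.
- have /derivable1_diffP/differentiable_continuous h := @ex_derive _ _ _ _ _ _ _ (dexp 1).
  exact: cvg_at_right_filter h.
- by move=> x _; rewrite derive1E; apply: derive_val.
Qed.

End PowerKernel.

(** * Scalar fractional integrals *)

Section FractionalIntegral.
Context {R : realType} (al : R) (al01 : 0 < al < 1).
Notation mu := (@lebesgue_measure R).
Implicit Types (g : R -> R).

(* Gamma(al) times J^al g *)
Definition Jint g (t : R) : R :=
  \int[mu]_(s in `]0, t[) ((t - s) `^ (al - 1) * g s).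

Let al0 : 0 < al.
Proof. by case/andP : al01. Qed.

Lemma Jint_integrable g (t M : R) : measurable_fun `]0, t[ g ->
  (forall s, 0 < s < t -> `|g s| <= M) ->
  mu.-integrable `]0, t[ (EFin \o (fun s => (t - s) `^ (al - 1) * g s)).
Proof.
move=> mg gM.
apply: (@integrable_dominated _ _ _ (fun s => M * (t - s) `^ (al - 1))) => //.
- by apply: measurable_funM => //; exact: measurable_powR_subr.
- move=> s; rewrite /= in_itv/= => /gM h.
  by rewrite normrM ger0_norm ?powR_ge0// mulrC ler_wpM2r ?powR_ge0.
- by apply: integrable_scale => //; exact: integrable_powR_subr.
Qed.

Lemma Jint_cst (M t : R) : 0 <= t -> Jint (fun=> M) t = M * t `^ al / al.
Proof.
move=> t0; rewrite /Jint RintegralZr//; last exact: integrable_powR_subr.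
by rewrite Rintegral_powR_subr// subr0 subrr powR0 ?gt_eqF// subr0 mulrC mulrA.
Qed.

Lemma le_Jint g1 g2 (t M : R) : measurable_fun `]0, t[ g1 ->
  measurable_fun `]0, t[ g2 ->
  (forall s, 0 < s < t -> `|g1 s| <= M) -> (forall s, 0 < s < t -> `|g2 s| <= M) ->
  (forall s, 0 < s < t -> g1 s <= g2 s) -> Jint g1 t <= Jint g2 t.
Proof.
move=> m1 m2 b1 b2 g12; apply: le_Rintegral => //.
- exact: Jint_integrable b1.
- exact: Jint_integrable b2.
- move=> s; rewrite /= in_itv/= => /g12 h.
  by rewrite ler_wpM2l ?powR_ge0.
Qed.

Lemma Jint_bound g (t M : R) : 0 <= t -> measurable_fun `]0, t[ g ->
  (forall s, 0 < s < t -> `|g s| <= M) -> `|Jint g t| <= M * t `^ al / al.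
Proof.
move=> t0 mg gM; rewrite -Jint_cst//.
have ig := Jint_integrable mg gM.
apply: le_trans (le_normr_Rintegral _ ig) _ => //.
apply: le_Rintegral => //.
- exact: integrable_norm.
- apply: (@Jint_integrable _ _ `|M|) => //; exact: measurable_cst.
- move=> s; rewrite /= in_itv/= => /gM h.
  by rewrite normrM ger0_norm ?powR_ge0// ler_wpM2l ?powR_ge0.
Qed.

Lemma JintD g1 g2 (t M : R) : measurable_fun `]0, t[ g1 ->
  measurable_fun `]0, t[ g2 ->
  (forall s, 0 < s < t -> `|g1 s| <= M) -> (forall s, 0 < s < t -> `|g2 s| <= M) ->
  Jint (fun s => g1 s + g2 s) t = Jint g1 t + Jint g2 t.
Proof.
move=> m1 m2 b1 b2.
rewrite /Jint -RintegralD//; [|exact: Jint_integrable b1|exact: Jint_integrable b2].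
by apply: eq_Rintegral => s _; rewrite mulrDr.
Qed.

Lemma JintZ g (k t M : R) : measurable_fun `]0, t[ g ->
  (forall s, 0 < s < t -> `|g s| <= M) ->
  Jint (fun s => k * g s) t = k * Jint g t.
Proof.
move=> mg gM; rewrite /Jint -RintegralZl//; last exact: Jint_integrable gM.
by apply: eq_Rintegral => s _; rewrite mulrCA.
Qed.

Lemma eq_Jint g1 g2 t : (forall s, 0 < s < t -> g1 s = g2 s) ->
  Jint g1 t = Jint g2 t.
Proof.
move=> h; apply: eq_Rintegral => s /set_mem; rewrite /= in_itv/= => st.
by rewrite h.
Qed.

Lemma Jint0 g : Jint g 0 = 0.
Proof. by rewrite /Jint set_itvoo0 Rintegral_set0. Qed.

(** Split at t'. On ]0, t'[ the kernel decreases from (t' - s)^(al-1) to (t - s)^(al-1), so the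
    difference has a fixed sign and mass (t'^al - t^al + (t - t')^al) / al, at most (t - t')^al /
    al. The new piece ]t', t[ carries exactly this last mass, whence the factor 2. *)
Lemma Jint_holder g (t t' M : R) : 0 <= t' -> t' <= t -> measurable_fun `]0, t[ g ->
  (forall s, 0 < s < t -> `|g s| <= M) ->
  `|Jint g t - Jint g t'| <= 2 * M * (t - t') `^ al / al.
Proof.
move=> t0 tt' mg gM.
have [h|t'0] := leP t' 0.
  have -> : t' = 0 by lra.
  have M0 : 0 <= M * t `^ al / al.
    rewrite (le_trans _ (Jint_bound (le_trans t0 tt') mg gM))//.
  rewrite Jint0 !subr0 (le_trans (Jint_bound (le_trans t0 tt') mg gM))//; lra.
have [->|] := eqVneq t' t.
  by rewrite !subrr normr0 powR0 ?gt_eqF// mulr0 mul0r.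
move=> ne; have {ne tt'} tt' : t' < t by rewrite lt_neqAle ne tt'.
have M0 : 0 <= M.
  by apply: le_trans (gM (t / 2) _) => //; lra.
have mg' : measurable_fun `]0, t'[ g.
  by apply: measurable_funS mg => // s; rewrite /= !in_itv/=; lra.
have gM' s : 0 < s < t' -> `|g s| <= M by move=> h; apply: gM; lra.
have ig := Jint_integrable mg gM.
have ig' := Jint_integrable mg' gM'.
have ig1 : mu.-integrable `]0, t'[ (EFin \o (fun s => (t - s) `^ (al - 1) * g s)).
  by apply: integrableS ig => //= s; rewrite /= !in_itv/=; lra.
have ig2 : mu.-integrable `]t', t[ (EFin \o (fun s => (t - s) `^ (al - 1) * g s)).
  by apply: integrableS ig => //= s; rewrite /= !in_itv/=; lra.
have ik1 : mu.-integrable `]0, t'[ (EFin \o (fun s => (t - s) `^ (al - 1))).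
  by apply: integrable_powR_subr => //; exact: ltW.
have ik1' : mu.-integrable `]0, t'[ (EFin \o (fun s => (t' - s) `^ (al - 1))).
  exact: integrable_powR_subr.
have ik2 : mu.-integrable `]t', t[ (EFin \o (fun s => (t - s) `^ (al - 1))).
  exact: integrable_powR_subr.
rewrite /Jint (Rintegral_itvoo_split t0 (ltW tt') ig) addrAC -RintegralB//.
have p0 : t' `^ al <= t `^ al by apply: powR_le_pos (ltW al0) t0 (ltW tt').
have -> : 2 * M * (t - t') `^ al / al =
    M * ((t - t') `^ al / al) + M * ((t - t') `^ al / al) by lra.
apply: le_trans (ler_normD _ _) _; apply: lerD.
  apply: le_trans (le_normr_Rintegral _ _) _ => //; first exact: integrable_sub.
  have e : \int[mu]_(s in `]0, t'[) (M * ((t' - s) `^ (al - 1) - (t - s) `^ (al - 1)))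
      = M * ((t' `^ al - (t `^ al - (t - t') `^ al)) / al).
    rewrite RintegralZl ?RintegralB//; last exact: integrable_sub.
    rewrite !Rintegral_powR_subr//; last exact: ltW.
    by rewrite !subr0 subrr powR0 ?gt_eqF//; ring.
  apply: (@le_trans _ _
    (M * ((t' `^ al - (t `^ al - (t - t') `^ al)) / al))); last first.
    rewrite ler_wpM2l// ler_wpM2r ?invr_ge0 ?(ltW al0)//; lra.
  rewrite -e; apply: le_Rintegral => //.
  - by apply: integrable_norm; exact: integrable_sub.
  - by apply: integrable_scale => //; exact: integrable_sub.
  - move=> s; rewrite /= in_itv/= => st; rewrite -mulrBl normrM mulrC.
    have h : (t - s) `^ (al - 1) <= (t' - s) `^ (al - 1).
      by case/andP : al01 => _ al1; apply: powR_le_neg; lra.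
    rewrite [X in _ * X <= _]ler0_norm ?subr_le0// opprB ler_wpM2r ?subr_ge0//.
    by apply: gM'.
apply: le_trans (le_normr_Rintegral _ _) _ => //.
have -> : M * ((t - t') `^ al / al) = \int[mu]_(s in `]t', t[) (M * (t - s) `^ (al - 1)).
  rewrite RintegralZl// Rintegral_powR_subr ?(ltW tt')//.
  by rewrite subrr powR0 ?gt_eqF// subr0.
apply: le_Rintegral => //.
- exact: integrable_norm.
- exact: integrable_scale.
- move=> s; rewrite /= in_itv/= => st.
  rewrite normrM ger0_norm ?powR_ge0// mulrC ler_wpM2r ?powR_ge0//.
  by apply: gM; lra.
Qed.

Lemma powR_le_expR (b y : R) : 0 < b <= 1 -> 0 <= y -> y `^ b <= expR y.
Proof.
move=> b01 y0; apply: le_trans (expR_ge1Dx y).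
have [y1|y1] := leP y 1.
  apply: (@le_trans _ _ 1); last lra.
  by have := @powR_le_pos R b y 1; rewrite powR1; apply => //; lra.
have := ler1_powR (ltW y1) (proj2 (andP b01)); lra.
Qed.

(** A large exponent om makes the fractional integral small relative to exp(om t). Half of the
    integrability is given up: with b = al / 2, (om (t - s))^b <= exp(om (t - s)) leaves the
    integrable kernel (t - s)^(b-1) and a gain om^(-b). *)
Lemma Jint_expR (T theta : R) : 0 < T -> 0 < theta -> exists2 om, 0 < om &
  forall t, 0 <= t <= T -> Jint (fun s => expR (om * s)) t <= theta * expR (om * t).
Proof.
move=> T0 th0; pose b := al / 2; have b0 : 0 < b by rewrite divr_gt0.
have b1 : b <= 1 by rewrite ler_pdivrMr//; case/andP : al01 => *; lra.
(* [z] will be om^b; it is the value for which the remaining mass T^b / b, divided by om^b, equals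
   theta. *)
pose z := T `^ b / b / theta.
have z0 : 0 < z by rewrite !divr_gt0// powR_gt0.
pose om := z `^ (b^-1); have om0 : 0 < om by rewrite powR_gt0.
have omb : om `^ b = z by rewrite /om -powRrM mulVf ?powRr1 ?gt_eqF// ltW.
exists om => // t /andP[t0 tT].
pose C := expR (om * t) / z.
have C0 : 0 < C by rewrite divr_gt0// expR_gt0.
have me (D : set (measurableTypeR R)) : measurable_fun D (fun s : R => expR (om * s)).
  apply: measurable_funTS; apply: (measurableT_comp (@measurable_expR R)).
  by apply: measurable_funM; [exact: measurable_cst|exact: measurable_id].
have ib : mu.-integrable `]0, t[ (EFin \o (fun s => (t - s) `^ (b - 1))).
  exact: integrable_powR_subr.
apply: (@le_trans _ _ (\int[mu]_(s in `]0, t[) (C * (t - s) `^ (b - 1)))).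
  apply: le_Rintegral => //.
  - apply: (@Jint_integrable _ _ (expR (om * t))) => [|s st]; first exact: me.
    rewrite ger0_norm ?expR_ge0// ler_expR ler_wpM2l ?(ltW om0)//; lra.
  - exact: integrable_scale.
  - move=> s; rewrite /= in_itv/= => st.
  have ts : 0 < t - s by lra.
  have -> : C * (t - s) `^ (b - 1) =
      (t - s) `^ (al - 1) * (expR (om * t) / (om * (t - s)) `^ b).
    rewrite powRM ?(ltW om0) ?(ltW ts)// omb /C.
    have -> : al - 1 = (b - 1) + b by rewrite /b; lra.
    rewrite (@powRD _ _ (b - 1) b); last by rewrite (gt_eqF ts) implybT.
    by field; rewrite !gt_eqF// powR_gt0.
  rewrite ler_wpM2l ?powR_ge0//.
  have -> : om * t = om * s + om * (t - s) by lra.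
  rewrite expRD -mulrA ler_peMr ?expR_ge0//.
  rewrite ler_pdivlMr ?mul1r ?powR_gt0 ?mulr_gt0//.
  by apply: powR_le_expR; [rewrite b0|rewrite mulr_ge0// ltW].
rewrite RintegralZl// Rintegral_powR_subr// subr0 subrr powR0 ?gt_eqF// subr0.
have -> : theta * expR (om * t) = C * (T `^ b / b).
  by rewrite /C /z; field; rewrite !gt_eqF// powR_gt0.
rewrite ler_wpM2l ?(ltW C0)// ler_wpM2r ?invr_ge0 ?(ltW b0)//.
by apply: powR_le_pos; lra.
Qed.

Lemma measurable_expR_scale (om : R) (D : set (measurableTypeR R)) :
  measurable_fun D (fun s : R => expR (om * s)).
Proof.
apply: measurable_funTS; apply: (measurableT_comp (@measurable_expR R)).
by apply: measurable_funM; [exact: measurable_cst|exact: measurable_id].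
Qed.

(** Let S be the supremum of exp(-om t) y(t). Taking theta = 1 / (2 (beta + 1)) in the weighted
    bound gives S <= A + S / 2, hence S <= 2 A and C = 2 exp(om T). The bound M only makes S finite
    and does not enter C. *)
Lemma Jint_gronwall (T beta : R) : 0 < T -> 0 <= beta -> exists2 C, 0 < C &
  forall (y : R -> R) (A M : R), measurable_fun `]0, T[ y -> 0 <= A ->
    (forall t, 0 <= t <= T -> 0 <= y t <= M) ->
    (forall t, 0 <= t <= T -> y t <= A + beta * Jint y t) ->
    forall t, 0 <= t <= T -> y t <= C * A.
Proof.
move=> T0 b0; have th0 : 0 < (2 * (beta + 1))^-1 by rewrite invr_gt0; lra.
have [om om0 hom] := Jint_expR T0 th0.
exists (2 * expR (om * T)); first by rewrite mulr_gt0// expR_gt0.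
move=> y A M my A0 yM hy.
pose E := [set expR (- (om * t)) * y t | t in `[0, T]%classic].
have E0 : E (expR (- (om * 0)) * y 0) by exists 0 => //=; rewrite in_itv/= lexx ltW.
have Eub : has_sup E.
  split; first by exists (expR (- (om * 0)) * y 0).
  exists M => _ [t /= tT <-]; rewrite in_itv/= in tT.
  have /andP[y0 ym] := yM _ tT.
  apply: le_trans ym; rewrite ler_piMl// -expR0 ler_expR oppr_le0.
  by rewrite mulr_ge0 ?(ltW om0)//; case/andP : tT.
pose S := sup E.
have yS t : 0 <= t <= T -> y t <= S * expR (om * t).
  move=> tT; rewrite -ler_pdivrMr ?expR_gt0// mulrC -expRN.
  by apply: sup_upper_bound => //; exists t => //=; rewrite in_itv.
have S0 : 0 <= S.
  have /andP[y0 _] := yM 0 ltac:(by rewrite lexx ltW).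
  by have := yS 0 ltac:(by rewrite lexx ltW); rewrite mulr0 expR0 mulr1; lra.
have SA : S <= A + S / 2.
  apply: ge_sup; first by case: Eub.
  move=> _ [t /= + <-]; rewrite in_itv/= => tT.
  have e1 : expR (- (om * t)) <= 1.
    rewrite -expR0 ler_expR oppr_le0.
    by rewrite mulr_ge0 ?(ltW om0)//; case/andP : tT.
  have e2 : expR (- (om * t)) * expR (om * t) = 1 by rewrite -expRD addrC subrr expR0.
  have h1 : Jint y t <= S * Jint (fun s => expR (om * s)) t.
    rewrite -(JintZ _ (M := expR (om * T))); last 2 first.
    - exact: measurable_expR_scale.
    - move=> s st; rewrite ger0_norm ?expR_ge0// ler_expR ler_wpM2l ?(ltW om0)//; lra.
    apply: (@le_Jint _ _ _ (M + S * expR (om * T))).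
    - by apply: measurable_funS my => // s; rewrite /= !in_itv/=; lra.
    - by apply: measurable_funM; [exact: measurable_cst|exact: measurable_expR_scale].
    - move=> s st; have /yM/andP[y0 ym] : 0 <= s <= T by lra.
      rewrite ger0_norm// (le_trans ym)// lerDl mulr_ge0// expR_ge0.
    - move=> s st; rewrite ger0_norm ?mulr_ge0 ?expR_ge0//.
      have M0 : 0 <= M by have := yM s; lra.
      rewrite ler_wpDl// ler_wpM2l// ler_expR ler_wpM2l ?(ltW om0)//; lra.
    - by move=> s st; apply: yS; lra.
  have h2 : beta * Jint y t <= S / 2 * expR (om * t).
    apply: (@le_trans _ _ (beta * (S * ((2 * (beta + 1))^-1 * expR (om * t))))).
      by rewrite ler_wpM2l// (le_trans h1)// ler_wpM2l// hom.
    have -> : beta * (S * ((2 * (beta + 1))^-1 * expR (om * t))) =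
       (S / 2 * expR (om * t)) * (beta / (beta + 1)) by field; lra.
    rewrite ler_piMr//; first by rewrite mulr_ge0 ?expR_ge0//; lra.
    by rewrite ler_pdivrMr; lra.
  have h3 := hy _ tT.
  apply: (@le_trans _ _ (expR (- (om * t)) * (A + S / 2 * expR (om * t)))).
    rewrite ler_wpM2l ?expR_ge0//; lra.
  rewrite mulrDr mulrCA e2 mulr1 lerD2r.
  by rewrite ler_piMl.
move=> t tT; apply: le_trans (yS _ tT) _.
apply: (@le_trans _ _ (2 * A * expR (om * t))).
  rewrite ler_wpM2r ?expR_ge0//; lra.
rewrite mulrAC ler_wpM2r// ler_wpM2l// ler_expR ler_wpM2l ?(ltW om0)//; lra.
Qed.

End FractionalIntegral.

(** * Fubini on the triangle 0 < s < t < tau *)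

Section ConvolutionFubini.
Context {R : realType}.
Notation mu := (@lebesgue_measure R).
Context (tau C : R) (g p q c : R -> R).
Hypotheses (ig : mu.-integrable `]0, tau[ (EFin \o g))
  (mp : measurable_fun (setT : set (measurableTypeR R)) p)
  (mq : measurable_fun (setT : set (measurableTypeR R)) q)
  (p0 : forall t, 0 <= p t) (q0 : forall t, 0 <= q t)
  (hc : forall s, 0 < s < tau ->
     (\int[mu]_(t in `]s, tau[) (p t * q (t - s))%:E = (c s)%:E)%E)
  (cC : forall s, 0 < s < tau -> c s <= C).

Let g_ := g \_ `]0, tau[.
Let p_ := p \_ `]-oo, tau[.
Let q_ := q \_ `]0, +oo[.
(** Extension by zero places the integrand on the whole plane: [g_] enforces 0 < s, [q_] enforces s
    < t and [p_] enforces t < tau. Two weights are kept because the singular kernel is needed both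
    as q(t - s) with p = 1, for the adjoint of the fractional derivative, and as p with q = 1, for
    primitives. *)
Let H (z : R * R) : R := p_ z.1 * q_ (z.1 - z.2) * g_ z.2.

Let mg_ : measurable_fun (setT : set (measurableTypeR R)) g_.
Proof.
apply: (measurable_restrictT g (measurable_itv `]0, tau[)).1.
exact: integrable_measurable ig.
Qed.

Let mp_ : measurable_fun (setT : set (measurableTypeR R)) p_.
Proof.
apply: (measurable_restrictT p (measurable_itv `]-oo, tau[)).1.
exact: measurable_funTS.
Qed.

Let mq_ : measurable_fun (setT : set (measurableTypeR R)) q_.
Proof.
apply: (measurable_restrictT q (measurable_itv `]0, +oo[)).1.
exact: measurable_funTS.
Qed.

Let mH : measurable_fun setT (EFin \o H).
Proof.
apply/measurable_EFinP; apply: measurable_funM.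
  apply: measurable_funM.
    exact: (measurableT_comp mp_ measurable_fst).
  apply: (measurableT_comp mq_).
  by apply: measurable_funB; [exact: measurable_fst|exact: measurable_snd].
exact: (measurableT_comp mg_ measurable_snd).
Qed.

Let HtE t : 0 < t < tau -> (fun s => H (t, s)) =
  (fun s => p t * q (t - s) * g s) \_ `]0, t[.
Proof.
move=> ht; apply/funext => s; rewrite /H /p_ /q_ /g_ !patchE /=.
have -> : t \in `]-oo, tau[%classic.
  by apply/mem_set; rewrite /= in_itv/=; lra.
case: ifPn => [/set_mem|]; rewrite ?notin_setE /= in_itv/= => h1;
  case: ifPn => [/set_mem|]; rewrite ?notin_setE /= in_itv/= => h2;
  case: ifPn => [/set_mem|]; rewrite ?notin_setE /= in_itv/= => h3 //;
  rewrite ?mulr0 ?mul0r//; exfalso; lra.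
Qed.

Let HsE s : 0 < s < tau -> (fun t => H (t, s)) =
  (fun t => p t * q (t - s) * g s) \_ `]s, tau[.
Proof.
move=> hs; apply/funext => t; rewrite /H /p_ /q_ /g_ !patchE /=.
have -> : s \in `]0, tau[%classic.
  by apply/mem_set; rewrite /= in_itv/=; lra.
case: ifPn => [/set_mem|]; rewrite ?notin_setE /= in_itv/= => h1;
  case: ifPn => [/set_mem|]; rewrite ?notin_setE /= in_itv/= => h2;
  case: ifPn => [/set_mem|]; rewrite ?notin_setE /= in_itv/= => h3 //;
  rewrite ?mulr0 ?mul0r//; exfalso; lra.
Qed.

Let Hs0 s : ~ (0 < s < tau) -> (fun t => H (t, s)) = cst 0.
Proof.
move=> hs; apply/funext => t; rewrite /H /g_ !patchE /=.
case: ifPn => [/set_mem|]; last by rewrite mulr0.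
by rewrite /= in_itv/= => h; exfalso; lra.
Qed.

Let Ht0 t : ~ (0 < t < tau) -> (fun s => H (t, s)) = cst 0.
Proof.
move=> hs; apply/funext => s; rewrite /H /p_ /q_ /g_ !patchE /=.
case: ifPn => [/set_mem|]; rewrite ?notin_setE /= in_itv/= => h1;
  case: ifPn => [/set_mem|]; rewrite ?notin_setE /= in_itv/= => h2;
  case: ifPn => [/set_mem|]; rewrite ?notin_setE /= in_itv/= => h3 //;
  rewrite ?mulr0 ?mul0r//; exfalso; lra.
Qed.

Let mpq s (D : set (measurableTypeR R)) : measurable_fun D (fun t => p t * q (t - s)).
Proof.
apply: measurable_funTS; apply: measurable_funM => //.
apply: (measurableT_comp mq).
by apply: measurable_funB; [exact: measurable_id|exact: measurable_cst].
Qed.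

Let c0 s : 0 < s < tau -> 0 <= c s.
Proof.
move=> /hc h; rewrite -lee_fin -h; apply: integral_ge0 => t _.
by rewrite lee_fin mulr_ge0.
Qed.

Let intHs s : 0 < s < tau ->
  (\int[mu]_t (H (t, s))%:E = (c s * g s)%:E)%E.
Proof.
move=> hs.
transitivity (\int[mu]_(t in `]s, tau[) ((g s)%:E * (p t * q (t - s))%:E))%E.
  rewrite [RHS]integral_mkcond; apply: eq_integral => t _.
  have := congr1 (fun f => f t) (HsE hs); rewrite /= => ->.
  by rewrite !patchE; case: ifP => // _; rewrite -EFinM mulrC.
rewrite integralZl//; first by rewrite hc// -EFinM mulrC.
apply/integrableP; split; first by apply/measurable_EFinP; exact: mpq.
under eq_integral do rewrite /= ger0_norm ?mulr_ge0//.
by rewrite hc// ltry.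
Qed.

Let intHsabs s : 0 < s < tau ->
  (\int[mu]_t `|(H (t, s))%:E| = (c s * `|g s|)%:E)%E.
Proof.
move=> hs.
transitivity (\int[mu]_(t in `]s, tau[) (`|g s|%:E * (p t * q (t - s))%:E))%E.
  rewrite [RHS]integral_mkcond; apply: eq_integral => t _.
  have := congr1 (fun f => f t) (HsE hs); rewrite /= => ->.
  rewrite !patchE; case: ifP => // _; last by rewrite normr0.
  by rewrite normrM (ger0_norm (mulr_ge0 (p0 _) (q0 _))) -EFinM mulrC.
rewrite integralZl//; first by rewrite hc// -EFinM mulrC.
apply/integrableP; split; first by apply/measurable_EFinP; exact: mpq.
under eq_integral do rewrite /= ger0_norm ?mulr_ge0//.
by rewrite hc// ltry.
Qed.

(** By Tonelli, integrating |H| in t first leaves c(s) |g(s)|, which is dominated by the integrable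
    function |C| |g(s)|. *)
Let iH : (mu \x mu)%E.-integrable setT (EFin \o H).
Proof.
apply: (@integrable21ltyP _ _ _ _ R mu mu (EFin \o H) mH).2.
have ign : mu.-integrable `]0, tau[ (EFin \o (fun s => `|C| * `|g s|)).
  by apply: integrable_scale => //; exact: integrable_norm.
apply: (@le_lt_trans _ _ (\int[mu]_s
   `|((fun s => (`|C| * `|g s|)%:E) \_ `]0%R, tau[) s|)%E).
  apply: ge0_le_integral => //.
  - by move=> s _; apply: integral_ge0.
  - apply: (@measurable_fun_fubini_tonelli_G _ _ _ _ R mu (fun z => `|(H z)%:E|%E)) => //.
    by apply: measurableT_comp.
  - apply: measurableT_comp => //.
    apply: (measurable_restrictT _ (measurable_itv _)).1.
    exact: measurable_int ign.
  - move=> s _; rewrite patchE; case: ifPn => [/set_mem|].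
      rewrite /= in_itv/= => hs.
      rewrite intHsabs// lee_fin normrM !normr_id ler_wpM2r//.
      by rewrite (le_trans (cC hs))// ler_norm.
    rewrite notin_setE/= in_itv/= => hs.
    rewrite normr0; under eq_integral do
      rewrite (congr1 (fun f => f _) (Hs0 hs)) /= normr0.
    by rewrite integral0.
have /(integrable_restrict mu (measurable_itv `]0, tau[) measurableT) : mu.-integrable (setT `&` `]0, tau[) (EFin \o (fun s => `|C| * `|g s|)).
  by rewrite setTI.
by move=> /integrableP[].
Qed.

Let F1 t : 0 < t < tau -> (\int[mu]_s (H (t, s))%:E =
  \int[mu]_(s in `]0%R, t[) (p t * q (t - s) * g s)%:E)%E.
Proof.
move=> ht; rewrite [RHS]integral_mkcond; apply: eq_integral => s _.
have := congr1 (fun f => f s) (HtE ht); rewrite /= => ->.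
by rewrite !patchE; case: ifP.
Qed.

(** For g merely integrable the singular convolution converges only at almost every t. This is what
    permits evaluating J^alpha w against vectors when w is only square integrable. *)
Lemma convolution_integrable_ae : {ae mu, forall t, 0 < t < tau ->
  mu.-integrable `]0, t[ (EFin \o (fun s => p t * q (t - s) * g s))}.
Proof.
have := ae_integrable1 iH; apply: filterS => t /= h ht.
have : mu.-integrable (setT `&` `]0, t[) (EFin \o (fun s => p t * q (t - s) * g s)).
  apply/(integrable_restrict mu (measurable_itv `]0, t[) measurableT).
  apply: eq_integrable h => // s _.
  have := congr1 (fun f => f s) (HtE ht); rewrite /= => ->.
  by rewrite !patchE; case: ifP.
by rewrite setTI.
Qed.

Let iF : mu.-integrable `]0, tau[ (fubini_F mu (EFin \o H)).
Proof. by apply: integrableS (integrable_fubini_F iH). Qed.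

Let G t := \int[mu]_(s in `]0, t[) (p t * q (t - s) * g s).

Let GE t : 0 < t < tau -> G t = fine (fubini_F mu (EFin \o H) t).
Proof. by move=> ht; rewrite /fubini_F /= F1. Qed.

Lemma convolution_integrable : mu.-integrable `]0, tau[ (EFin \o G).
Proof.
have : mu.-integrable `]0, tau[ (EFin \o (fun t => fine (fubini_F mu (EFin \o H) t))).
  apply: (le_integrable _ _ _ iF) => //.
    apply/measurable_EFinP; apply: measurableT_comp => //.
    exact: measurable_int iF.
  by move=> t _ /=; case: (fubini_F _ _ _) => [r| |] //=; rewrite normr0 ?leey.
apply: eq_integrable => // t /set_mem; rewrite /= in_itv/= => ht.
by rewrite GE.
Qed.

Lemma convolution_Fubini : \int[mu]_(t in `]0, tau[) G t =
  \int[mu]_(s in `]0, tau[) (c s * g s).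
Proof.
have e1 : (\int[mu]_(t in `]0%R, tau[) (G t)%:E =
           \int[mu]_(t in `]0%R, tau[) fubini_F mu (EFin \o H) t)%E.
  apply: ae_eq_integral => //.
  - exact: measurable_int convolution_integrable.
  - exact: measurable_int iF.
  - have mI : measurable (`]0, tau[%classic : set (measurableTypeR R)) by [].
    apply: filterS (integrable_ae mI iF) => t h ht; have {}h := h ht.
    by move: ht; rewrite /= in_itv/= => ht; rewrite GE// fineK.
rewrite /Rintegral e1; congr fine.
have e2 : (\int[mu]_(t in `]0%R, tau[) fubini_F mu (EFin \o H) t =
           \int[mu]_t fubini_F mu (EFin \o H) t)%E.
  rewrite integral_mkcond; apply: eq_integral => t _.
  rewrite patchE; case: ifPn => //; rewrite notin_setE/= in_itv/= => ht.
  by rewrite /fubini_F/=; under eq_integral do rewrite (congr1 (fun f => f _) (Ht0 ht));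
    rewrite /= integral0.
rewrite e2 /fubini_F (Fubini iH) [RHS]integral_mkcond.
apply: eq_integral => s _; rewrite patchE; case: ifPn => [/set_mem|].
  by rewrite /= in_itv/= => hs; rewrite intHs.
rewrite notin_setE/= in_itv/= => hs.
under eq_integral do rewrite /= (congr1 (fun f => f _) (Hs0 hs)).
by rewrite /= integral0.
Qed.

End ConvolutionFubini.

(** * Quadratic inequality for Volterra equations *)

Section UniformContinuity.
Context {R : realType} (T : R).

Definition ucont {X : normedModType R} (f : R -> X) :=
  forall e : R, 0 < e -> exists2 d : R, 0 < d &
    forall s t, 0 <= s <= T -> 0 <= t <= T -> `|s - t| <= d -> `|f s - f t| <= e.

Lemma measurable_truncn_le (c : R) (m : nat) : 0 < c ->
  measurable ([set t | (Num.truncn (t * c) <= m)%N] : set (measurableTypeR R)).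
Proof.
move=> c0; rewrite (_ : [set t | _] = `]-oo, m.+1%:R / c[%classic).
  exact: measurable_itv.
by apply/seteqP; split => t /=; rewrite truncn_le_nat in_itv/= ltr_pdivlMr.
Qed.

Lemma finite_valued_minn (j : R -> nat) (K : nat) :
  (forall m, measurable ([set t | (j t <= m)%N] : set (measurableTypeR R))) ->
  finite_valued (fun t => minn (j t) K).
Proof.
move=> mj; have mm m : measurable ([set t | (minn (j t) K <= m)%N] : set (measurableTypeR R)).
  have [Km|mK] := leqP K m.
    rewrite (_ : [set t | _] = setT); first exact: measurableT.
    by apply/seteqP; split => t //= _; rewrite geq_min Km orbT.
  rewrite (_ : [set t | _] = [set t | (j t <= m)%N]); first exact: mj.
  by apply/seteqP; split => t /=; rewrite geq_min (leqNgt K) mK orbF.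
apply: (@finite_valued_nat _ _ K) => [t|m]; first exact: geq_minr.
case: m => [|m].
  rewrite (_ : _ @^-1` _ = [set t | (minn (j t) K <= 0)%N]); first exact: mm.
  by apply/seteqP; split => t /=; rewrite leqn0 => /eqP.
rewrite (_ : _ @^-1` _ = [set t | (minn (j t) K <= m.+1)%N] `\`
   [set t | (minn (j t) K <= m)%N]); first exact: measurableD.
apply/seteqP; split => t /=; first by move=> ->; rewrite leqnn ltnn.
by move=> [h1 /negP]; rewrite -ltnNge => h2; apply/eqP; rewrite eqn_leq h1.
Qed.

Lemma ucont_smeas {X : normedModType R} (f : R -> X) :
  ucont f -> smeas `]0, T[ f.
Proof.
move=> hf; apply/smeasP.
(* f is sampled at the grid point to the left of t with mesh 1 / (n + 1). The cap on the index
   leaves only finitely many values and is inactive for t < T. *)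
pose s (n : nat) (t : R) : X := f ((minn (Num.truncn (t * n.+1%:R)) (Num.truncn (T * n.+1%:R)))%:R / n.+1%:R).
exists s; split.
  move=> n; apply: (finite_valued_comp (fun i => f (i%:R / n.+1%:R))).
  by apply: finite_valued_minn => m; exact: measurable_truncn_le.
move=> t; rewrite /= in_itv/= => /andP[t0 tT].
apply/cvgrPdist_le => e e0; have [d d0 hd] := hf _ e0.
have /cvgrPdist_le/(_ _ d0) := @cvg_harmonic R; apply: filterS => n.
rewrite sub0r normrN /harmonic ger0_norm ?invr_ge0// => nd.
rewrite /s (minn_idPl _); last by rewrite le_truncn// ler_wpM2r// ltW.
have /truncn_itv/andP[h1 h2] : 0 <= t * n.+1%:R by rewrite mulr_ge0// ltW.
set i := Num.truncn _ in h1 h2 *.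
have n0 : (0 : R) < n.+1%:R by rewrite ltr0n.
have h3 : i%:R / n.+1%:R <= t by rewrite ler_pdivrMr.
have h4 : t - i%:R / n.+1%:R <= n.+1%:R^-1.
  rewrite lerBlDr -[X in X + _]mul1r -mulrDl ler_pdivlMr// nat1r; exact: ltW.
apply: hd.
- by rewrite (ltW t0) ltW.
- by rewrite divr_ge0//= (le_trans h3)// ltW.
- by rewrite ger0_norm ?subr_ge0// (le_trans h4).
Qed.

Lemma ucont_cst {X : normedModType R} (x : X) : ucont (fun=> x).
Proof. by move=> e e0; exists 1 => // s t _ _ _; rewrite subrr normr0 ltW. Qed.

Lemma ucontD {X : normedModType R} (f g : R -> X) :
  ucont f -> ucont g -> ucont (fun t => f t + g t).
Proof.
move=> hf hg e e0; have e2 : 0 < e / 2 by rewrite divr_gt0.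
have [d1 d10 h1] := hf _ e2; have [d2 d20 h2] := hg _ e2.
exists (Num.min d1 d2); first by rewrite lt_min d10.
move=> s t hs ht; rewrite le_min => /andP[k1 k2].
rewrite opprD addrACA (le_trans (ler_normD _ _))//.
have := h1 _ _ hs ht k1; have := h2 _ _ hs ht k2; lra.
Qed.

Lemma ucont_lip {X Y : normedModType R} (F : X -> Y) (L : R) (f : R -> X) :
  (forall x y, `|F x - F y| <= L * `|x - y|) -> ucont f ->
  ucont (fun t => F (f t)).
Proof.
move=> hF hf e e0; have L1 : 0 < `|L| + 1 by rewrite ltr_wpDl.
have [d d0 h] := hf _ (divr_gt0 e0 L1); exists d => // s t hs ht st.
apply: le_trans (hF _ _) _.
apply: (@le_trans _ _ ((`|L| + 1) * `|f s - f t|)).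
  by rewrite ler_wpM2r// (le_trans (ler_norm L))// lerDl.
by rewrite mulrC -ler_pdivlMr// h.
Qed.

Lemma ucont_limit {X : normedModType R} (f_ : nat -> R -> X) f :
  (forall n, ucont (f_ n)) ->
  (forall e : R, 0 < e -> exists n, forall t, 0 <= t <= T -> `|f_ n t - f t| <= e) ->
  ucont f.
Proof.
move=> hf hc e e0; have e3 : 0 < e / 3 by rewrite divr_gt0.
have [n hn] := hc _ e3; have [d d0 hd] := hf n _ e3.
exists d => // s t hs ht st.
have -> : f s - f t = (f_ n s - f_ n t) - (f_ n s - f s) + (f_ n t - f t).
  by rewrite opprB (addrC (f_ n s - f_ n t)) !subrKA.
have := hn _ hs; have := hn _ ht; have := hd _ _ hs ht st.
have := ler_normD (f_ n s - f_ n t - (f_ n s - f s)) (f_ n t - f t).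
have := ler_normB (f_ n s - f_ n t) (f_ n s - f s); lra.
Qed.

Lemma holder_ucont {X : normedModType R} (f : R -> X) (al L : R) : 0 < al ->
  (forall s t, 0 <= s -> s <= t -> t <= T -> `|f t - f s| <= L * (t - s) `^ al) ->
  ucont f.
Proof.
move=> al0 hf e e0; have L1 : 0 < `|L| + 1 by rewrite ltr_wpDl.
have e1 : 0 < e / (`|L| + 1) by rewrite divr_gt0.
exists ((e / (`|L| + 1)) `^ al^-1); first exact: powR_gt0.
move=> s t hs ht; wlog st : s t hs ht / s <= t.
  move=> H; have [|/ltW] := leP s t; first exact: H.
  by move=> ts h; rewrite distrC; apply: H => //; rewrite distrC.
rewrite distrC ger0_norm ?subr_ge0// distrC => h.
apply: (@le_trans _ _ ((`|L| + 1) * (t - s) `^ al)).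
  have [h1 h2] : 0 <= s /\ t <= T by lra.
  apply: le_trans (hf _ _ h1 st h2) _.
  by rewrite ler_wpM2r ?powR_ge0// (le_trans (ler_norm L))// lerDl.
rewrite mulrC -ler_pdivlMr//.
have -> : e / (`|L| + 1) = ((e / (`|L| + 1)) `^ al^-1) `^ al.
  by rewrite -powRrM mulVf ?gt_eqF// powRr1// ltW.
by apply: powR_le_pos; rewrite ?subr_ge0// ltW.
Qed.

End UniformContinuity.

(** * Discrete convolutions with log-convex weights *)

Section DiscreteConvolution.
Context {R : realType}.

(** Course-of-values recursion: [B n] tabulates the first n values, later tables agree with earlier
    ones, and the sequence is read off the diagonal. *)
Lemma strong_recursion (F : (nat -> R) -> nat -> R) :
  (forall f g n, (forall k, (k < n)%N -> f k = g k) -> F f n = F g n) ->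
  exists b, forall n, b n = F b n.
Proof.
move=> hF.
pose fix B n := if n is n'.+1 then
  fun k => if k == n' then F (B n') n' else B n' k else fun=> 0.
have Bst m n k : (k < n)%N -> (n <= m)%N -> B m k = B n k.
  move=> kn; elim: m => [|m ih]; first by rewrite leqn0 => /eqP ->.
  rewrite leq_eqVlt => /predU1P[->//|]; rewrite ltnS => nm /=.
  by rewrite ltn_eqF ?ih// (leq_trans kn).
exists (fun k => B k.+1 k) => n /=; rewrite eqxx.
by apply: hF => k kn; exact: (Bst n k.+1 k (ltnSn k) kn).
Qed.

Context (w : nat -> R) (w0 : forall n, 0 < w n)
  (wdec : forall m n, (m <= n)%N -> w n <= w m)
  (wlc : forall m n, (m <= n)%N -> w m.+1 * w n <= w m * w n.+1).

(* Kaluza: the reciprocal of a power series with log-convex coefficients has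
   nonpositive coefficients beyond the constant one. *)
Lemma kaluza : exists c : nat -> R,
  [/\ forall n, w n.+1 = \sum_(j < n.+1) c j * w (n - j)%N,
      forall n, 0 <= c n & forall n, \sum_(j < n) c j <= 1].
Proof.
have [|c hc] := @strong_recursion (fun c n =>
    (w n.+1 - \sum_(j < n) c j * w (n - j)%N) / w 0%N).
  move=> f g n fg; congr ((_ - _) / _); apply: eq_bigr => j _.
  by rewrite fg.
have rec n : w n.+1 = \sum_(j < n.+1) c j * w (n - j)%N.
  rewrite big_ord_recr/= subnn [c n]hc mulfVK ?gt_eqF//.
  by rewrite addrC subrK.
have c0 n : 0 <= c n.
  elim/ltn_ind: n => -[|n] ih.
    by rewrite hc big_ord0 subr0 divr_ge0 ?ltW.
  (* After multiplication by w (n + 1), the recursion for w (n + 1) turns the claim into a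
     comparison of sums with weights c j. Its terms are w (n + 1) w (n + 1 - j) <= w (n + 2) w (n -
     j), which is log-convexity. *)
  rewrite hc divr_ge0 ?(ltW (w0 _))// subr_ge0 -(ler_pM2l (w0 n.+1)).
  rewrite [leRHS](_ : _ = \sum_(j < n.+1) w n.+2 * (c j * w (n - j)%N)); last first.
    by rewrite -mulr_sumr -rec mulrC.
  rewrite mulr_sumr; apply: ler_sum => j _.
  have jn : (j <= n)%N by rewrite -ltnS.
  rewrite mulrCA [leRHS]mulrCA ler_wpM2l ?ih// subSn//.
  by rewrite mulrC [leRHS]mulrC wlc// (leq_trans (leq_subr _ _)).
exists c; split => // n; case: n => [|n]; first by rewrite big_ord0.
(* As w decreases, w n times the sum of the c j is at most the sum of c j w (n - j), which is w (n +
   1), hence at most w n. *)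
rewrite -(ler_pM2r (w0 n)) mul1r; apply: le_trans (wdec (leqnSn n)).
rewrite rec mulr_suml; apply: ler_sum => j _.
by rewrite ler_wpM2l// wdec// leq_subr.
Qed.

Lemma sum_triangle (c x : nat -> R) N :
  \sum_(j < N) c j * \sum_(i < (N - j)%N) w (N - j - i.+1)%N * x i =
  \sum_(i < N) (\sum_(j < (N - i)%N) c j * w (N - i - j.+1)%N) * x i.
Proof.
transitivity (\sum_(j < N) \sum_(i < N | (i < N - j)%N) c j * w (N - j - i.+1)%N * x i).
  apply: eq_bigr => j _; rewrite mulr_sumr.
  rewrite (big_ord_widen N (fun i => c j * (w (N - j - i.+1)%N * x i))) ?leq_subr//.
  by apply: eq_bigr => i _; rewrite mulrA.
rewrite (exchange_big_dep xpredT)//=; apply: eq_bigr => i _; rewrite mulr_suml.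
rewrite (big_ord_widen N (fun j => c j * w (N - i - j.+1)%N * x i)) ?leq_subr//.
apply: eq_big => [j|j _]; first by rewrite !ltn_subRL addnC.
by rewrite -!subnDA !addnS addnC.
Qed.

(** The inner sums on the right are the same convolution at the earlier indices N - j - 1. Only the
    newest value x N is left outside, so induction on N becomes possible. *)
Lemma convolution_recursion (c x : nat -> R) N :
  (forall n, w n.+1 = \sum_(j < n.+1) c j * w (n - j)%N) ->
  \sum_(i < N.+1) w (N - i)%N * x i = w 0%N * x N +
  \sum_(j < N) c j * \sum_(i < (N - j)%N) w (N - j - i.+1)%N * x i.
Proof.
move=> rec; rewrite big_ord_recr/= subnn addrC; congr (_ + _).
rewrite sum_triangle; apply: eq_bigr => i _; congr (_ * _).
have -> : (N - i)%N = (N - i).-1.+1 by rewrite prednK// subn_gt0.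
by rewrite rec; apply: eq_bigr => j _; rewrite subSS.
Qed.

Context {X : completeNormedModType R} (dot : {dot X for @idfun R})
  (hdot : forall x, dot x x = `|x| ^+ 2).

(* Discrete Alikhanov inequality: inverting the convolution with the Kaluza
   coefficients, each new value is compared with a convex combination of [a]
   and the earlier ones. *)
Lemma discrete_convolution_sqr (f d : nat -> X) (a : X) :
  (forall N y, dot (d N) y =
     dot a y + \sum_(i < N.+1) w (N - i)%N * dot (f i) y) ->
  forall N, `|d N| ^+ 2 <=
     `|a| ^+ 2 + 2 * \sum_(i < N.+1) w (N - i)%N * dot (f i) (d i).
Proof.
move=> hd; have [c [rec c0 c1]] := kaluza.
elim/ltn_ind => N ih.
rewrite (convolution_recursion (fun i => dot (f i) (d i)) N rec).
have hw : w 0%N * dot (f N) (d N) = `|d N| ^+ 2 - dot a (d N) -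
    \sum_(j < N) c j * (dot (d (N - j.+1)%N) (d N) - dot a (d N)).
  have := hd N (d N).
  rewrite (convolution_recursion (fun i => dot (f i) (d N)) N rec) hdot => ->.
  rewrite [X in _ = _ - X](_ : _ = \sum_(j < N) c j *
    \sum_(i < (N - j)%N) w (N - j - i.+1)%N * dot (f i) (d N)); first by ring.
  apply: eq_bigr => j _; congr (_ * _); rewrite hd addrC addKr.
  rewrite (subnSK (ltn_ord j)); apply: eq_bigr => i _.
  by rewrite -!subnDA addSnnS.
have hi : \sum_(j < N) c j * (`|d (N - j.+1)%N| ^+ 2 - `|a| ^+ 2) <=
  2 * \sum_(j < N) c j *
    \sum_(i < (N - j)%N) w (N - j - i.+1)%N * dot (f i) (d i).
  rewrite mulr_sumr; apply: ler_sum => j _; rewrite mulrCA ler_wpM2l//.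
  have h : (N - j.+1 < N)%N by rewrite ltn_subrL/=; case: N j {ih hw} => // -[].
  have := ih _ h; rewrite subnSK//.
  rewrite [X in _ -> _ <= 2 * X](_ : _ =
    \sum_(i < (N - j)%N) w (N - j.+1 - i)%N * dot (f i) (d i)); first by lra.
  by apply: eq_bigr => i _; rewrite -!subnDA addSnnS.
(* With s the sum of the c j, d N equals w 0 f N + (1 - s) a + sum of c j d (N - j - 1). Pairing
   with d N and applying the arithmetic-geometric inequality to each term gives the claim; s <= 1 is
   what makes the coefficient of a nonnegative. *)
have key : `|d N| ^+ 2 - `|a| ^+ 2 <= 2 * (w 0%N * dot (f N) (d N)) +
    \sum_(j < N) c j * (`|d (N - j.+1)%N| ^+ 2 - `|a| ^+ 2); last by lra.
rewrite hw.
have AM := dot_AMGM hdot.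
have S1 : \sum_(j < N) c j * (dot (d (N - j.+1)%N) (d N) - dot a (d N)) <=
   \sum_(j < N) c j * ((`|d (N - j.+1)%N| ^+ 2 + `|d N| ^+ 2) / 2 - dot a (d N)).
  apply: ler_sum => j _; rewrite ler_wpM2l// lerD2r ler_pdivlMr// mulrC.
  exact: AM.
pose s := \sum_(j < N) c j.
have S2 : \sum_(j < N) c j * ((`|d (N - j.+1)%N| ^+ 2 + `|d N| ^+ 2) / 2 - dot a (d N)) =
  (\sum_(j < N) c j * (`|d (N - j.+1)%N| ^+ 2 - `|a| ^+ 2)) / 2 +
  s * (`|a| ^+ 2 / 2 + `|d N| ^+ 2 / 2 - dot a (d N)).
  rewrite /s !mulr_suml -big_split/=; apply: eq_bigr => j _; lra.
have s1 : s <= 1 by exact: c1.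
have : 0 <= (1 - s) * (`|a| ^+ 2 / 2 + `|d N| ^+ 2 / 2 - dot a (d N)).
  by rewrite mulr_ge0 ?subr_ge0//; have := AM a (d N); lra.
move: S1; rewrite S2; move: (\sum_(j < N) _) (\sum_(j < N) _) => A B.
rewrite mulrBl mul1r; lra.
Qed.

End DiscreteConvolution.

(** * Riemann sums for the singular kernel *)

Section RiemannSums.
Context {R : realType} (al : R) (al01 : 0 < al < 1).
Notation mu := (@lebesgue_measure R).
Let al0 : 0 < al. Proof. by case/andP : al01. Qed.

(* Rectangle rule for the kernel t^(al-1) on a grid of step h, sampled at the
   right end points to avoid the singularity. *)
Definition kweight (h : R) (j : nat) : R := h * (j.+1%:R * h) `^ (al - 1).

Section Step.
Context (h : R) (h0 : 0 < h).
Let p1 : al - 1 <= 0. Proof. by case/andP : al01 => _ ?; lra. Qed.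
Let jh j : 0 < j.+1%:R * h. Proof. by rewrite mulr_gt0// ltr0n. Qed.

Lemma kweight_gt0 n : 0 < kweight h n.
Proof. by rewrite mulr_gt0// powR_gt0. Qed.

Lemma kweight_dec m n : (m <= n)%N -> kweight h n <= kweight h m.
Proof.
move=> mn; rewrite ler_wpM2l ?(ltW h0)//; apply: powR_le_neg => //.
by rewrite ler_wpM2r ?(ltW h0)// ler_nat.
Qed.

(** The exponent is nonpositive, so the claim reduces to (m + 1) (n + 2) <= (m + 2) (n + 1), that is
    m <= n. *)
Lemma kweight_log_convex m n : (m <= n)%N ->
  kweight h m.+1 * kweight h n <= kweight h m * kweight h n.+1.
Proof.
move=> mn; rewrite /kweight.
have r x y : (h * x) * (h * y) = h ^+ 2 * (x * y) by ring.
rewrite !r ler_wpM2l ?sqr_ge0//.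
rewrite -!powRM ?(ltW (jh _))//; apply: powR_le_neg => //; first exact: mulr_gt0.
have e i j : i.+1%:R * h * (j.+1%:R * h) = (i.+1 * j.+1)%:R * h ^+ 2 :> R.
  by rewrite natrM; ring.
by rewrite !e ler_wpM2r ?sqr_ge0// ler_nat mulnS [leqRHS]mulSn leq_add2r ltnS.
Qed.

Context (M : nat).
Let tau := M.+1%:R * h.

Let kM i : (i <= M)%N -> kweight h (M - i)%N = h * (tau - i%:R * h) `^ (al - 1).
Proof.
by move=> iM; rewrite /kweight -subSn// natrB ?leqW// mulrBl.
Qed.

Let cell_cst (C : R) i :
  \int[mu]_(s in `](i%:R * h), (i.+1%:R * h)[) C = C * h.
Proof.
rewrite Rintegral_cst//= lebesgue_measure_itv/= lte_fin ltr_pM2r// ltr_nat ltnSn.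
by rewrite -EFinB/= -mulrBl -natrB// subSnn mul1r.
Qed.

Let icst (C : R) i :
  mu.-integrable `](i%:R * h), (i.+1%:R * h)[ (EFin \o (fun=> C)).
Proof.
apply: (@integrable_bounded _ _ _ `|C|) => //; exact: lebesgue_itvoo_lty.
Qed.

Let ik i : (i <= M)%N ->
  mu.-integrable `](i%:R * h), (i.+1%:R * h)[ (EFin \o (fun s => (tau - s) `^ (al - 1))).
Proof.
by move=> iM; apply: integrable_powR_subr => //; rewrite ler_wpM2r ?(ltW h0)// ler_nat.
Qed.

Let kc i := \int[mu]_(s in `](i%:R * h), (i.+1%:R * h)[) (tau - s) `^ (al - 1).

Let le_kc i : (i <= M)%N -> kweight h (M - i)%N <= kc i.
Proof.
move=> iM; rewrite kM// mulrC -(cell_cst ((tau - i%:R * h) `^ (al - 1)) i).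
apply: le_Rintegral => //; first exact: ik.
move=> s; rewrite /= in_itv/= => /andP[s1 s2].
have s3 : i.+1%:R * h <= tau by rewrite ler_wpM2r ?(ltW h0)// ler_nat.
by apply: powR_le_neg => //; lra.
Qed.

Let kc_le i : (i < M)%N -> kc i <= kweight h (M - i.+1)%N.
Proof.
move=> iM; rewrite kM// mulrC -(cell_cst ((tau - i.+1%:R * h) `^ (al - 1)) i).
apply: le_Rintegral => //.
  exact/ik/ltnW.
move=> s; rewrite /= in_itv/= => /andP[s1 s2].
have s3 : i.+1%:R * h < tau by rewrite ltr_pM2r// ltr_nat.
by apply: powR_le_neg => //; lra.
Qed.

Let split (f : R -> R) m : (m <= M)%N -> mu.-integrable `]0, tau[ (EFin \o f) ->
  \int[mu]_(s in `]0, (m.+1%:R * h)[) f s =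
  \int[mu]_(s in `]0, (m%:R * h)[) f s +
  \int[mu]_(s in `](m%:R * h), (m.+1%:R * h)[) f s.
Proof.
move=> mM hf; apply: Rintegral_itvoo_split.
- by rewrite mulr_ge0// ltW.
- by rewrite ler_wpM2r ?(ltW h0)// ler_nat.
- apply: integrableS hf => //; apply: subset_itvl.
  by rewrite bnd_simp ler_wpM2r ?(ltW h0)// ler_nat.
Qed.

Let I m := \int[mu]_(s in `]0, (m%:R * h)[) (tau - s) `^ (al - 1).

Let IS m : (m <= M)%N -> I m.+1 = I m + kc m.
Proof. by move=> mM; apply: split => //; exact: integrable_powR_subr. Qed.

Let I0 : I 0 = 0.
Proof. by rewrite /I mul0r set_itvoo0 Rintegral_set0. Qed.

Let IM : I M.+1 = tau `^ al / al.
Proof.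
rewrite /I -/tau Rintegral_powR_subr//; last by rewrite ltW// jh.
by rewrite subr0 subrr powR0 ?gt_eqF// subr0.
Qed.

Lemma sum_kweight_le : \sum_(i < M.+1) kweight h (M - i)%N <= tau `^ al / al.
Proof.
rewrite -IM; suff H m : (m <= M.+1)%N -> \sum_(i < m) kweight h (M - i)%N <= I m.
  exact: H.
elim: m => [|m ih] mM; first by rewrite big_ord0 I0.
by rewrite big_ord_recr IS//= lerD ?ih ?(ltnW mM)// le_kc.
Qed.

(** The kernel mass of each cell is at most the rectangle weight of the following cell. The deficits
    therefore telescope, and only the mass of the last, singular cell, h^al / al, survives. *)
Let sum_kweight_ge : I M.+1 - \sum_(i < M.+1) kweight h (M - i)%N <= h `^ al / al.
Proof.
have H m : (m <= M)%N -> I m <= \sum_(i < m) kweight h (M - i.+1)%N.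
  elim: m => [|m ih] mM; first by rewrite big_ord0 I0.
  by rewrite big_ord_recr IS ?(ltnW mM)//= lerD ?ih ?(ltnW mM)// kc_le.
have e : kc M = h `^ al / al.
  rewrite /kc Rintegral_powR_subr//; last by rewrite ler_wpM2r ?(ltW h0)// ler_nat.
  by rewrite subrr powR0 ?gt_eqF// subr0 -mulrBl -natrB// subSnn mul1r.
rewrite IS// big_ord_recl/= subn0 -e.
have := H M (leqnn M); have := kweight_gt0 M.
rewrite [X in kweight h M + X](_ : _ = \sum_(i < M) kweight h (M - i.+1)%N)//.
move: (\sum_(i < M) _) => W; lra.
Qed.

(** Two errors add up on each cell: the oscillation [om] of g against the kernel mass, and the
    sampling deficit of the kernel against the bound S. Summed over the cells, the masses give
    tau^al / al and the deficits at most h^al / al. *)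
Lemma Jint_riemann (g : R -> R) (om S : R) : measurable_fun `]0, tau[ g ->
  (forall s, 0 < s <= tau -> `|g s| <= S) ->
  (forall i s, (i <= M)%N -> i%:R * h < s < i.+1%:R * h ->
     `|g s - g (i.+1%:R * h)| <= om) ->
  `|\sum_(i < M.+1) kweight h (M - i)%N * g (i.+1%:R * h) - Jint al g tau| <=
  (om * tau `^ al + S * h `^ al) / al.
Proof.
move=> mg gS gom.
have S0 : 0 <= S.
  by apply: le_trans (gS tau _); rewrite ?normr_ge0// lexx andbT jh.
have ig : mu.-integrable `]0, tau[ (EFin \o (fun s => (tau - s) `^ (al - 1) * g s)).
  by apply: (@Jint_integrable _ _ al01 _ _ S) => // s hs; apply: gS; lra.
have cell i : (i <= M)%N -> `|kweight h (M - i)%N * g (i.+1%:R * h) -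
     \int[mu]_(s in `](i%:R * h), (i.+1%:R * h)[) ((tau - s) `^ (al - 1) * g s)| <=
     om * kc i + S * (kc i - kweight h (M - i)%N).
  move=> iM.
  have sub : `](i%:R * h), (i.+1%:R * h)[ `<=` `]0, tau[.
    apply: subset_itv; rewrite bnd_simp ?ler_wpM2r ?(ltW h0)// ?ler_nat//.
    by rewrite mulr_ge0// ltW.
  have igc : mu.-integrable `](i%:R * h), (i.+1%:R * h)[
      (EFin \o (fun s => (tau - s) `^ (al - 1) * g s)) by exact: integrableS ig.
  have ikc := ik iM.
  have ikg : mu.-integrable `](i%:R * h), (i.+1%:R * h)[
      (EFin \o (fun s => g (i.+1%:R * h) * (tau - s) `^ (al - 1))).
    exact: integrable_scale.
  have -> : kweight h (M - i)%N * g (i.+1%:R * h) -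
     \int[mu]_(s in `](i%:R * h), (i.+1%:R * h)[) ((tau - s) `^ (al - 1) * g s) =
     (\int[mu]_(s in `](i%:R * h), (i.+1%:R * h)[)
        (g (i.+1%:R * h) * (tau - s) `^ (al - 1) - (tau - s) `^ (al - 1) * g s)) -
     g (i.+1%:R * h) * (kc i - kweight h (M - i)%N).
    by rewrite RintegralB// RintegralZl// -/(kc i); ring.
  apply: le_trans (ler_normB _ _) _; apply: lerD.
    apply: le_trans (le_normr_Rintegral _ _) _ => //; first exact: integrable_sub.
    rewrite /kc -RintegralZl//; apply: le_Rintegral => //.
    - by apply: integrable_norm; exact: integrable_sub.
    - exact: integrable_scale.
    - move=> s; rewrite /= in_itv/= => hs.
      rewrite [_ * g s]mulrC -mulrBl normrM (ger0_norm (powR_ge0 _ _)).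
      by rewrite ler_wpM2r ?powR_ge0// distrC gom.
  rewrite normrM mulrC [X in X * _]ger0_norm ?subr_ge0 ?le_kc// mulrC ler_wpM2r ?subr_ge0 ?le_kc//.
  by apply: gS; rewrite jh/= ler_wpM2r ?(ltW h0)// ler_nat.
suff H m : (m <= M.+1)%N ->
    `|\sum_(i < m) kweight h (M - i)%N * g (i.+1%:R * h) -
      \int[mu]_(s in `]0, (m%:R * h)[) ((tau - s) `^ (al - 1) * g s)| <=
    om * I m + S * (I m - \sum_(i < m) kweight h (M - i)%N).
  apply: le_trans (H M.+1 (leqnn _)) _.
  rewrite [leRHS]mulrDl -!mulrA IM lerD2l ler_wpM2l// -IM; exact: sum_kweight_ge.
elim: m => [|m ih] mM.
  by rewrite !big_ord0 I0 mul0r set_itvoo0 Rintegral_set0 !subrr !mulr0 addr0 normr0.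
rewrite !big_ord_recr/= split// IS//.
have := ih (ltnW mM); have := cell m mM.
set A := \sum_(i < m) kweight h (M - i)%N * _; set B := \int[mu]_(s in `]0, _[) _.
set D := kweight _ _ * _; set E := \int[mu]_(s in _) _; set W := \sum_(i < m) _.
move=> h1 h2.
have -> : A + D - (B + E) = (A - B) + (D - E) by ring.
apply: le_trans (ler_normD _ _) _; lra.
Qed.

End Step.
End RiemannSums.

(** * Passage from the grid to the continuous quadratic inequality *)

Section FractionalSquare.
Context {R : realType} (al : R) (al01 : 0 < al < 1).
Context {X : completeNormedModType R}.
Context (dot : {dot X for @idfun R}) (hdot : forall x, dot x x = `|x| ^+ 2).
Notation mu := (@lebesgue_measure R).
Let al0 : 0 < al. Proof. by case/andP : al01. Qed.

Context (T : R) (T0 : 0 < T) (f d : R -> X) (a : X) (S : R).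
Hypotheses (uf : ucont T f) (fS : forall t : R, 0 <= t <= T -> `|f t| <= S)
  (hd : forall (t : R) y, 0 <= t <= T ->
     dot (d t) y = dot a y + Jint al (fun s => dot (f s) y) t).

Let S0 : 0 <= S.
Proof. by apply: le_trans (fS (t := 0) _); rewrite ?normr_ge0// lexx ltW. Qed.

Let itv_sub t : t <= T -> (`]0, t[%classic : set R) `<=` `]0, T[%classic.
Proof. by move=> tT s; rewrite /= !in_itv/=; lra. Qed.

Let mfy y t : t <= T -> measurable_fun (`]0, t[ : set (measurableTypeR R))
  (fun s => dot (f s) y).
Proof.
move=> tT; apply: (measurable_funS _ (itv_sub tT)) => //.
by apply: smeas_dotl => //; exact: ucont_smeas.
Qed.

Let fy y s t : t <= T -> 0 < s < t -> `|dot (f s) y| <= S * `|y|.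
Proof.
move=> tT st; apply: le_trans (dot_CS hdot _ _) _.
by rewrite ler_wpM2r// fS//; lra.
Qed.

Let Sd := `|a| + S * T `^ al / al.

Lemma Jint_solution_bound t : 0 <= t <= T -> `|d t| <= Sd.
Proof.
move=> tT; have h0 : 0 <= S * T `^ al / al by rewrite divr_ge0 ?mulr_ge0 ?powR_ge0 ?(ltW al0).
apply: (norm_le_dot hdot) => [|y]; first by rewrite addr_ge0.
have [t0 tT'] := andP tT.
rewrite hd// mulrDl; apply: lerD; first exact: dot_le.
apply: le_trans (ler_norm _) _.
have := Jint_bound al01 t0 (mfy y tT') (fun s => @fy y s t tT').
move/le_trans; apply; rewrite [leRHS]mulrAC [X in _ <= X / _]mulrAC.
rewrite ler_wpM2r ?invr_ge0 ?(ltW al0)// ler_wpM2l ?mulr_ge0//.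
by apply: powR_le_pos => //; exact: ltW.
Qed.

Lemma Jint_solution_holder s t : 0 <= s -> s <= t -> t <= T ->
  `|d t - d s| <= 2 * S / al * (t - s) `^ al.
Proof.
move=> s0 st tT; apply: (norm_le_dot hdot) => [|y].
  by rewrite !mulr_ge0 ?powR_ge0 ?invr_ge0 ?(ltW al0).
rewrite dotBl !hd; [|lra|lra].
rewrite opprD addrACA subrr add0r; apply: le_trans (ler_norm _) _.
have := Jint_holder al01 s0 st (mfy y tT) (fun s => @fy y s t tT).
by move/le_trans; apply; rewrite le_eqVlt; apply/orP; left; apply/eqP; ring.
Qed.

Lemma Jint_solution_ucont : ucont T d.
Proof. exact: (holder_ucont al0 Jint_solution_holder). Qed.

Let fd s := dot (f s) (d s).

Let ufd : ucont T (fd : R -> R^o).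
Proof.
move=> e e0.
have L1 : 0 < Sd + S + 1.
  have := Jint_solution_bound (t := 0); rewrite lexx (ltW T0) => /(_ isT).
  have := normr_ge0 (d 0); have := S0; lra.
have e1 : 0 < e / (Sd + S + 1) by rewrite divr_gt0.
have [d1 d10 h1] := uf e1; have [d2 d20 h2] := Jint_solution_ucont e1.
exists (Num.min d1 d2); first by rewrite lt_min d10.
move=> s t hs ht; rewrite le_min => /andP[k1 k2].
have -> : fd s - fd t = dot (f s - f t) (d s) + dot (f t) (d s - d t).
  by rewrite /fd dotBl [dot (f t) (_ - _)](dotC dot) dotBl !(dotC dot _ (f t)) addrA subrK.
have -> : e = e / (Sd + S + 1) * (Sd + S + 1) by rewrite mulfVK// gt_eqF.
apply: le_trans (ler_normD _ _) _.
apply: (@le_trans _ _ (e / (Sd + S + 1) * Sd + S * (e / (Sd + S + 1)))).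
  apply: lerD; apply: le_trans (dot_CS hdot _ _) _; apply: ler_pM => //.
  - exact: h1.
  - exact: Jint_solution_bound.
  - exact: fS.
  - exact: h2.
move: e1; set z := e / _ => z0.
by rewrite !mulrDr mulr1 [S * z]mulrC lerDl ltW.
Qed.

Let mfd t : t <= T -> measurable_fun (`]0, t[ : set (measurableTypeR R)) fd.
Proof.
move=> tT; apply: (measurable_funS _ (itv_sub tT)) => //.
by apply: smeas_dot => //; apply: ucont_smeas => //; exact: Jint_solution_ucont.
Qed.

Let fdS s : 0 <= s <= T -> `|fd s| <= S * Sd.
Proof.
move=> hs; apply: le_trans (dot_CS hdot _ _) _; apply: ler_pM => //; first exact: fS.
exact: Jint_solution_bound.
Qed.

Let Sd0 : 0 <= Sd.
Proof.
have := Jint_solution_bound (t := 0); rewrite lexx (ltW T0) => /(_ isT).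
exact: le_trans.
Qed.

(** [K1] e bounds the distance of the discrete solution from d at grid points. [K3] e collects the
    Riemann error for dot (f, d), the replacement of the discrete solution by d inside that pairing,
    and the change from |D N|^2 to |d t|^2. *)
Let K1 := (T `^ al + S) / al.
Let K3 := 2 * ((T `^ al + S * Sd) / al + S * K1 * (T `^ al / al)) + K1 * (2 * Sd + K1).

Let K10 : 0 <= K1.
Proof. by rewrite divr_ge0 ?addr_ge0 ?powR_ge0// ltW. Qed.

(** On a grid fine enough that f and dot (f, d) oscillate by at most e per cell and h^al <= e, the
    discrete inequality differs from the continuous one by O(e), with a constant independent of
    t. *)
Let step t e : 0 < t <= T -> 0 < e <= 1 ->
  `|d t| ^+ 2 <= `|a| ^+ 2 + 2 * Jint al fd t + K3 * e.
Proof.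
move=> /andP[t0 tT] /andP[e0 e1].
have [d1 d10 h1] := uf e0; have [d2 d20 h2] := ufd e0.
pose d3 := e `^ al^-1; have d30 : 0 < d3 by rewrite powR_gt0.
have d3e x : 0 <= x -> x <= d3 -> x `^ al <= e.
  move=> x0 xd; have -> : e = d3 `^ al.
    by rewrite /d3 -powRrM mulVf ?gt_eqF// powRr1// ltW.
  by apply: powR_le_pos => //; exact: ltW.
pose dl := Num.min d1 (Num.min d2 d3).
have dl0 : 0 < dl by rewrite !lt_min d10 d20.
(* The step divides t exactly, so that t is the last grid point (N + 1) h, while h stays below
   [dl]. *)
pose N := Num.truncn (t / dl); pose h := t / N.+1%:R.
have h0 : 0 < h by rewrite divr_gt0.
have hdl : h <= dl.
  by rewrite ler_pdivrMr// mulrC -ler_pdivrMr// ltW// truncnS_gt.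
have [hd1 hd2 hd3] : [/\ h <= d1, h <= d2 & h <= d3].
  by move: hdl; rewrite /dl !le_min => /andP[-> /andP[-> ->]].
have Nh : N.+1%:R * h = t by rewrite /h mulrC mulfVK// pnatr_eq0.
have grid i : (i <= N)%N -> 0 < i.+1%:R * h <= t.
  move=> iN; rewrite mulr_gt0//= -Nh ler_wpM2r ?(ltW h0)// ler_nat//.
have cell i s : (i <= N)%N -> i%:R * h < s < i.+1%:R * h ->
    [/\ 0 <= s <= T, 0 <= i.+1%:R * h <= T & `|s - i.+1%:R * h| <= h].
  move=> iN /andP[s1 s2]; have /andP[g1 g2] := grid i iN.
  have g0 : 0 <= i%:R * h by rewrite mulr_ge0// ltW.
  have e' : i.+1%:R * h = i%:R * h + h by rewrite -natr1 mulrDl mul1r.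
  split; [lra|lra|].
  rewrite ler0_norm; lra.
have hal : h `^ al <= e by apply: d3e => //; exact: ltW.
have Tal x : 0 <= x <= T -> x `^ al <= T `^ al.
  by move=> hx; apply: powR_le_pos; [exact: ltW|lra|lra].
pose F i := f (i.+1%:R * h).
(* [D] solves the discrete equation exactly with the sampled data. The values of d do so only up to
   an error, so the discrete inequality is applied to [D] and then transferred. *)
pose D M := a + \sum_(i < M.+1) kweight al h (M - i)%N *: F i.
have Dd M y : dot (D M) y =
    dot a y + \sum_(i < M.+1) kweight al h (M - i)%N * dot (F i) y.
  rewrite /D dotDl; congr (_ + _).
  elim/big_ind2 : _ => [|x1 x2 y1 y2 <- <-|i _]; [exact: linear0l|exact: dotDl|].
  by rewrite dotZl.
have err M : (M <= N)%N -> `|D M - d (M.+1%:R * h)| <= e * K1.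
  move=> MN; have /andP[g1 g2] := grid M MN.
  apply: (norm_le_dot hdot) => [|y]; first by rewrite mulr_ge0// ltW.
  have tauT : M.+1%:R * h <= T by lra.
  rewrite dotBl Dd hd; last lra.
  rewrite opprD addrACA subrr add0r.
  have om i s : (i <= M)%N -> i%:R * h < s < i.+1%:R * h ->
     `|dot (f s) y - dot (f (i.+1%:R * h)) y| <= e * `|y|.
    move=> iM hs; have [c1 c2 c3] := cell i s (leq_trans iM MN) hs.
    rewrite -dotBl (le_trans (dot_CS hdot _ _))// ler_wpM2r// h1//.
    exact: le_trans c3 _.
  have fb s : 0 < s <= M.+1%:R * h -> `|dot (f s) y| <= S * `|y|.
    move=> hs; apply: le_trans (dot_CS hdot _ _) _.
    by rewrite ler_wpM2r// fS//; lra.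
  have := Jint_riemann al01 h0 (mfy y tauT) fb om.
  move/(le_trans (ler_norm _))/le_trans; apply.
  have -> : e * K1 * `|y| = (e * `|y| * T `^ al + S * `|y| * e) / al.
    by rewrite /K1; ring.
  rewrite ler_wpM2r ?invr_ge0 ?(ltW al0)//; apply: lerD.
    by rewrite ler_wpM2l ?mulr_ge0 ?(ltW e0)// Tal// (ltW g1).
  by rewrite ler_wpM2l ?mulr_ge0.
have := @discrete_convolution_sqr R (kweight al h) (kweight_gt0 al h0)
  (kweight_dec al01 h0) (kweight_log_convex al01 h0) X dot hdot F D a Dd N.
have sumD : \sum_(i < N.+1) kweight al h (N - i)%N * dot (F i) (D i) <=
    \sum_(i < N.+1) kweight al h (N - i)%N * fd (i.+1%:R * h) +
    S * (e * K1) * (T `^ al / al).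
  apply: (@le_trans _ _ (\sum_(i < N.+1) (kweight al h (N - i)%N * fd (i.+1%:R * h) +
      S * (e * K1) * kweight al h (N - i)%N))).
    apply: ler_sum => i _; have iN : (i <= N)%N by rewrite -ltnS.
    have /andP[g1 g2] := grid i iN.
    rewrite [S * _ * _]mulrC -mulrDr ler_wpM2l ?(ltW (kweight_gt0 _ h0 _))//.
    have -> : D i = d (i.+1%:R * h) + (D i - d (i.+1%:R * h)) by rewrite addrC subrK.
    rewrite dotDr lerD2l (le_trans (dot_le hdot _ _))//.
    by apply: ler_pM => //; [apply: fS; lra|exact: err].
  rewrite big_split/= lerD2l -mulr_sumr ler_wpM2l//.
    by apply: mulr_ge0 => //; apply: mulr_ge0 => //; exact: ltW.
  apply: le_trans (sum_kweight_le al01 h0 N) _.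
  rewrite Nh ler_wpM2r ?invr_ge0 ?(ltW al0)// Tal//; lra.
have omfd i s : (i <= N)%N -> i%:R * h < s < i.+1%:R * h ->
    `|fd s - fd (i.+1%:R * h)| <= e.
  move=> iN hs; have [c1 c2 c3] := cell i s iN hs.
  apply: h2 => //; exact: le_trans c3 _.
have := Jint_riemann al01 h0 (M := N) (g := fd) (om := e) (S := S * Sd).
rewrite Nh => /(_ (mfd tT)).
have fb s : 0 < s <= t -> `|fd s| <= S * Sd by move=> hs; apply: fdS; lra.
move=> /(_ fb omfd)/(le_trans (ler_norm _)) r1 r2.
have r3 : (e * t `^ al + S * Sd * h `^ al) / al <= e * ((T `^ al + S * Sd) / al).
  rewrite mulrA ler_wpM2r ?invr_ge0 ?(ltW al0)// [leRHS]mulrDr; apply: lerD.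
    by rewrite ler_wpM2l ?(ltW e0)// Tal; lra.
  by rewrite mulrC ler_wpM2r//; apply: mulr_ge0.
have r4 := err N (leqnn N); rewrite Nh in r4.
have r5 : `|d t| <= Sd by apply: Jint_solution_bound; lra.
have r6 : `|d t| <= `|D N| + e * K1.
  have := ler_normB (D N) (D N - d t); rewrite opprB addrC subrK; lra.
have r7 : `|d t| ^+ 2 <= `|D N| ^+ 2 + e * (K1 * (2 * Sd + K1)).
  have ek : e * K1 <= K1 by rewrite ler_piMl.
  have ek0 : 0 <= e * K1 by rewrite mulr_ge0// ltW.
  have q : e * (K1 * (2 * Sd + K1)) = e * K1 * (2 * Sd + K1) by ring.
  have [c|c] := leP `|d t| (`|D N|).
    have : `|d t| ^+ 2 <= `|D N| ^+ 2 by rewrite ler_pXn2r// nnegrE.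
    have : 0 <= e * K1 * (2 * Sd + K1).
      by apply: mulr_ge0 => //; apply: addr_ge0 => //; apply: mulr_ge0.
    rewrite q.
    lra.
  have : (`|d t| - `|D N|) * (`|d t| + `|D N|) <= e * K1 * (2 * Sd + K1).
    apply: ler_pM; first by rewrite subr_ge0 ltW.
    - exact: addr_ge0.
    - by rewrite lerBlDl.
    - have p : `|d t| + `|D N| <= 2 * Sd by lra.
      by rewrite (le_trans p)// lerDl.
  rewrite -subr_sqr q; lra.
have -> : K3 * e = 2 * (e * ((T `^ al + S * Sd) / al)) +
   2 * (S * (e * K1) * (T `^ al / al)) + e * (K1 * (2 * Sd + K1)).
  by rewrite /K3; ring.
lra.
Qed.

Lemma Jint_sqr t : 0 <= t <= T ->
  `|d t| ^+ 2 <= `|a| ^+ 2 + 2 * Jint al (fun s => dot (f s) (d s)) t.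
Proof.
move=> /andP[t0 tT]; move: t0; rewrite le_eqVlt => /predU1P[<-|t0].
  rewrite Jint0 mulr0 addr0 (_ : d 0 = a)//.
  by apply: (dot_eqP hdot) => y; rewrite hd ?lexx ?(ltW T0)// Jint0 addr0.
apply/ler_addgt0Pr => e e0.
have K30 : 0 < `|K3| + 1 by rewrite ltr_wpDl.
pose e' := Num.min 1 (e / (`|K3| + 1)).
have e'0 : 0 < e' by rewrite lt_min ltr01 divr_gt0.
have := @step t e'; rewrite t0 tT e'0 ge_min lexx => /(_ isT isT)/le_trans; apply.
rewrite lerD2l; apply: le_trans (ler_wpM2r (ltW e'0) (ler_norm _)) _.
apply: (@le_trans _ _ ((`|K3| + 1) * e')); first by rewrite ler_wpM2r ?(ltW e'0)// lerDl.
by rewrite mulrC -ler_pdivlMr// ge_min lexx orbT.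
Qed.

End FractionalSquare.

(** * A priori bound for one-sided bounded right-hand sides *)

Section Apriori.
Context {R : realType} (al : R) (al01 : 0 < al < 1).

(** The one-sided bound on dot (f, d) turns the quadratic inequality into a Gronwall inequality for
    |d|^2 with factor 2 b and datum |a|^2 + 2 e T^al / al, whence the factor 1 + 2 T^al / al. C is
    chosen before the space, the functions and the slack e, and the size S of f leaves no trace in
    it. *)
Lemma Jint_apriori (T b : R) : 0 < T -> 0 <= b -> exists2 C, 0 < C &
  forall (X : completeNormedModType R) (dot : {dot X for @idfun R})
    (hdot : forall x, dot x x = `|x| ^+ 2) (f d : R -> X) (a : X) (S e : R),
  ucont T f -> (forall t : R, 0 <= t <= T -> `|f t| <= S) ->
  (forall (t : R) y, 0 <= t <= T ->
     dot (d t) y = dot a y + Jint al (fun s => dot (f s) y) t) ->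
  0 <= e -> (forall t, 0 <= t <= T -> dot (f t) (d t) <= b * `|d t| ^+ 2 + e) ->
  forall t, 0 <= t <= T -> `|d t| ^+ 2 <= C * (`|a| ^+ 2 + e).
Proof.
move=> T0 b0; have b20 : 0 <= 2 * b by rewrite mulr_ge0.
have al0 : 0 < al by case/andP : al01.
have [C C0 hC] := Jint_gronwall al01 T0 b20.
have L0 : 0 <= 2 * T `^ al / al by rewrite divr_ge0 ?mulr_ge0 ?powR_ge0// ltW.
exists (C * (1 + 2 * T `^ al / al)); first by rewrite mulr_gt0//; lra.
move=> X dot hdot f d a S e uf fS hd e0 fd t tT.
have bd s : 0 <= s <= T -> `|d s| <= `|a| + S * T `^ al / al.
  exact: (Jint_solution_bound al01 hdot T0 uf fS hd).
have ud : ucont T d by exact: (Jint_solution_ucont al01 hdot T0 uf fS hd).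
have md : measurable_fun (`]0, T[ : set (measurableTypeR R)) (fun s => `|d s| ^+ 2).
  apply: (eq_measurable_fun (fun s => dot (d s) (d s))) => [s _|]; first exact: hdot.
  by apply: smeas_dot => //; exact: ucont_smeas.
pose M := (`|a| + S * T `^ al / al) ^+ 2.
have dM s : 0 <= s <= T -> 0 <= `|d s| ^+ 2 <= M.
  by move=> hs; rewrite sqr_ge0/= /M !expr2 ler_pM// bd.
have step s : 0 <= s <= T -> `|d s| ^+ 2 <=
    (`|a| ^+ 2 + 2 * e * T `^ al / al) + 2 * b * Jint al (fun r => `|d r| ^+ 2) s.
  move=> hs; have /andP[s0 sT] := hs.
  apply: le_trans (Jint_sqr al01 hdot T0 uf fS hd hs) _.
  have sub : (`]0, s[%classic : set R) `<=` `]0, T[%classic by move=> r; rewrite /= !in_itv/=; lra.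
  have m1 : measurable_fun (`]0, s[ : set (measurableTypeR R)) (fun r => dot (f r) (d r)).
    apply: (measurable_funS _ sub) => //.
    by apply: smeas_dot => //; exact: ucont_smeas.
  have m2 : measurable_fun (`]0, s[ : set (measurableTypeR R)) (fun r => `|d r| ^+ 2).
    exact: (measurable_funS _ sub).
  have M0 : 0 <= M by exact: sqr_ge0.
  have bM r : 0 < r < s -> `|b * `|d r| ^+ 2| <= b * M.
    move=> hr; have /dM/andP[q1 q2] : 0 <= r <= T by lra.
    by rewrite ger0_norm ?mulr_ge0// ler_wpM2l.
  have be r : 0 < r < s -> `|e| <= e by rewrite ger0_norm.
  have J2 : Jint al (fun r => b * `|d r| ^+ 2 + e) s =
      b * Jint al (fun r => `|d r| ^+ 2) s + e * s `^ al / al.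
    rewrite (@JintD _ _ al01 _ _ _ (b * M + e)).
    - rewrite (@JintZ _ _ al01 _ _ _ M)//; last first.
        by move=> r hr; rewrite ger0_norm ?sqr_ge0//; have := dM r; lra.
      by rewrite Jint_cst.
    - by apply: measurable_funM => //; exact: measurable_cst.
    - exact: measurable_cst.
    - by move=> r hr; apply: le_trans (bM r hr) _; rewrite lerDl.
    - by move=> r hr; rewrite ger0_norm// lerDr mulr_ge0.
  have J1 : Jint al (fun r => dot (f r) (d r)) s <= Jint al (fun r => b * `|d r| ^+ 2 + e) s.
    apply: (@le_Jint _ _ al01 _ _ _
      (S * (`|a| + S * T `^ al / al) + (b * M + e))) => //.
    - apply: measurable_funD; last exact: measurable_cst.
      by apply: measurable_funM => //; exact: measurable_cst.
    - move=> r hr; have hr' : 0 <= r <= T by lra.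
      rewrite (le_trans (dot_CS hdot _ _))//.
      apply: (@le_trans _ _ (S * (`|a| + S * T `^ al / al))).
        by apply: ler_pM => //; [exact: fS|exact: bd].
      by rewrite lerDl addr_ge0// mulr_ge0.
    - move=> r hr; rewrite (le_trans (ler_normD _ _))//.
      have := bM r hr; have := be r hr.
      have : 0 <= S * (`|a| + S * T `^ al / al).
        have z0 : (0 : R) <= 0 <= T by rewrite lexx ltW.
        by rewrite mulr_ge0// ?(le_trans _ (fS _ z0))// (le_trans _ (bd _ z0)).
      lra.
    - by move=> r hr; apply: fd; lra.
  have p : e * s `^ al / al <= e * T `^ al / al.
    rewrite ler_wpM2r ?invr_ge0 ?(ltW al0)// ler_wpM2l//.
    by apply: powR_le_pos; lra.
  have -> : 2 * e * T `^ al / al = 2 * (e * T `^ al / al) by ring.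
  rewrite J2 in J1; lra.
have A0 : 0 <= `|a| ^+ 2 + 2 * e * T `^ al / al.
  by rewrite addr_ge0 ?sqr_ge0// divr_ge0 ?mulr_ge0 ?powR_ge0// ltW.
apply: le_trans (hC _ _ _ md A0 dM step t tT) _.
rewrite -[leRHS]mulrA ler_wpM2l ?(ltW C0)//.
have -> : 2 * e * T `^ al / al = (2 * T `^ al / al) * e by ring.
move: L0; set L := 2 * _ / _ => L0.
have : 0 <= L * `|a| ^+ 2 by rewrite mulr_ge0// sqr_ge0.
have -> : (1 + L) * (`|a| ^+ 2 + e) = `|a| ^+ 2 + e + (L * `|a| ^+ 2 + L * e) by ring.
lra.
Qed.

End Apriori.

(** * Volterra equations with a bounded operator *)

Section VolterraSeries.
Context {R : realType} (al : R) (al01 : 0 < al < 1) (T c : R) (T0 : 0 < T) (c0 : 0 < c).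
Context {X : completeNormedModType R}.
Context (dot : {dot X for @idfun R}) (hdot : forall x, dot x x = `|x| ^+ 2).
Context (K : X -> X) (M : R) (M0 : 0 <= M) (KD : forall x y, K (x + y) = K x + K y)
  (KZ : forall k x, K (k *: x) = k *: K x) (KM : forall x, `|K x| <= M * `|x|).
Notation mu := (@lebesgue_measure R).
Let al0 : 0 < al. Proof. by case/andP : al01. Qed.

(** For c = 1 / Gamma(al) and t >= 0 this is the Mittag-Leffler term t^(k al) / Gamma(k al + 1). It
    is kept as an iterate, so that no closed form and no asymptotics of Gamma enter. *)
Definition frac_power (k : nat) : R -> R := iter k (fun g t => c * Jint al g t) (fun=> 1).

Let frac_powerS k t : frac_power k.+1 t = c * Jint al (frac_power k) t.
Proof. by []. Qed.

Lemma frac_power_ge0 k t : 0 <= frac_power k t.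
Proof.
elim: k t => [|k ih] t; first exact: ler01.
rewrite frac_powerS mulr_ge0 ?(ltW c0)//; apply: Rintegral_ge0 => s _.
by rewrite mulr_ge0// powR_ge0.
Qed.

Let th := (2 * c * (M + 1))^-1.

Let th0 : 0 < th.
Proof. by rewrite invr_gt0 !mulr_gt0// ltr_wpDl. Qed.

(** Measured against exp(om t), each iteration gains the factor c [th] = 1 / (2 (M + 1)). This beats
    the growth M of one application of K and leaves 2^-k; the added 1 covers M = 0. *)
Lemma frac_power_props : exists2 E, 0 < E & forall k,
  ucont T (frac_power k : R -> R^o) /\
  forall t, 0 <= t <= T -> frac_power k t * M ^+ k <= 2^-1 ^+ k * E.
Proof.
have [om om0 hom] := Jint_expR al01 T0 th0.
pose E := expR (om * T); have E0 : 0 < E by exact: expR_gt0.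
pose q := (2 * (M + 1))^-1.
have M1 : 0 < M + 1 by rewrite ltr_wpDl.
have q0 : 0 < q by rewrite invr_gt0 mulr_gt0.
have eE t : 0 <= t <= T -> expR (om * t) <= E.
  by move=> /andP[t1 tT]; rewrite ler_expR ler_wpM2l// ltW.
have main k : ucont T (frac_power k : R -> R^o) /\
    forall t, 0 <= t <= T -> frac_power k t <= q ^+ k * expR (om * t).
  elim: k => [|k [uk bk]].
    split; first exact: (@ucont_cst R T R^o 1).
    move=> t /andP[t1 tT]; rewrite expr0 mul1r -[frac_power 0 t]expR0 ler_expR.
    by rewrite mulr_ge0// ltW.
  have mk t : t <= T -> measurable_fun (`]0, t[ : set (measurableTypeR R)) (frac_power k).
    move=> tT; apply: (@measurable_funS _ _ _ _ `]0, T[) => //.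
      by move=> s; rewrite /= !in_itv/=; lra.
    by apply: smeas_measurable; exact: ucont_smeas.
  have bE s : 0 <= s <= T -> `|frac_power k s| <= q ^+ k * E.
    move=> hs; rewrite ger0_norm ?frac_power_ge0// (le_trans (bk _ hs))//.
    by rewrite ler_wpM2l ?exprn_ge0 ?(ltW q0)// eE.
  split.
    apply: (@holder_ucont _ _ R^o _ al (c * (2 * (q ^+ k * E) / al))) => // s t s0 st tT.
    rewrite !frac_powerS -mulrBr normrM (gtr0_norm c0) -mulrA ler_wpM2l ?(ltW c0)//.
    have bs r : 0 < r < t -> `|frac_power k r| <= q ^+ k * E by move=> hr; apply: bE; lra.
    have := Jint_holder al01 s0 st (mk t tT) bs.
    by move/le_trans; apply; rewrite le_eqVlt; apply/orP; left; apply/eqP; ring.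
  move=> t tT; have /andP[t1 tT'] := tT; rewrite frac_powerS.
  have h1 : Jint al (frac_power k) t <= Jint al (fun s => q ^+ k * expR (om * s)) t.
    apply: (@le_Jint _ _ al01 _ _ _ (q ^+ k * E)).
    - exact: mk.
    - by apply: measurable_funM; [exact: measurable_cst|exact: measurable_expR_scale].
    - by move=> s hs; apply: bE; lra.
    - move=> s hs; rewrite ger0_norm ?mulr_ge0 ?exprn_ge0 ?expR_ge0 ?(ltW q0)//.
      by rewrite ler_wpM2l ?exprn_ge0 ?(ltW q0)// eE//; lra.
    - by move=> s hs; apply: bk; lra.
  have h2 : Jint al (fun s => q ^+ k * expR (om * s)) t <= q ^+ k * (th * expR (om * t)).
    rewrite (@JintZ _ _ al01 _ _ _ E).
    - by rewrite ler_wpM2l ?exprn_ge0 ?(ltW q0)// hom.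
    - exact: measurable_expR_scale.
    - by move=> s hs; rewrite ger0_norm ?expR_ge0// eE//; lra.
  apply: (@le_trans _ _ (c * (q ^+ k * (th * expR (om * t))))).
    by rewrite ler_wpM2l ?(ltW c0)// (le_trans h1).
  rewrite le_eqVlt; apply/orP; left; apply/eqP.
  by rewrite exprS /q /th; field; rewrite !gt_eqF.
exists E => // k; have [uk bk] := main k; split => // t tT.
apply: (@le_trans _ _ (q ^+ k * E * M ^+ k)).
  rewrite ler_wpM2r ?exprn_ge0// (le_trans (bk _ tT))//.
  by rewrite ler_wpM2l ?exprn_ge0 ?(ltW q0)// eE.
rewrite mulrAC -exprMn ler_wpM2r ?(ltW E0)// lerXn2r ?nnegrE//.
- by rewrite mulr_ge0// ltW.
- rewrite /q invfM -mulrA ler_piMr// mulrC ler_pdivrMr// mul1r lerDl//.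
Qed.

Definition volterra_sum (N : nat) (a : X) (t : R) : X :=
  \sum_(k < N) frac_power k t *: iter k K a.

Let iterM k a : `|iter k K a| <= M ^+ k * `|a|.
Proof.
elim: k => [|k ih]; first by rewrite expr0 mul1r.
by rewrite iterS (le_trans (KM _))// exprS -mulrA ler_wpM2l.
Qed.

Lemma volterra_series : exists U : X -> R -> X, exists2 E, 0 < E & forall a t,
  0 <= t <= T -> forall N, `|volterra_sum N a t - U a t| <= 2 * E * `|a| * 2^-1 ^+ N.
Proof.
have [E E0 hE] := frac_power_props.
(* The geometric tail is kept as the difference 2^-N - 2^-(N+j), because the induction on j then
   closes with equality. *)
have tail a t N j : 0 <= t <= T ->
    `|volterra_sum (N + j) a t - volterra_sum N a t| <=
    2 * E * `|a| * (2^-1 ^+ N - 2^-1 ^+ (N + j)).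
  move=> tT; elim: j => [|j ih]; first by rewrite addn0 !subrr normr0 mulr0.
  rewrite addnS {1}/volterra_sum big_ord_recr/= -/(volterra_sum _ _ _) addrAC.
  apply: le_trans (ler_normD _ _) _.
  have h : `|frac_power (N + j) t *: iter (N + j) K a| <= E * `|a| * 2^-1 ^+ (N + j).
    rewrite normrZ ger0_norm ?frac_power_ge0//.
    apply: (@le_trans _ _ (frac_power (N + j) t * (M ^+ (N + j) * `|a|))).
      by rewrite ler_wpM2l ?frac_power_ge0.
    rewrite mulrA [leRHS]mulrAC ler_wpM2r// [leRHS]mulrC.
    exact: (hE _).2.
  apply: le_trans (lerD ih h) _; rewrite exprS.
  by rewrite le_eqVlt; apply/orP; left; apply/eqP; field.
have p0 n : 0 <= (2^-1 : R) ^+ n by rewrite exprn_ge0.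
have tail2 : forall (b : X) (t : R) (n m : nat), 0 <= t <= T -> (n <= m)%N ->
    `|volterra_sum m b t - volterra_sum n b t| <= 2 * E * `|b| * 2^-1 ^+ n.
  move=> b t n m tT nm; rewrite -(subnKC nm) (le_trans (tail _ _ _ _ tT))//.
  by rewrite ler_wpM2l ?mulr_ge0 ?(ltW E0)// lerBlDr lerDl.
have half : 2^-1 ^+ n @[n --> \oo] --> (0 : R).
  by apply: cvg_expr; rewrite ger0_norm// invf_lt1// ltr1n.
have ex a : exists u : R -> X, forall t, 0 <= t <= T ->
    volterra_sum n a t @[n --> \oo] --> u t.
  suff /choice[u hu] : forall t : R, exists l : X, 0 <= t <= T ->
    volterra_sum n a t @[n --> \oo] --> l by exists u.
  move=> t; have [tT|] := boolP (0 <= t <= T); last by exists 0.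
  suff [l hl] : exists l : X, volterra_sum n a t @[n --> \oo] --> l by exists l.
  apply: cauchy_seq_cvg => e e0.
  have : (2 * E * `|a|) * 2^-1 ^+ n @[n --> \oo] --> (0 : R).
    by rewrite -(mulr0 (2 * E * `|a|)); apply: cvgMl_tmp.
  move/cvgrPdist_le => /(_ _ e0)[N _ hN]; exists N => n m Nn Nm.
  wlog nm : n m Nn Nm / (m <= n)%N.
    move=> H; have [/H|/ltnW/H] := leqP m n; first exact.
    by rewrite distrC; exact.
  apply: le_trans (tail2 _ _ _ _ tT nm) _.
  by have := hN m Nm; rewrite /= sub0r normrN ger0_norm// mulr_ge0// mulr_ge0// mulr_ge0// ltW.
have [U hU] := choice ex.
exists U, E => // a t tT N.
have c1 : volterra_sum n a t - volterra_sum N a t @[n --> \oo] --> U a t - volterra_sum N a t.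
  by apply: cvgB; [exact: hU|exact: cvg_cst].
rewrite distrC.
apply: (ler_cvg_to (cvg_norm c1) (cvg_cst (2 * E * `|a| * 2^-1 ^+ N))).
by exists N => // n /= Nn; exact: tail2.
Qed.

End VolterraSeries.

Section VolterraSolution.
Context {R : realType} (al : R) (al01 : 0 < al < 1) (T c : R) (T0 : 0 < T) (c0 : 0 < c).
Context {X : completeNormedModType R}.
Context (dot : {dot X for @idfun R}) (hdot : forall x, dot x x = `|x| ^+ 2).
Context (K : X -> X) (M : R) (M0 : 0 <= M) (KD : forall x y, K (x + y) = K x + K y)
  (KZ : forall k x, K (k *: x) = k *: K x) (KM : forall x, `|K x| <= M * `|x|).
Notation mu := (@lebesgue_measure R).
Let al0 : 0 < al. Proof. by case/andP : al01. Qed.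

Let K0 : K 0 = 0.
Proof. by have := KZ 0 0; rewrite !scale0r. Qed.

Let KB x y : K (x - y) = K x - K y.
Proof. by rewrite KD -scaleN1r KZ scaleN1r. Qed.

(** Identities for the limit of the series are proved by bounding their defect by a multiple of 2^-N
    for every N. *)
Lemma geometric_small (x : R) C : (forall N, `|x| <= C * 2^-1 ^+ N) -> x = 0.
Proof.
move=> h; apply/normr0_eq0/eqP; rewrite eq_le normr_ge0 andbT.
have hc : C * 2^-1 ^+ n @[n --> \oo] --> (0 : R).
  rewrite -(mulr0 C); apply: cvgMl_tmp; apply: cvg_expr.
  by rewrite ger0_norm// invf_lt1// ltr1n.
by apply: (ler_cvg_to (cvg_cst `|x|) hc); exact: nearW.
Qed.

Let sum_ucont N a : ucont T (volterra_sum al c K N a).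
Proof.
have [E E0 hE] := @frac_power_props R al al01 T c T0 c0 M M0.
elim: N => [|N ih].
  have -> : volterra_sum al c K 0 a = fun=> 0.
    by apply/funext => t; rewrite /volterra_sum big_ord0.
  exact: ucont_cst.
have -> : volterra_sum al c K N.+1 a =
    fun t => volterra_sum al c K N a t + frac_power al c N t *: iter N K a.
  by apply/funext => t; rewrite /volterra_sum big_ord_recr.
apply: ucontD => //.
apply: (@ucont_lip R T R^o X (fun r => r *: iter N K a) `|iter N K a|); last exact: (hE N).1.
by move=> x y; rewrite -scalerBl normrZ mulrC.
Qed.

Let K_sum N a t : K (volterra_sum al c K N a t) = volterra_sum al c K N (K a) t.
Proof.
rewrite /volterra_sum; elim/big_ind2 : _ => [|x1 x2 y1 y2 <- <-|i _]//.
by rewrite KZ -iterS iterSr.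
Qed.

Let sumB N a b t : volterra_sum al c K N (a - b) t =
  volterra_sum al c K N a t - volterra_sum al c K N b t.
Proof.
rewrite /volterra_sum -sumrB; apply: eq_bigr => k _; rewrite -scalerBr; congr (_ *: _).
by elim: (k : nat) => [|n ih]//; rewrite !iterS ih KB.
Qed.

(** The partial sums are the Picard iterates: applying the fractional integral shifts [frac_power]
    by one, and K shifts the power of K by one. *)
Let sum_step N a t y : 0 <= t <= T -> dot (volterra_sum al c K N.+1 a t) y =
  dot a y + Jint al (fun s => dot (c *: K (volterra_sum al c K N a s)) y) t.
Proof.
move=> tT; have [E E0 hE] := @frac_power_props R al al01 T c T0 c0 M M0.
have [t0 tT'] := andP tT.
have dsum m b s : dot (volterra_sum al c K m b s) y =
    \sum_(k < m) frac_power al c k s * dot (iter k K b) y.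
  rewrite /volterra_sum; elim/big_ind2 : _ => [|x1 x2 y1 y2 <- <-|i _].
  - exact: linear0l.
  - exact: dotDl.
  - exact: dotZl.
rewrite dsum big_ord_recl; congr (_ + _); first by rewrite /frac_power/= mul1r.
have mk k : measurable_fun (`]0, t[ : set (measurableTypeR R)) (frac_power al c k).
  apply: (@measurable_funS _ _ _ _ `]0, T[) => //.
    by move=> s; rewrite /= !in_itv/=; lra.
  by apply: smeas_measurable; apply: ucont_smeas; exact: (hE k).1.
have bk k : exists B, forall s, 0 < s < t -> `|frac_power al c k s| <= B.
  have [d d0 hd] := (hE k).1 1 ltr01.
  have hc : ucont T (frac_power al c k : R -> R^o) := (hE k).1.
  case: k mk {hd} hc => [|k] mk hc.
    by exists 1 => s _; rewrite /frac_power/= normr1.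
  have hk : exists B, forall s, 0 <= s <= T -> `|frac_power al c k.+1 s| <= B.
    (* With M = 0 the weighted bound says nothing about [frac_power] itself. Taken with M + 1 >= 1,
       it dominates the unweighted function. *)
    have [E' E'0 hE'] := @frac_power_props R al al01 T c T0 c0 (M + 1) (addr_ge0 M0 ler01).
    exists (2^-1 ^+ k.+1 * E') => s hs; rewrite ger0_norm ?frac_power_ge0//.
    apply: le_trans ((hE' k.+1).2 s hs); rewrite ler_peMr ?frac_power_ge0//.
    by rewrite exprn_ege1// lerDr.
  by have [B hB] := hk; exists B => s hs; apply: hB; lra.
under [in RHS]eq_Jint => s _.
  rewrite dotZl K_sum dsum mulr_sumr.
  over.
rewrite /Jint.
transitivity (\int[mu]_(s in `]0, t[) (\sum_(k < N)
   (c * dot (iter k.+1 K a) y) * ((t - s) `^ (al - 1) * frac_power al c k s))).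
  rewrite Rintegral_big_sum//.
    apply: eq_bigr => k _; have [B hB] := bk k.
    rewrite RintegralZl//; last exact: (Jint_integrable al01 (mk k) hB).
    by rewrite /frac_power/= mulrAC.
  move=> k; apply: integrable_scale => //; have [B hB] := bk k.
  exact: (Jint_integrable al01 (mk k) hB).
apply: eq_Rintegral => s _; rewrite mulr_sumr; apply: eq_bigr => k _.
by rewrite iterSr; ring.
Qed.

(** Two properties accompany the equation: commutation with K will bound A_n u_n for initial values
    in D(A), and compatibility with differences of initial values lets the Cauchy estimate pass from
    D(A) to all of X. *)
Lemma volterra_solution : exists U : X -> R -> X,
  [/\ forall a, ucont T (U a),
      forall a, exists S, forall t, 0 <= t <= T -> `|U a t| <= S,
      forall a t y, 0 <= t <= T ->
        dot (U a t) y = dot a y + Jint al (fun s => dot (c *: K (U a s)) y) t,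
      forall a t, 0 <= t <= T -> K (U a t) = U (K a) t &
      forall a b t, 0 <= t <= T -> U (a - b) t = U a t - U b t].
Proof.
have [U [E E0 hU]] := volterra_series al01 T0 c0 M0 KM.
have hU0 a t : 0 <= t <= T -> `|U a t| <= 2 * E * `|a|.
  move=> tT; have := hU a t tT 0%N.
  by rewrite /volterra_sum big_ord0 sub0r normrN expr0 mulr1.
have uU a : ucont T (U a).
  apply: (ucont_limit (f_ := fun n => volterra_sum al c K n a)) => // e e0.
  have : (2 * E * `|a|) * 2^-1 ^+ n @[n --> \oo] --> (0 : R).
    rewrite -(mulr0 (2 * E * `|a|)); apply: cvgMl_tmp; apply: cvg_expr.
    by rewrite ger0_norm// invf_lt1// ltr1n.
  move/cvgrPdist_le => /(_ _ e0)[N _ hN]; exists N => t tT.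
  apply: le_trans (hU a t tT N) _.
  have := hN N (leqnn N); rewrite /= sub0r normrN => /(le_trans _); apply.
  exact: ler_norm.
have KU a t : 0 <= t <= T -> K (U a t) = U (K a) t.
  move=> tT; apply/subr0_eq/normr0_eq0.
  apply: (@geometric_small _ (M * (2 * E * `|a|) + 2 * E * `|K a|)) => N.
  rewrite normr_id mulrDl.
  have -> : K (U a t) - U (K a) t = K (U a t - volterra_sum al c K N a t) +
      (volterra_sum al c K N (K a) t - U (K a) t).
    by rewrite KB K_sum addrA subrK.
  apply: le_trans (ler_normD _ _) _; apply: lerD; last exact: hU.
  by rewrite (le_trans (KM _))// -[leRHS]mulrA ler_wpM2l// distrC hU.
exists U; split => //.
- by move=> a; exists (2 * E * `|a|) => t; exact: hU0.
- move=> a t y tT; apply/subr0_eq; have [t0 tT'] := andP tT.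
  apply: (@geometric_small _ (2 * E * `|a| * 2^-1 * `|y| +
     c * (M * (2 * E * `|a|)) * `|y| * t `^ al / al)) => N.
  pose V s := U a s - volterra_sum al c K N a s.
  have mV : measurable_fun (`]0, t[ : set (measurableTypeR R)) (fun s => dot (c *: K (V s)) y).
    apply: (@measurable_funS _ _ _ _ `]0, T[) => //.
      by move=> s; rewrite /= !in_itv/=; lra.
    apply: smeas_dotl => //; apply: ucont_smeas.
    apply: (@ucont_lip _ _ _ _ (fun x => c *: K x) (c * M)).
      by move=> x x'; rewrite -scalerBr -KB normrZ gtr0_norm// -mulrA ler_wpM2l ?(ltW c0).
    apply: ucontD => //.
    apply: (@ucont_lip _ _ _ _ (fun x => - x) 1) => // x x'.
    by rewrite -opprD normrN mul1r.
  have mp : measurable_fun (`]0, t[ : set (measurableTypeR R))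
      (fun s => dot (c *: K (volterra_sum al c K N a s)) y).
    apply: (@measurable_funS _ _ _ _ `]0, T[) => //.
      by move=> s; rewrite /= !in_itv/=; lra.
    apply: smeas_dotl => //; apply: ucont_smeas.
    apply: (@ucont_lip _ _ _ _ (fun x => c *: K x) (c * M)) => //.
    by move=> x x'; rewrite -scalerBr -KB normrZ gtr0_norm// -mulrA ler_wpM2l ?(ltW c0).
  have bK x (L : R) : `|x| <= L -> `|dot (c *: K x) y| <= c * (M * L) * `|y|.
    move=> xL; rewrite (le_trans (dot_CS hdot _ _))// ler_wpM2r// normrZ gtr0_norm//.
    by rewrite ler_wpM2l ?(ltW c0)// (le_trans (KM _))// ler_wpM2l.
  have bV s : 0 < s < t -> `|V s| <= 2 * E * `|a| * 2^-1 ^+ N.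
    by move=> hs; rewrite /V distrC hU//; lra.
  have bp s : 0 < s < t -> `|volterra_sum al c K N a s| <= 2 * E * `|a| * 2^-1 ^+ N + 2 * E * `|a|.
    move=> hs; have hs' : 0 <= s <= T by lra.
    rewrite -[volterra_sum _ _ _ _ _ _](subrK (U a s)) (le_trans (ler_normD _ _))//.
    by rewrite lerD ?hU0// hU.
  have L0 : 0 <= 2 * E * `|a| * 2^-1 ^+ N.
    by rewrite mulr_ge0 ?exprn_ge0// mulr_ge0// mulr_ge0// ltW.
  have JE : Jint al (fun s => dot (c *: K (U a s)) y) t =
     Jint al (fun s => dot (c *: K (V s)) y) t +
     Jint al (fun s => dot (c *: K (volterra_sum al c K N a s)) y) t.
    rewrite -(@JintD _ _ al01 _ _ _ (c * (M * (2 * E * `|a| * 2^-1 ^+ N + 2 * E * `|a|)) * `|y|))//.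
    - by apply: eq_Jint => s _; rewrite -dotDl -scalerDr -KD /V subrK.
    - move=> s hs; apply: bK; rewrite (le_trans (bV s hs))// lerDl.
      by rewrite mulr_ge0// mulr_ge0// ltW.
    - by move=> s hs; apply: bK; exact: bp.
  have st := sum_step N a y tT.
  (* By the Picard identity the defect of the limit equation is the error of the partial sum N + 1
     minus the integral of K applied to the error of the partial sum N. *)
  have -> : dot (U a t) y - (dot a y + Jint al (fun s => dot (c *: K (U a s)) y) t) =
    dot (U a t - volterra_sum al c K N.+1 a t) y -
    Jint al (fun s => dot (c *: K (V s)) y) t.
    by rewrite JE dotBl st; ring.
  apply: le_trans (ler_normB _ _) _; rewrite mulrDl; apply: lerD.
    apply: le_trans (dot_CS hdot _ _) _; rewrite distrC mulrAC ler_wpM2r//.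
    by apply: le_trans (hU a t tT N.+1) _; rewrite exprS mulrA.
  have := Jint_bound al01 t0 mV (fun s hs => bK _ _ (bV s hs)).
  by move/le_trans; apply; rewrite le_eqVlt; apply/orP; left; apply/eqP; ring.
- move=> a b t tT; apply/subr0_eq/normr0_eq0.
  apply: (@geometric_small _ (2 * E * `|a - b| + (2 * E * `|a| + 2 * E * `|b|))) => N.
  rewrite normr_id.
  have -> : U (a - b) t - (U a t - U b t) =
     (U (a - b) t - volterra_sum al c K N (a - b) t) +
     ((volterra_sum al c K N a t - U a t) - (volterra_sum al c K N b t - U b t)).
    rewrite sumB -[LHS](subrKA (volterra_sum al c K N a t - volterra_sum al c K N b t)).
    by congr (_ + _); rewrite !opprD !opprK addrACA.
  rewrite [leRHS]mulrDl [X in _ <= _ + X]mulrDl; apply: le_trans (ler_normD _ _) _; apply: lerD.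
    by rewrite -normrN opprB; exact: hU.
  by apply: le_trans (ler_normB _ _) _; apply: lerD; exact: hU.
Qed.

End VolterraSolution.

(** * Resolvents and Yosida approximation *)

Section Opnorm.
Context {R : realType} {X : normedModType R} (B : X -> X).
Hypotheses (BZ : forall k x, B (k *: x) = k *: B x) (hB : bounded_map B).

Let has : has_sup [set `|B x| | x in [set x : X | `|x| <= 1]].
Proof.
split; first by exists `|B 0|; exists 0 => //=; rewrite normr0.
have [M hM] := hB; exists `|M| => _ [x /= x1 <-].
rewrite (le_trans (hM x))// (le_trans (ler_wpM2r _ (ler_norm M)))//.
by rewrite ler_piMr.
Qed.

Lemma opnorm_ge0 : 0 <= opnorm B.
Proof.
apply: le_trans (normr_ge0 (B 0)) _; apply: sup_upper_bound => //.
by exists 0 => //=; rewrite normr0.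
Qed.

Lemma le_opnorm x : `|B x| <= opnorm B * `|x|.
Proof.
have [->|x0] := eqVneq x 0.
  by have := BZ 0 0; rewrite !scale0r => ->; rewrite normr0 mulr0.
have nx : 0 < `|x| by rewrite normr_gt0.
rewrite -ler_pdivrMr// mulrC -[X in X * _]ger0_norm ?invr_ge0// -normrZ -BZ.
apply: sup_upper_bound => //; exists (`|x|^-1 *: x) => //=.
by rewrite normrZ ger0_norm ?invr_ge0// mulVf// gt_eqF.
Qed.

End Opnorm.

Section Resolvent.
Context {R : realType} {X : completeNormedModType R}.
Context (dot : {dot X for @idfun R}) (hdot : forall x, dot x x = `|x| ^+ 2).
Context (A : operator X) (hAlin : linear_operator A)
  (hAdense : densely_defined A)
  (hAres : [set l : R | 0 < l] `<=` resolvent_set A)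
  (hAbound : forall l : R, 0 < l -> l * opnorm (resolvent A l) <= 1).

Lemma dom0 : dom A 0.
Proof. exact: hAlin.1. Qed.

Lemma op0 : A 0 = 0.
Proof.
have [_] := hAlin.2 1 0 0 dom0 dom0; rewrite !scale1r addr0 => h.
by apply: (addrI (A 0)); rewrite -h addr0.
Qed.

Lemma domZ k x : dom A x -> dom A (k *: x) /\ A (k *: x) = k *: A x.
Proof. by move=> dx; have := hAlin.2 k x 0 dx dom0; rewrite op0 !addr0. Qed.

Lemma domD x y : dom A x -> dom A y -> dom A (x + y) /\ A (x + y) = A x + A y.
Proof. by move=> dx dy; have := hAlin.2 1 x y dx dy; rewrite !scale1r. Qed.

Lemma domB x y : dom A x -> dom A y -> dom A (x - y) /\ A (x - y) = A x - A y.
Proof.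
move=> dx dy; have [d1 e1] := domZ (-1) dy; have := domD dx d1.
by rewrite e1 !scaleN1r.
Qed.

Lemma resolventP l y : 0 < l ->
  dom A (resolvent A l y) /\ l *: resolvent A l y - A (resolvent A l y) = y.
Proof.
move=> l0; have [[x [hx _]] _] := ((hAres l0).1 y, tt).
by apply: (@xgetPex _ 0 [set x | dom A x /\ l *: x - A x = y]); exists x.
Qed.

Lemma resolvent_unique l x y : 0 < l -> dom A x -> l *: x - A x = y ->
  resolvent A l y = x.
Proof.
move=> l0 dx ex; have [z [hz uz]] := (hAres l0).1 y.
by rewrite -(uz _ (resolventP y l0)) (uz x).
Qed.

Lemma resolventD l x y : 0 < l ->
  resolvent A l (x + y) = resolvent A l x + resolvent A l y.
Proof.
move=> l0; have [d1 e1] := resolventP x l0; have [d2 e2] := resolventP y l0.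
have [d3 e3] := domD d1 d2; apply: resolvent_unique => //.
by rewrite e3 scalerDr opprD addrACA e1 e2.
Qed.

Lemma resolventZ l k x : 0 < l -> resolvent A l (k *: x) = k *: resolvent A l x.
Proof.
move=> l0; have [d1 e1] := resolventP x l0.
have [d3 e3] := domZ k d1; apply: resolvent_unique => //.
by rewrite e3 scalerA mulrC -scalerA -scalerBr e1.
Qed.

Lemma resolventB l x y : 0 < l ->
  resolvent A l (x - y) = resolvent A l x - resolvent A l y.
Proof. by move=> l0; rewrite resolventD// -scaleN1r resolventZ// scaleN1r. Qed.

Lemma resolvent_le l x : 0 < l -> l * `|resolvent A l x| <= `|x|.
Proof.
move=> l0; have := le_opnorm (fun k x => resolventZ k x l0) (hAres l0).2 x.
move=> /(ler_wpM2l (ltW l0))/le_trans; apply.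
by rewrite mulrA ler_piMl// hAbound.
Qed.

(** Squaring l |x| <= |l x - A x| gives 2 l dot (A x, x) <= |A x|^2 for every l > 0. A positive
    inner product is contradicted by l = (|A x|^2 + 1) / dot (A x, x). *)
Lemma dissipative x : dom A x -> dot (A x) x <= 0.
Proof.
move=> dx; rewrite leNgt; apply/negP => h.
have h2 l : 0 < l -> 2 * l * dot (A x) x <= `|A x| ^+ 2.
  move=> l0; have := resolvent_le (l *: x - A x) l0.
  rewrite (resolvent_unique l0 dx erefl) => hl.
  have : (l * `|x|) ^+ 2 <= `|l *: x - A x| ^+ 2.
    by rewrite ler_pXn2r// nnegrE// mulr_ge0// ltW.
  rewrite (normrB_dot hdot) dotZl normrZ gtr0_norm// (dotC dot x); lra.
have := h2 ((`|A x| ^+ 2 + 1) / dot (A x) x).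
have p0 : 0 < `|A x| ^+ 2 + 1 by rewrite ltr_wpDl// sqr_ge0.
rewrite divr_gt0// => /(_ isT).
have -> : 2 * ((`|A x| ^+ 2 + 1) / dot (A x) x) * dot (A x) x = 2 * (`|A x| ^+ 2 + 1).
  by field; rewrite gt_eqF.
have := sqr_ge0 `|A x|; lra.
Qed.

(** This is the contraction P_n approximating the identity; the Yosida approximation A_n is A
    composed with it. The index is n + 1, to stay in the resolvent set from n = 0 on. *)
Definition yosida (n : nat) (x : X) : X := n.+1%:R *: resolvent A n.+1%:R x.

Let n0 n : (0 : R) < n.+1%:R. Proof. by rewrite ltr0n. Qed.

Lemma yosida_dom n x : dom A (yosida n x).
Proof. by apply: (domZ _ _).1; exact: (resolventP x (n0 n)).1. Qed.

Lemma op_yosida n x : A (yosida n x) = n.+1%:R *: (yosida n x - x).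
Proof.
have [d e] := resolventP x (n0 n).
rewrite /yosida (domZ _ d).2; congr (_ *: _).
by rewrite -{3}e opprB addrC subrK.
Qed.

Lemma yosidaD n x y : yosida n (x + y) = yosida n x + yosida n y.
Proof. by rewrite /yosida resolventD// scalerDr. Qed.

Lemma yosidaZ n k x : yosida n (k *: x) = k *: yosida n x.
Proof. by rewrite /yosida resolventZ// !scalerA mulrC. Qed.

Lemma yosidaB n x y : yosida n (x - y) = yosida n x - yosida n y.
Proof. by rewrite /yosida resolventB// scalerBr. Qed.

Lemma yosida_le n x : `|yosida n x| <= `|x|.
Proof. by rewrite /yosida normrZ gtr0_norm// resolvent_le. Qed.

Lemma yosidaB_dom n x : dom A x -> yosida n x - x = resolvent A n.+1%:R (A x).
Proof.
move=> dx; have := resolvent_unique (n0 n) dx erefl.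
rewrite resolventB// resolventZ// -/(yosida n x).
by move=> h; rewrite -{2}h opprB addrC subrK.
Qed.

Lemma op_yosida_dom n x : dom A x -> A (yosida n x) = yosida n (A x).
Proof. by move=> dx; rewrite op_yosida yosidaB_dom. Qed.

Lemma yosida_approx_dom n x : dom A x -> `|yosida n x - x| <= `|A x| / n.+1%:R.
Proof.
move=> dx; rewrite yosidaB_dom// ler_pdivlMr// mulrC.
exact: resolvent_le.
Qed.

Lemma dense_dom x (e : R) : 0 < e -> exists2 y, dom A y & `|x - y| < e.
Proof.
move=> e0; have [] := @hAdense (ball x e).
- by exists x; exact: ballxx.
- exact: ball_open.
by move=> y [+ dy]; rewrite -ball_normE /= => h; exists y.
Qed.

(** On D(A) the distance to the identity is at most |A y| / (n + 1); density of D(A) and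
    contractivity extend the convergence to X. *)
Lemma yosida_cvg x : yosida n x @[n --> \oo] --> x.
Proof.
apply/cvgrPdist_le => e e0.
have e3 : 0 < e / 3 by rewrite divr_gt0.
have [y dy xy] := dense_dom x e3.
have /cvgrPdist_le/(_ _ e3) : `|A y| / n.+1%:R @[n --> \oo] --> (0 : R).
  by have := @cvg_div_natS R `|A y| 0; under eq_fun do rewrite addn0.
apply: filterS => n; rewrite sub0r normrN => /(le_trans (ler_norm _)) h.
have -> : x - yosida n x = (x - y) - yosida n (x - y) - (yosida n y - y).
  by rewrite yosidaB !opprB -[RHS]addrA [X in _ = _ + X]addrC !subrKA.
have := ler_normB (x - y - yosida n (x - y)) (yosida n y - y).
have := ler_normB (x - y) (yosida n (x - y)); have := yosida_le n (x - y).
have := le_trans (yosida_approx_dom n dy) h.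
have := ltW xy; lra.
Qed.

End Resolvent.

(** * Uniform convergence of the Yosida approximations *)

Section YosidaLimit.
Context {R : realType} (al : R) (al01 : 0 < al < 1) (T c : R) (T0 : 0 < T) (c0 : 0 < c).
Context {X : completeNormedModType R}.
Context (dot : {dot X for @idfun R}) (hdot : forall x, dot x x = `|x| ^+ 2).
Context (A : operator X) (hAlin : linear_operator A)
  (hAdense : densely_defined A)
  (hAres : [set l : R | 0 < l] `<=` resolvent_set A)
  (hAbound : forall l : R, 0 < l -> l * opnorm (resolvent A l) <= 1).
Context (B : {linear X -> X}) (hB : bounded_map B).
Let b := opnorm B.
Context (C : R) (C0 : 0 < C).
Hypothesis hC : forall (f d : R -> X) (a : X) (S e : R),
  ucont T f -> (forall t : R, 0 <= t <= T -> `|f t| <= S) ->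
  (forall (t : R) y, 0 <= t <= T ->
     dot (d t) y = dot a y + Jint al (fun s => dot (f s) y) t) ->
  0 <= e -> (forall t, 0 <= t <= T -> dot (f t) (d t) <= c * b * `|d t| ^+ 2 + e) ->
  forall t, 0 <= t <= T -> `|d t| ^+ 2 <= C * (`|a| ^+ 2 + e).

Definition yosida_generator (n : nat) (x : X) : X := A (yosida A n x) + B x.

Notation K := yosida_generator.

Let b0 : 0 <= b. Proof. exact: opnorm_ge0. Qed.

Let Bb x : `|B x| <= b * `|x|.
Proof. by apply: le_opnorm => // k y; exact: linearZ. Qed.

Lemma op_yosidaD n x y : A (yosida A n (x + y)) = A (yosida A n x) + A (yosida A n y).
Proof.
rewrite (yosidaD hAlin hAres) (domD hAlin _ _).2//; exact: (yosida_dom hAlin hAres).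
Qed.

Lemma op_yosidaZ n k x : A (yosida A n (k *: x)) = k *: A (yosida A n x).
Proof.
rewrite (yosidaZ hAlin hAres) (domZ hAlin _ _).2//; exact: (yosida_dom hAlin hAres).
Qed.

Lemma generatorD n x y : K n (x + y) = K n x + K n y.
Proof. by rewrite /K op_yosidaD linearD addrACA. Qed.

Lemma generatorZ n k x : K n (k *: x) = k *: K n x.
Proof. by rewrite /K op_yosidaZ linearZ scalerDr. Qed.

Lemma generatorB n x y : K n (x - y) = K n x - K n y.
Proof. by rewrite generatorD -scaleN1r generatorZ scaleN1r. Qed.

Lemma op_yosida_bound n x : `|A (yosida A n x)| <= n.+1%:R * 2 * `|x|.
Proof.
rewrite (op_yosida hAlin hAres) normrZ normr_nat -mulrA ler_wpM2l// (le_trans (ler_normB _ _))//.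
by have := yosida_le hAlin hAres hAbound n x; lra.
Qed.

Lemma generator_le n x : `|K n x| <= (n.+1%:R * 2 + b) * `|x|.
Proof.
by rewrite (le_trans (ler_normD _ _))// mulrDl lerD// op_yosida_bound.
Qed.

Lemma yosida_dissipative n x : dot (A (yosida A n x)) x <= 0.
Proof.
rewrite (op_yosida hAlin hAres) dotZl pmulr_rle0 ?ltr0n// dotBl hdot subr_le0.
rewrite (le_trans (dot_le hdot _ _))// expr2 ler_wpM2r//.
exact: (yosida_le hAlin hAres hAbound).
Qed.

Let KM0 n : 0 <= n.+1%:R * 2 + b :> R.
Proof. by rewrite addr_ge0. Qed.

Let ucontK n f : ucont T f -> ucont T (fun t => c *: K n (f t)).
Proof.
apply: (@ucont_lip _ _ _ _ (fun x => c *: K n x) (c * (n.+1%:R * 2 + b))) => x x'.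
rewrite -scalerBr -generatorB normrZ gtr0_norm// -mulrA ler_wpM2l ?(ltW c0)//.
exact: generator_le.
Qed.

Let bndK n f S : (forall t : R, 0 <= t <= T -> `|f t| <= S) ->
  forall t : R, 0 <= t <= T -> `|c *: K n (f t)| <= c * ((n.+1%:R * 2 + b) * S).
Proof.
move=> hf t tT; rewrite normrZ gtr0_norm// ler_wpM2l ?(ltW c0)//.
by rewrite (le_trans (generator_le _ _))// ler_wpM2l// hf.
Qed.

Let JKmeas n f y t : ucont T f -> t <= T ->
  measurable_fun (`]0, t[ : set (measurableTypeR R)) (fun s => dot (c *: K n (f s)) y).
Proof.
move=> uf tT; apply: (@measurable_funS _ _ _ _ `]0, T[) => //.
  by move=> s; rewrite /= !in_itv/=; lra.
by apply: smeas_dotl => //; apply: ucont_smeas; exact: ucontK.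
Qed.

(** Since x = P_n x - A_n x / (n + 1), the difference x - y is P_n x - P_m y up to a term of size L
    (1 / (n + 1) + 1 / (m + 1)). Against P_n x - P_m y, which lies in D(A), the dissipativity of A
    applies to A_n x - A_m y. *)
Lemma resolvent_quasi_dissipative n m (x y : X) (L : R) :
  `|A (yosida A n x)| <= L -> `|A (yosida A m y)| <= L ->
  dot (K n x - K m y) (x - y) <=
    b * `|x - y| ^+ 2 + 2 * L ^+ 2 * (n.+1%:R^-1 + m.+1%:R^-1).
Proof.
move=> hx hy; set p := A (yosida A n x); set q := A (yosida A m y).
have i0 k : (0 : R) < k.+1%:R^-1 by rewrite invr_gt0.
have yx k z : z = yosida A k z - k.+1%:R^-1 *: A (yosida A k z).
  by rewrite (op_yosida hAlin hAres) scalerA mulVf ?pnatr_eq0// scale1r opprB addrC subrK.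
have L0 : 0 <= L by exact: le_trans hx.
have -> : K n x - K m y = (p - q) + B (x - y).
  by rewrite /K linearB opprD addrACA.
rewrite dotDl addrC; apply: lerD.
  by rewrite (le_trans (dot_le hdot _ _))// expr2 mulrA ler_wpM2r.
have dx := yosida_dom hAlin hAres n x; have dy := yosida_dom hAlin hAres m y.
have [d1 e1] := domB hAlin dx dy.
have h1 := dissipative hdot hAlin hAres hAbound d1.
rewrite e1 -/p -/q in h1.
have -> : x - y = (yosida A n x - yosida A m y) - (n.+1%:R^-1 *: p - m.+1%:R^-1 *: q).
  by rewrite {1}(yx n x) {1}(yx m y) -/p -/q !opprD !opprK addrACA.
have h2 : - dot (p - q) (n.+1%:R^-1 *: p - m.+1%:R^-1 *: q) <=
    (2 * L) * (L * (n.+1%:R^-1 + m.+1%:R^-1)).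
  rewrite lerNl (le_trans _ (lerNnormlW (dot_CS hdot _ _)))//.
  rewrite lerN2; apply: ler_pM => //.
    by rewrite (le_trans (ler_normB _ _))//; lra.
  rewrite (le_trans (ler_normB _ _))// !normrZ !gtr0_norm// mulrDr.
  by rewrite ![L * _]mulrC lerD// ler_wpM2l// ltW.
have e3 : dot (p - q) ((yosida A n x - yosida A m y) - (n.+1%:R^-1 *: p - m.+1%:R^-1 *: q)) =
  dot (p - q) (yosida A n x - yosida A m y) - dot (p - q) (n.+1%:R^-1 *: p - m.+1%:R^-1 *: q).
  by rewrite (dotC dot (p - q)) dotBl !(dotC dot (p - q)).
have -> : 2 * L ^+ 2 * (n.+1%:R^-1 + m.+1%:R^-1) =
    (2 * L) * (L * (n.+1%:R^-1 + m.+1%:R^-1)) by ring.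
by rewrite e3 (le_trans _ h2)// -[leRHS]add0r lerD2r.
Qed.

Lemma yosida_limit (a : X) : exists U : nat -> R -> X, exists u : R -> X,
  [/\ forall n, ucont T (U n), ucont T u,
      forall t, 0 <= t <= T -> `|u t| ^+ 2 <= C * `|a| ^+ 2,
      forall e : R, 0 < e -> exists N, forall n t, (N <= n)%N -> 0 <= t <= T ->
        `|U n t - u t| <= e &
      forall n t y, 0 <= t <= T ->
        dot (U n t) y = dot a y + Jint al (fun s => dot (c *: K n (U n s)) y) t].
Proof.
have /choice[V hV] : forall n, exists V : X -> R -> X,
  [/\ forall a, ucont T (V a),
      forall a, exists S, forall t, 0 <= t <= T -> `|V a t| <= S,
      forall a t y, 0 <= t <= T ->
        dot (V a t) y = dot a y + Jint al (fun s => dot (c *: K n (V a s)) y) t,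
      forall a t, 0 <= t <= T -> K n (V a t) = V (K n a) t &
      forall a b t, 0 <= t <= T -> V (a - b) t = V a t - V b t].
  move=> n; exact: (volterra_solution al01 T0 c0 hdot (KM0 n) (generatorD n)
    (generatorZ n) (generator_le n)).
have hbound n z t : 0 <= t <= T -> `|V n z t| ^+ 2 <= C * `|z| ^+ 2.
  have [u1 u2 u3 _ _] := hV n; have [S hS] := u2 z.
  move=> tT; have := hC (ucontK n (u1 z)) (bndK n hS) (fun t y => u3 z t y) (lexx 0) _ tT.
  rewrite addr0; apply => s sT; rewrite addr0 dotZl -mulrA ler_wpM2l ?(ltW c0)//.
  rewrite dotDl -[leRHS]add0r; apply: lerD; first exact: yosida_dissipative.
  by rewrite (le_trans (dot_le hdot _ _))// expr2 mulrA ler_wpM2r.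
pose D := Num.sqrt C.
have D0 : 0 <= D by exact: sqrtr_ge0.
have hb n z t : 0 <= t <= T -> `|V n z t| <= D * `|z|.
  move=> tT; rewrite -(@ler_pXn2r _ 2)// ?nnegrE// ?mulr_ge0//.
  by rewrite exprMn sqr_sqrtr ?(ltW C0)//; exact: hbound.
(* On the domain of A the generators commute with the solution, which bounds
   A_n u_n uniformly in n; the differences then solve a dissipative problem. *)
have cauchy_dom z : dom A z -> exists G, 0 <= G /\ forall n m t, 0 <= t <= T ->
    `|V n z t - V m z t| ^+ 2 <= G * (n.+1%:R^-1 + m.+1%:R^-1).
  (* [L] bounds A_n u_n = (A_n + B) u_n - B u_n. The first term is the solution with initial value
     (A_n + B) z, and |A_n z| = |P_n A z| <= |A z|. *)
  move=> dz; pose L := D * (`|A z| + b * `|z|) + b * (D * `|z|).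
  have L0 : 0 <= L by rewrite addr_ge0 ?mulr_ge0 ?addr_ge0 ?mulr_ge0.
  exists (C * (c * (2 * L ^+ 2))); split.
    apply: mulr_ge0; first exact: ltW.
    by apply: mulr_ge0; [exact: ltW|rewrite mulr_ge0 ?sqr_ge0].
  move=> n m t tT.
  have AL k s : 0 <= s <= T -> `|A (yosida A k (V k z s))| <= L.
    move=> sT; have [_ _ _ u4 _] := hV k.
    have -> : A (yosida A k (V k z s)) = V k (K k z) s - B (V k z s).
      by rewrite -u4// /K addrK.
    apply: le_trans (ler_normB _ _) _; apply: lerD.
      apply: le_trans (hb _ _ _ sT) _; rewrite ler_wpM2l//.
      rewrite (le_trans (ler_normD _ _))// lerD//.
      rewrite (op_yosida_dom hAlin hAres)//.
      exact: (yosida_le hAlin hAres hAbound).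
    by rewrite (le_trans (Bb _))// ler_wpM2l// hb.
  have [p1 p2 p3 _ _] := hV n; have [q1 q2 q3 _ _] := hV m.
  have [S1 hS1] := p2 z; have [S2 hS2] := q2 z.
  pose f s := c *: K n (V n z s) - c *: K m (V m z s).
  pose d s := V n z s - V m z s.
  have uf : ucont T f.
    apply: ucontD; first exact: ucontK.
    apply: (@ucont_lip _ _ _ _ (fun x => - x) 1); last exact: ucontK.
    by move=> x x'; rewrite -opprD normrN mul1r.
  have fS s : 0 <= s <= T -> `|f s| <=
      c * ((n.+1%:R * 2 + b) * S1) + c * ((m.+1%:R * 2 + b) * S2).
    move=> sT; rewrite (le_trans (ler_normB _ _))// lerD//.
      exact: (bndK n hS1).
    exact: (bndK m hS2).
  have fd s y : 0 <= s <= T -> dot (d s) y = dot 0 y + Jint al (fun r => dot (f r) y) s.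
    move=> sT; have [s0 sT'] := andP sT.
    rewrite /d dotBl p3// q3// opprD addrACA subrr linear0l; congr (_ + _).
    have bd (k : nat) (g : R -> X) S' : (forall t : R, 0 <= t <= T -> `|g t| <= S') ->
        forall r, 0 < r < s -> `|dot (c *: K k (g r)) y| <= c * ((k.+1%:R * 2 + b) * S') * `|y|.
      move=> hg r hr; rewrite (le_trans (dot_CS hdot _ _))// ler_wpM2r// (bndK k hg)//; lra.
    rewrite -mulN1r -(@JintZ _ _ al01 _ (-1) _ _ (JKmeas m y (q1 z) sT') (bd m _ _ hS2)).
    set M1 := c * ((n.+1%:R * 2 + b) * S1) * `|y|.
    set M2 := c * ((m.+1%:R * 2 + b) * S2) * `|y|.
    have z0 : (0 : R) <= 0 <= T by rewrite lexx ltW.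
    have M10 : 0 <= M1.
      by rewrite !mulr_ge0 ?(ltW c0)// (le_trans _ (hS1 0 z0)).
    have M20 : 0 <= M2.
      by rewrite !mulr_ge0 ?(ltW c0)// (le_trans _ (hS2 0 z0)).
    rewrite -(@JintD _ _ al01 _ _ _ (M1 + M2)).
    - by apply: eq_Jint => r _; rewrite /f dotBl mulN1r.
    - exact: JKmeas.
    - by apply: measurable_funM; [exact: measurable_cst|exact: JKmeas].
    - by move=> r hr; rewrite (le_trans (bd n _ _ hS1 r hr))// lerDl.
    - move=> r hr; rewrite normrM normrN1 mul1r.
      by rewrite (le_trans (bd m _ _ hS2 r hr))// lerDr.
  have e0 : 0 <= c * (2 * L ^+ 2 * (n.+1%:R^-1 + m.+1%:R^-1)).
    apply: mulr_ge0; first exact: ltW.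
    by apply: mulr_ge0; [rewrite mulr_ge0 ?sqr_ge0|rewrite addr_ge0].
  have fdiss s : 0 <= s <= T -> dot (f s) (d s) <= c * b * `|d s| ^+ 2 +
      c * (2 * L ^+ 2 * (n.+1%:R^-1 + m.+1%:R^-1)).
    move=> sT; rewrite /f -scalerBr dotZl -mulrA -mulrDr ler_wpM2l ?(ltW c0)//.
    by apply: resolvent_quasi_dissipative; exact: AL.
  have := hC uf fS fd e0 fdiss tT; rewrite normr0 expr0n/= add0r => h.
  by apply: (le_trans h); rewrite !mulrA.
have ucauchy : forall e : R, 0 < e -> exists N : nat, forall n m t, (N <= n)%N ->
    (N <= m)%N -> 0 <= t <= T -> `|V n a t - V m a t| <= e.
  move=> e e0; have D1 : 0 < D + 1 by rewrite ltr_wpDl.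
  (* The initial value is split as (a - z) + z with z in D(A): each of the two solutions starting at
     a - z stays below e / 3, and the difference of those starting at z falls below e / 3 for large
     indices. *)
  have [z dz az] := dense_dom hAdense a (divr_gt0 (divr_gt0 e0 (ltr0Sn R 2)) D1).
  have [G [G0 hG]] := cauchy_dom z dz.
  have e3 : 0 < e / 3 by rewrite divr_gt0.
  have e4 : 0 < (e / 3) ^+ 2 by rewrite exprn_gt0.
  have : (2 * G) / n.+1%:R @[n --> \oo] --> (0 : R).
    by have := @cvg_div_natS R (2 * G) 0; under eq_fun do rewrite addn0.
  move/cvgrPdist_le => /(_ _ e4)[N _ hN].
  exists N => n m t Nn Nm tT.
  have [_ _ _ _ vn] := hV n; have [_ _ _ _ vm] := hV m.
  have -> : V n a t - V m a t = V n (a - z) t - V m (a - z) t + (V n z t - V m z t).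
    rewrite vn// vm// -[LHS](subrK (V n z t - V m z t)); congr (_ + _).
    by rewrite !opprD !opprK addrACA.
  have k1 k : `|V k (a - z) t| <= e / 3.
    apply: le_trans (hb _ _ _ tT) _.
    apply: (@le_trans _ _ ((D + 1) * `|a - z|)); first by rewrite ler_wpM2r// lerDl.
    by rewrite mulrC -ler_pdivlMr// ltW.
  have k2 : `|V n z t - V m z t| <= e / 3.
    rewrite -(@ler_pXn2r _ 2)// ?nnegrE ?(ltW e3)//.
    apply: le_trans (hG n m t tT) _.
    have := hN N (leqnn N); rewrite /= sub0r normrN => /(le_trans (ler_norm _)).
    apply: le_trans; rewrite (_ : 2 * G / N.+1%:R = G * (N.+1%:R^-1 + N.+1%:R^-1)); last by ring.
    have iN k : (N <= k)%N -> k.+1%:R^-1 <= N.+1%:R^-1 :> R.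
      by move=> Nk; rewrite lef_pV2 ?posrE ?ltr0n// ler_nat.
    by rewrite ler_wpM2l// lerD// iN.
  have := ler_normD (V n (a - z) t - V m (a - z) t) (V n z t - V m z t).
  have := ler_normB (V n (a - z) t) (V m (a - z) t).
  have := k1 n; have := k1 m; lra.
have /choice[u hu] : forall t : R, exists l : X, 0 <= t <= T ->
    V n a t @[n --> \oo] --> l.
  move=> t; have [tT|_] := boolP (0 <= t <= T); last by exists 0.
  suff [l hl] : exists l : X, V n a t @[n --> \oo] --> l by exists l.
  apply: cauchy_seq_cvg => e e0; have [N hN] := ucauchy e e0.
  by exists N => n m Nn Nm; exact: hN.
have unif (e : R) : 0 < e -> exists N, forall n t, (N <= n)%N -> 0 <= t <= T ->
    `|V n a t - u t| <= e.
  move=> e0; have [N hN] := ucauchy e e0; exists N => n t Nn tT.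
  have c1 : V n a t - V m a t @[m --> \oo] --> V n a t - u t.
    by apply: cvgB; [exact: cvg_cst|exact: hu].
  apply: (ler_cvg_to (cvg_norm c1) (cvg_cst e)).
  by exists N => // m /= Nm; exact: hN.
exists (fun n => V n a), u; split => //.
- by move=> n; have [] := hV n.
- apply: (@ucont_limit R T X (fun n => V n a)) => [n|e e0]; first by have [] := hV n.
  by have [N hN] := unif e e0; exists N => t; exact: hN.
- move=> t tT.
  have c1 : `|V n a t| ^+ 2 @[n --> \oo] --> `|u t| ^+ 2.
    by under eq_fun do rewrite expr2; rewrite expr2; apply: cvgM; apply: cvg_norm; exact: hu.
  by apply: (ler_cvg_to c1 (cvg_cst _)); apply: nearW => n; exact: hbound.
- by move=> n t y tT; have [_ _ h _ _] := hV n; exact: h.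
Qed.

End YosidaLimit.

(** * Existence *)

Section SquareIntegrable.
Context {R : realType} (T : R).
Context {X : completeNormedModType R}.
Context (dot : {dot X for @idfun R}) (hdot : forall x, dot x x = `|x| ^+ 2).
Notation mu := (@lebesgue_measure R).
Implicit Types v w : R -> X.

Let mI : measurable (`]0, T[%classic : set (measurableTypeR R)).
Proof. exact: measurable_itv. Qed.

Lemma L2_smeas v : L2 T v -> smeas `]0, T[ v.
Proof. by case. Qed.

Lemma L2_integrable_sqr v : L2 T v ->
  mu.-integrable `]0, T[ (EFin \o (fun t => `|v t| ^+ 2)).
Proof.
move=> [_ mv iv]; apply/integrableP; split.
  by apply/measurable_EFinP; apply: measurable_funX; exact: smeas_norm.
by under eq_integral do rewrite /= ger0_norm ?sqr_ge0//.
Qed.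

Lemma L2_integrable_norm v : L2 T v ->
  mu.-integrable `]0, T[ (EFin \o (fun t => `|v t|)).
Proof.
move=> hv; apply: (@integrable_dominated _ _ _ (fun t => 1 + `|v t| ^+ 2)) => //.
- exact: (smeas_norm (L2_smeas hv)).
- move=> t _; rewrite normr_id; have := sqr_ge0 (`|v t| - 1); nra.
- apply: integrable_add => //; last exact: L2_integrable_sqr.
  apply: (@integrable_bounded _ _ _ 1) => //; first exact: lebesgue_itvoo_lty.
  by move=> t _; rewrite normr1.
Qed.

Lemma L2_bounded v (S : R) : smeas `]0, T[ v ->
  (forall t, 0 < t < T -> `|v t| <= S) -> L2 T v.
Proof.
move=> mv bv; split => //.
have h : mu.-integrable `]0, T[ (EFin \o (fun t => `|v t| ^+ 2)).
  apply: (@integrable_bounded _ _ _ (S ^+ 2)) => //.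
  - exact: lebesgue_itvoo_lty.
  - by apply: measurable_funX; exact: smeas_norm.
  - move=> t; rewrite /= in_itv/= => /bv h.
    by rewrite ger0_norm ?sqr_ge0// !expr2 ler_pM.
move/integrableP : h => [_]; under eq_integral do rewrite /= ger0_norm ?sqr_ge0//.
by [].
Qed.

Lemma L2_dot_integrable v w : L2 T v -> L2 T w ->
  mu.-integrable `]0, T[ (EFin \o (fun t => dot (v t) (w t))).
Proof.
move=> hv hw; apply: (integrable_dot hdot (p := fun t => `|v t| ^+ 2 + `|w t| ^+ 2)) => //.
- exact: L2_smeas.
- exact: L2_smeas.
- move=> t _; have := sqr_ge0 (`|v t| - `|w t|).
  have := sqr_ge0 (`|v t|); have := sqr_ge0 (`|w t|); nra.
- by apply: integrable_add => //; exact: L2_integrable_sqr.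
Qed.

Lemma L2_dotD v1 v2 w : L2 T v1 -> L2 T v2 -> L2 T w ->
  L2_dot dot T (fun t => v1 t + v2 t) w = L2_dot dot T v1 w + L2_dot dot T v2 w.
Proof.
move=> h1 h2 hw; rewrite /L2_dot -RintegralD//; [|exact: L2_dot_integrable|exact: L2_dot_integrable].
by apply: eq_Rintegral => t _; rewrite dotDl.
Qed.

Lemma L2_dot_cvg (v_ : nat -> R -> X) v w (S : R) :
  (forall n, smeas `]0, T[ (v_ n)) -> (forall n t, 0 < t < T -> `|v_ n t| <= S) ->
  (forall t, 0 < t < T -> v_ n t @[n --> \oo] --> v t) -> L2 T w ->
  L2_dot dot T (v_ n) w @[n --> \oo] --> L2_dot dot T v w.
Proof.
move=> mv bv cv hw.
apply: (@Rintegral_dominated_cvg _ _ _ _ (fun t => S * `|w t|)) => //.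
- by move=> n; apply: smeas_dot => //; exact: L2_smeas.
- by move=> t; rewrite /= in_itv/= => ht; apply: dot_cvgl => //; exact: cv.
- move=> n t; rewrite /= in_itv/= => ht; rewrite (le_trans (dot_CS hdot _ _))//.
  by rewrite ler_wpM2r// bv.
- by apply: integrable_scale => //; exact: L2_integrable_norm.
Qed.

End SquareIntegrable.

Lemma L2_sub {R : realType} (T : R) {X : completeNormedModType R} (v w : R -> X) :
  L2 T v -> L2 T w -> L2 T (fun t => v t - w t).
Proof.
move=> hv hw; have m := smeasB (L2_smeas hv) (L2_smeas hw); split => //.
have : (@lebesgue_measure R).-integrable `]0, T[
    (EFin \o (fun t => `|v t - w t| ^+ 2)).
  apply: (@integrable_dominated _ _ _ (fun t => 2 * (`|v t| ^+ 2 + `|w t| ^+ 2))) => //.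
  - by apply: measurable_funX; exact: smeas_norm.
  - move=> t _; rewrite ger0_norm ?sqr_ge0//.
    have := ler_normB (v t) (w t); have := normr_ge0 (v t - w t).
    have := sqr_ge0 (`|v t| - `|w t|); nra.
  - by apply: integrable_scale => //; apply: integrable_add => //; exact: L2_integrable_sqr.
move/integrableP => [_]; under eq_integral do rewrite /= ger0_norm ?sqr_ge0//.
by [].
Qed.

Section FracInt.
Context {R : realType} (al : R) (al01 : 0 < al < 1).
Context {X : completeNormedModType R}.
Context (dot : {dot X for @idfun R}) (hdot : forall x, dot x x = `|x| ^+ 2).
Notation mu := (@lebesgue_measure R).

Lemma frac_int_dot (w : R -> X) (t : R) y : smeas `]0, t[ w ->
  mu.-integrable `]0, t[ (EFin \o (fun s => (t - s) `^ (al - 1) * `|w s|)) ->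
  dot (frac_int al w t) y = (Gamma al)^-1 * Jint al (fun s => dot (w s) y) t.
Proof.
move=> mw iw; rewrite /frac_int dotZl; congr (_ * _).
rewrite (bochner_integral_dot hdot)//.
- by apply: eq_Rintegral => s _; rewrite dotZl.
- exact: lebesgue_itvoo_lty.
- by apply: smeas_scale => //; exact: measurable_powR_subr.
- move: iw; apply: eq_integrable => // s _ /=.
  by rewrite normrZ ger0_norm ?powR_ge0.
Qed.

End FracInt.

(** * The limit of the approximations satisfies the weak formulation *)

Section WeakExistence.
Context {R : realType} (al : R) (al01 : 0 < al < 1) (T : R) (T0 : 0 < T).
Context {X : completeNormedModType R}.
Context (dot : {dot X for @idfun R}) (hdot : forall x, dot x x = `|x| ^+ 2).
Context (A : operator X) (hAlin : linear_operator A)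
  (hAdense : densely_defined A)
  (hAres : [set l : R | 0 < l] `<=` resolvent_set A)
  (hAbound : forall l : R, 0 < l -> l * opnorm (resolvent A l) <= 1).
Context (B : {linear X -> X}) (hB : bounded_map B).
Notation mu := (@lebesgue_measure R).
Let b := opnorm B.
Let c := (Gamma al)^-1.
Let c0 : 0 < c. Proof. by rewrite invr_gt0 Gamma_gt0. Qed.
Notation K := (yosida_generator A B).

Let Bb x : `|B x| <= b * `|x|.
Proof. by apply: le_opnorm => // k y; exact: linearZ. Qed.

Let b0 : 0 <= b. Proof. exact: opnorm_ge0. Qed.

Let ucontM (F : X -> X) (L : R) f : (forall x y, F (x - y) = F x - F y) ->
  (forall x, `|F x| <= L * `|x|) -> ucont T f -> ucont T (fun t => F (f t)).
Proof. by move=> FB FL; apply: ucont_lip => x y; rewrite -FB; exact: FL. Qed.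

Let ucont_L2 (f : R -> X) (S : R) : ucont T f -> (forall t, 0 <= t <= T -> `|f t| <= S) -> L2 T f.
Proof.
move=> uf fS; apply: (L2_bounded (S := S)); first exact: ucont_smeas.
by move=> t ht; apply: fS; lra.
Qed.

(** The approximations solve their equation with a continuous right-hand side, so U - a is J^alpha
    of (A_n + B) U at every t; the factor c is the normalisation of J^alpha. *)
Lemma frac_deriv_generator n (U : R -> X) a (S : R) : ucont T U ->
  (forall t, 0 <= t <= T -> `|U t| <= S) ->
  (forall t y, 0 <= t <= T ->
     dot (U t) y = dot a y + Jint al (fun s => dot (c *: K n (U s)) y) t) ->
  frac_deriv al T (fun t => U t - a) (fun t => K n (U t)).
Proof.
move=> uU US hU.
have KL x := generator_le hAlin hAres hAbound hB n x.
have uK : ucont T (fun t => K n (U t)).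
  by apply: ucontM KL uU => x y; exact: generatorB.
have M0 : 0 <= n.+1%:R * 2 + opnorm B :> R by rewrite addr_ge0.
have KS t : 0 <= t <= T -> `|K n (U t)| <= (n.+1%:R * 2 + opnorm B) * S.
  by move=> tT; rewrite (le_trans (KL _))// ler_wpM2l// US.
split.
- apply: (@ucont_L2 _ (S + `|a|)).
    by apply: ucontD => //; exact: ucont_cst.
  by move=> t tT; rewrite (le_trans (ler_normB _ _))// lerD2r US.
- exact: ucont_L2 KS.
- apply: nearW => t; rewrite /= in_itv/= => ht.
  have sub : (`]0, t[%classic : set R) `<=` `]0, T[%classic.
    by move=> s; rewrite /= !in_itv/=; lra.
  have mK : smeas `]0, t[ (fun s => K n (U s)).
    by apply: smeas_subset sub _; exact: ucont_smeas.
  have bK s : 0 < s < t -> `| `|K n (U s)| | <= (n.+1%:R * 2 + opnorm B) * S.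
    by move=> hs; rewrite normr_id KS//; lra.
  apply: (dot_eqP hdot) => y; rewrite (frac_int_dot hdot)//; last first.
    exact: (Jint_integrable al01 (smeas_norm mK) bK).
  rewrite dotBl hU; last lra.
  rewrite addrC addKr -/c.
  rewrite -(@JintZ _ _ al01 _ _ _ ((n.+1%:R * 2 + opnorm B) * S * `|y|)).
  + by apply: eq_Jint => s _; rewrite dotZl.
  + exact: smeas_dotl.
  + move=> s hs; rewrite (le_trans (dot_CS hdot _ _))// ler_wpM2r//.
    by have := bK s hs; rewrite normr_id.
Qed.

(** U itself need not take values in D(A). P_n is bounded from X into D(A) with the graph norm, so
    it carries simple approximations of U to simple approximations of P_n U in D(A). *)
Lemma lifted_yosida n (U : R -> X) (S : R) : ucont T U ->
  (forall t, 0 <= t <= T -> `|U t| <= S) ->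
  lifted (perturb A B) T (fun t => yosida A n (U t))
    (fun t => A (yosida A n (U t)) + B (yosida A n (U t))).
Proof.
move=> uU US.
have PL := yosida_le hAlin hAres hAbound n.
have PB x y : yosida A n (x - y) = yosida A n x - yosida A n y.
  exact: yosidaB.
pose F x := A (yosida A n x) + B (yosida A n x).
have AB x y : A (yosida A n (x - y)) = A (yosida A n x) - A (yosida A n y).
  by rewrite (op_yosidaD hAlin hAres) -scaleN1r (op_yosidaZ hAlin hAres) scaleN1r.
have FB x y : F (x - y) = F x - F y.
  by rewrite /F AB PB linearB opprD addrACA.
pose L := n.+1%:R * 2 + b; have L0 : 0 <= L by rewrite addr_ge0.
have FL x : `|F x| <= L * `|x|.
  rewrite (le_trans (ler_normD _ _))// mulrDl lerD//.
    exact: (op_yosida_bound hAlin hAres hAbound).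
  by rewrite (le_trans (Bb _))// ler_wpM2l.
have uP : ucont T (fun t => yosida A n (U t)).
  by apply: (ucontM (L := 1)) uU => // x; rewrite mul1r.
have uF : ucont T (fun t => F (U t)) by exact: ucontM FL uU.
have g1 x : graph_norm (perturb A B) (yosida A n x) <= (1 + L) * `|x|.
  by rewrite /graph_norm mulrDl mul1r; apply: lerD => //; exact: FL.
split.
- split; first by move=> t _; exact: (yosida_dom hAlin hAres).
    have [s [hs cs]] := (smeasP _ _).1 (ucont_smeas uU).
    exists (fun k t => yosida A n (s k t)); split.
      move=> k; have [f1 f2] := finite_valued_comp (yosida A n) (hs k).
      split => //; first by move=> _ [t _ <-]; exact: (yosida_dom hAlin hAres).
    move=> t It; apply: (@cvg_dist_squeeze _ R^o _ _ (fun k => (1 + L) * `|s k t - U t|)).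
      move=> k; rewrite subr0 -PB ger0_norm; first exact: g1.
      by rewrite addr_ge0.
    rewrite -(mulr0 (1 + L)); apply: cvgMl_tmp; rewrite -(normr0 X).
    apply: cvg_norm; rewrite -(subrr (U t)); apply: cvgB; last exact: cvg_cst.
    exact: cs.
  have : L2 T (fun t => (1 + L) *: U t).
    apply: (@ucont_L2 _ ((1 + L) * S)).
      apply: (ucontM (F := fun x => (1 + L) *: x) (L := 1 + L)) uU => x.
        by move=> y; rewrite scalerBr.
      by rewrite normrZ ger0_norm// addr_ge0.
    by move=> t tT; rewrite normrZ ger0_norm ?addr_ge0// ler_wpM2l ?addr_ge0// US.
  move=> [_ _]; apply: le_lt_trans; apply: ge0_le_integral => //.
  + by move=> t _; rewrite lee_fin sqr_ge0.
  + apply/measurable_EFinP; apply: measurable_funX; apply: measurable_funD.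
      by apply: smeas_norm; exact: ucont_smeas.
    apply: smeas_norm; exact: (ucont_smeas uF).
  + apply/measurable_EFinP; apply: measurable_funX; apply: smeas_norm.
    apply: smeas_scale => //; exact: ucont_smeas.
  + move=> t _; rewrite lee_fin normrZ ger0_norm ?addr_ge0// !expr2.
    by apply: ler_pM; rewrite ?addr_ge0//; exact: g1.
- apply: (@ucont_L2 _ (L * S)) => // t tT.
  by rewrite (le_trans (FL _))// ler_wpM2l// US.
- by apply: nearW.
Qed.

Lemma yosida_limit_weak (U : nat -> R -> X) (u : R -> X) a (S : R) :
  (forall n, ucont T (U n)) -> ucont T u -> (forall t, 0 <= t <= T -> `|u t| <= S) ->
  (forall e : R, 0 < e -> exists N, forall n t, (N <= n)%N -> 0 <= t <= T ->
        `|U n t - u t| <= e) ->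
  (forall n t y, 0 <= t <= T ->
     dot (U n t) y = dot a y + Jint al (fun s => dot (c *: K n (U n s)) y) t) ->
  weak_solution dot al T (perturb A B) a u.
Proof.
move=> uU uu uS cU hU; split; first exact: ucont_L2 uS.
have [N0 hN0] := cU 1 ltr01.
(* The shift by [N0] makes the bound S + 1 hold from the first index on, as dominated convergence
   requires. *)
pose V n := U (n + N0)%N.
have VS n t : 0 <= t <= T -> `|V n t| <= S + 1.
  move=> tT; rewrite -(subrK (u t) (V n t)) addrC (le_trans (ler_normD _ _))//.
  by rewrite lerD ?uS// hN0// leq_addl.
have cV t : 0 <= t <= T -> V n t @[n --> \oo] --> u t.
  move=> tT; apply/cvgrPdist_le => e e0; have [N hN] := cU e e0.
  exists N => // n /= Nn; rewrite distrC hN//.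
  exact: leq_trans Nn (leq_addr _ _).
pose P n x := yosida A (n + N0)%N x.
have PL n x : `|P n x| <= `|x| by exact: (yosida_le hAlin hAres hAbound).
have PB n x y : P n (x - y) = P n x - P n y by exact: yosidaB.
have cP x : P n x @[n --> \oo] --> x.
  by have := yosida_cvg hAlin hAdense hAres hAbound (x := x); rewrite -(cvg_shiftn N0).
have cPV t : 0 <= t <= T -> P n (V n t) @[n --> \oo] --> u t.
  move=> tT.
  apply: (cvg_dist_squeeze (v := fun n => `|V n t - u t| + `|P n (u t) - u t|)).
    move=> n; have -> : P n (V n t) - u t = P n (V n t - u t) + (P n (u t) - u t).
      by rewrite PB subrKA.
    by rewrite (le_trans (ler_normD _ _))// lerD2r PL.
  rewrite -[X in _ --> X]addr0 -(normr0 X).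
  apply: cvgD; apply: cvg_norm; rewrite -(subrr (u t)); apply: cvgB => //.
  - exact: cV.
  - exact: cvg_cst.
  - exact: cvg_cst.
move=> phi psi1 psi2 [hphi hpsi1 ad1] [_ hpsi2 ad2].
have uP n : ucont T (fun t => P n (V n t)).
  by apply: (ucontM (F := P n) (L := 1)) => [x y|x|]; rewrite ?mul1r ?PB//; exact: uU.
have PVS n t : 0 <= t <= T -> `|P n (V n t)| <= S + 1.
  by move=> tT; rewrite (le_trans (PL _ _))// VS.
pose G n t := B (V n t - P n (V n t)).
have uG n : ucont T (G n).
  apply: (ucontM (F := fun x => B x) (L := b)) => //; first exact: linearB.
  apply: ucontD; first exact: uU.
  apply: (ucontM (F := fun x => - x) (L := 1)) => // [x y|x].
    by rewrite opprD.
  by rewrite normrN mul1r.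
have GS n t : 0 <= t <= T -> `|G n t| <= b * ((S + 1) + (S + 1)).
  move=> tT; rewrite (le_trans (Bb _))// ler_wpM2l//.
  by rewrite (le_trans (ler_normB _ _))// lerD ?VS ?PVS.
have id n : L2_dot dot T (fun t => V n t - a) psi1 =
    L2_dot dot T (fun t => P n (V n t)) psi2 + L2_dot dot T (G n) phi.
  have fd := frac_deriv_generator (uU _) (VS n) (hU (n + N0)%N).
  have lf := lifted_yosida (n + N0)%N (uU _) (VS n).
  rewrite -(ad1 _ _ fd) -(ad2 _ _ lf) -L2_dotD//; last 2 first.
  - by case: lf.
  - exact: ucont_L2 (GS n).
  apply: eq_Rintegral => t _; congr (dot _ _).
  by rewrite /G linearB -addrA [X in _ = _ + X]addrC subrK.
have c1 : L2_dot dot T (fun t => V n t - a) psi1 @[n --> \oo] -->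
    L2_dot dot T (fun t => u t - a) psi1.
  apply: (L2_dot_cvg hdot (S := (S + 1) + `|a|)) => //.
  - by move=> n; apply: smeasB; [exact: ucont_smeas (uU _)|exact: smeas_cst].
  - by move=> n t ht; rewrite (le_trans (ler_normB _ _))// lerD2r VS//; lra.
  - by move=> t ht; apply: cvgB; [apply: cV; lra|exact: cvg_cst].
have c2 : L2_dot dot T (fun t => P n (V n t)) psi2 @[n --> \oo] --> L2_dot dot T u psi2.
  apply: (L2_dot_cvg hdot (S := S + 1)) => //.
  - by move=> n; exact: ucont_smeas (uP n).
  - by move=> n t ht; apply: PVS; lra.
  - by move=> t ht; apply: cPV; lra.
have c3 : L2_dot dot T (G n) phi @[n --> \oo] --> L2_dot dot T (fun=> 0) phi.
  apply: (L2_dot_cvg hdot (S := b * ((S + 1) + (S + 1)))) => //.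
  - by move=> n; exact: ucont_smeas (uG n).
  - by move=> n t ht; apply: GS; lra.
  - move=> t ht; have tT : 0 <= t <= T by lra.
    apply: (cvg_dist_squeeze (v := fun n => b * `|V n t - P n (V n t)|)).
      by move=> n; rewrite subr0 Bb.
    rewrite -(mulr0 b); apply: cvgMl_tmp; rewrite -(normr0 X); apply: cvg_norm.
    by rewrite -(subrr (u t)); apply: cvgB; [exact: cV|exact: cPV].
have e0 : L2_dot dot T (fun=> 0) phi = 0.
  transitivity (\int[mu]_(t in `]0, T[) (0 : R)); last by rewrite Rintegral_cst// mul0r.
  by apply: eq_Rintegral => t _; rewrite linear0l.
have c4 : L2_dot dot T (fun t => P n (V n t)) psi2 + L2_dot dot T (G n) phi
    @[n --> \oo] --> L2_dot dot T u psi2.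
  by rewrite -[X in _ --> X]addr0 -e0; exact: cvgD.
rewrite (_ : (fun n => _) = fun n => L2_dot dot T (fun t => V n t - a) psi1) in c4.
  exact: cvg_unique c1 c4.
by apply/funext => n; rewrite id.
Qed.

End WeakExistence.

(** * Uniqueness *)

Section WeakUniqueness.
Context {R : realType} (al : R) (al01 : 0 < al < 1) (T : R).
Context {X : completeNormedModType R}.
Context (dot : {dot X for @idfun R}) (hdot : forall x, dot x x = `|x| ^+ 2).
Notation mu := (@lebesgue_measure R).
Let al0 : 0 < al. Proof. by case/andP : al01. Qed.
Let c := (Gamma al)^-1.
Let c0 : 0 < c. Proof. by rewrite invr_gt0 Gamma_gt0. Qed.

Lemma Rintegral_support (f : R -> R) tau : 0 <= tau <= T ->
  mu.-integrable `]0, T[ (EFin \o f) -> (forall t, tau <= t -> f t = 0) ->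
  \int[mu]_(t in `]0, T[) f t = \int[mu]_(t in `]0, tau[) f t.
Proof.
move=> /andP[t0 tT] hf f0; rewrite (Rintegral_itvoo_split t0 tT hf).
rewrite [X in _ + X](_ : _ = 0) ?addr0//.
transitivity (\int[mu]_(t in `]tau, T[) (0 : R)); last by rewrite Rintegral_cst// mul0r.
by apply: eq_Rintegral => t /set_mem; rewrite /= in_itv/= => ht; apply: f0; lra.
Qed.

Let sub tau : tau <= T -> (`]0, tau[%classic : set R) `<=` `]0, T[%classic.
Proof. by move=> h s; rewrite /= !in_itv/=; lra. Qed.

Let cut (tau : R) (t : R) : R := \1_(`]0, tau[%classic : set R) t.

Let cut_lt tau t : 0 < t < tau -> cut tau t = 1.
Proof. by move=> h; rewrite /cut indicE mem_set//= in_itv. Qed.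

Let cut_ge tau t : tau <= t -> cut tau t = 0.
Proof. by move=> h; rewrite /cut indicE memNset//= in_itv/=; lra. Qed.

Let mcut tau (D : set (measurableTypeR R)) : measurable_fun D (cut tau).
Proof. exact: measurable_indic. Qed.

(* kap tau is the adjoint of J^al applied to the indicator of ]0, tau[ *)
Let kap (tau t : R) : R := c * ((tau - t) `^ al / al).

Let mkap tau (D : set (measurableTypeR R)) : measurable_fun D (kap tau).
Proof.
apply: measurable_funM; first exact: measurable_cst.
apply: measurable_funM; last exact: measurable_cst.
exact: measurable_powR_subr.
Qed.

Let kap_ge0 tau t : 0 <= kap tau t.
Proof. by rewrite mulr_ge0 ?(ltW c0)// divr_ge0 ?powR_ge0// ltW. Qed.

Let kap_le tau t : 0 < t < tau -> tau <= T -> kap tau t <= kap T 0.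
Proof.
move=> ht tT; rewrite ler_wpM2l ?(ltW c0)// ler_wpM2r ?invr_ge0 ?(ltW al0)//.
by apply: powR_le_pos; [exact: ltW|lra|lra].
Qed.

Let cutkap_le tau t : 0 < t < T -> tau <= T -> `|cut tau t * kap tau t| <= kap T 0.
Proof.
move=> ht tT; have [h|h] := leP tau t.
  by rewrite cut_ge// mul0r normr0.
rewrite cut_lt; last lra.
by rewrite mul1r ger0_norm// kap_le//; lra.
Qed.

Let L2_cutkap tau (z : X) : tau <= T -> L2 T (fun t => (cut tau t * kap tau t) *: z).
Proof.
move=> tT; apply: (L2_bounded (S := kap T 0 * `|z|)).
  by apply: smeas_scale => //; [exact: measurable_funM|exact: smeas_cst].
by move=> t ht; rewrite normrZ ler_wpM2r// cutkap_le.
Qed.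

Let L2_cut tau (z : X) : L2 T (fun t => cut tau t *: z).
Proof.
apply: (L2_bounded (S := `|z|)).
  by apply: smeas_scale => //; exact: smeas_cst.
move=> t ht; rewrite normrZ ler_piMl//.
by rewrite /cut indicE; case: (_ \in _); rewrite ?normr1 ?normr0.
Qed.

(** Exchanging the order of integration in the integral of J^alpha w over ]0, tau[ leaves, at time
    s, the kernel integral c (tau - s)^al / al, which is [kap tau s]. *)
Lemma frac_deriv_adjoint_cut (tau : R) (z : X) : 0 <= tau <= T ->
  adjoint dot T (frac_deriv al T) (fun t => (cut tau t * kap tau t) *: z)
    (fun t => cut tau t *: z).
Proof.
move=> tauT; have [tau0 tauT'] := andP tauT.
have h1 := L2_cutkap z tauT'.
have h2 := L2_cut tau z.
split => // v w [hv hw vw].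
pose g s := dot (w s) z.
have ig : mu.-integrable `]0, tau[ (EFin \o g).
  apply: integrableS (integrable_dotl hdot z _ (L2_smeas hw) (L2_integrable_norm hw)) => //.
  exact: sub.
have iw : mu.-integrable `]0, tau[ (EFin \o (fun s => `|w s|)).
  by apply: integrableS (L2_integrable_norm hw) => //; exact: sub.
have m1 : measurable_fun (setT : set (measurableTypeR R)) (fun=> 1 : R) by exact: measurable_cst.
have mk : measurable_fun (setT : set (measurableTypeR R)) (fun x : R => x `^ (al - 1)).
  exact: measurable_powR.
have k0 (x : R) : 0 <= x `^ (al - 1) by exact: powR_ge0.
have hc s : 0 < s < tau -> (\int[mu]_(t in `]s, tau[) (1 * (t - s) `^ (al - 1))%:E =
    ((tau - s) `^ al / al)%:E)%E.
  move=> hs; under eq_integral do rewrite mul1r.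
  by rewrite integral_powR_subl//; lra.
have cC s : 0 < s < tau -> (tau - s) `^ al / al <= T `^ al / al.
  move=> hs; rewrite ler_wpM2r ?invr_ge0 ?(ltW al0)//.
  by apply: powR_le_pos; [exact: ltW|lra|lra].
have F1 := convolution_Fubini ig m1 mk (fun=> ler01) k0 hc cC.
have I1 := convolution_integrable ig m1 mk (fun=> ler01) k0 hc cC.
have A1 := convolution_integrable_ae iw m1 mk (fun=> ler01) k0 hc cC.
transitivity (\int[mu]_(t in `]0, tau[) (kap tau t * g t)).
  rewrite /L2_dot (@Rintegral_support _ tau)//.
  - apply: eq_Rintegral => t /set_mem; rewrite /= in_itv/= => ht.
    by rewrite dotZr cut_lt// mul1r.
  - exact: (L2_dot_integrable hdot hw h1).
  - by move=> t ht; rewrite cut_ge// mul0r scale0r linear0r.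
rewrite /L2_dot [RHS](@Rintegral_support _ tau)//; last 2 first.
- exact: (L2_dot_integrable hdot hv h2).
- by move=> t ht; rewrite cut_ge// scale0r linear0r.
transitivity (c * \int[mu]_(s in `]0, tau[) ((tau - s) `^ al / al * g s)).
  rewrite -RintegralZl//.
    by apply: eq_Rintegral => s _; rewrite /kap mulrA.
  apply: (@integrable_dominated _ _ _ (fun s => T `^ al / al * `|g s|)) => //.
  - apply: measurable_funM; last exact: integrable_measurable ig.
    by apply: measurable_funM; [exact: measurable_powR_subr|exact: measurable_cst].
  - move=> s; rewrite /= in_itv/= => hs; rewrite normrM ler_wpM2r//.
    by rewrite ger0_norm ?cC// divr_ge0 ?powR_ge0// ltW.
  - by apply: integrable_scale => //; exact: integrable_norm.
rewrite -F1 -RintegralZl//.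
apply: Rintegral_ae_eq => //.
- by apply: measurable_funM; [exact: measurable_cst|exact: integrable_measurable I1].
- apply: smeas_dot => //.
    by apply: smeas_subset (sub tauT') (L2_smeas hv).
  by apply: smeas_scale => //; exact: smeas_cst.
(* Two null sets are discarded: where v differs from J^alpha w, and where the kernel times |w| is
   not integrable, so that the Bochner integral could not be tested against z. *)
- apply: (@filterS2 _ _ (ae_filter_ringOfSetsType mu) _ _ _ _ vw A1) => t vwt A1t.
  rewrite /= in_itv/= => ht.
  have ht' : (`]0, T[%classic : set R) t by rewrite /= in_itv/=; lra.
  rewrite cut_lt// scale1r (vwt ht') (frac_int_dot hdot)//.
  + by congr (_ * _); apply: eq_Rintegral => s _; rewrite mul1r.
  + apply: smeas_subset (L2_smeas hw) => s; rewrite /= !in_itv/=; lra.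
  + by apply: eq_integrable (A1t ht) => // s _ /=; rewrite mul1r.
Qed.

Context (A : operator X) (hAlin : linear_operator A)
  (hAres : [set l : R | 0 < l] `<=` resolvent_set A)
  (hAbound : forall l : R, 0 < l -> l * opnorm (resolvent A l) <= 1).
Context (B : {linear X -> X}) (hB : bounded_map B).
Let b := opnorm B.
Let BZ k x : B (k *: x) = k *: B x. Proof. exact: linearZ. Qed.
Let Bb x : `|B x| <= b * `|x|. Proof. exact: (le_opnorm BZ hB). Qed.
Let b0 : 0 <= b. Proof. exact: opnorm_ge0. Qed.
Let P := resolvent A 1.
(** P A = P - 1 on D(A), so [L] is the bounded extension of P (A + B) to all of X. *)
Let L x := P x - x + P (B x).

Let P_le x : `|P x| <= `|x|.
Proof. by have := resolvent_le hAlin hAres hAbound x ltr01; rewrite mul1r. Qed.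

Let PD x y : P (x + y) = P x + P y. Proof. exact: resolventD. Qed.
Let PZ k x : P (k *: x) = k *: P x. Proof. exact: resolventZ. Qed.

Let P_op x : dom A x -> P (A x) = P x - x.
Proof.
move=> dx; have -> : A x = x - (1 *: x - A x) by rewrite scale1r subKr.
rewrite PD -[in - (_ - _)]scaleN1r PZ scaleN1r; congr (_ - _).
exact: resolvent_unique.
Qed.

Let L_adjoint : exists L' : X -> X, forall x y, dot (L x) y = dot x (L' y).
Proof.
apply: (adjoint_map hdot (M := 2 + b)).
- move=> x y; rewrite /L PD opprD (linearD B) PD.
  by rewrite [P x + P y + _]addrACA; exact: addrACA.
- by move=> k x; rewrite /L BZ !PZ !scalerDr scalerN.
- move=> x; rewrite /L (le_trans (ler_normD _ _))// mulrDl lerD//.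
    rewrite (le_trans (ler_normB _ _))// [2]mulr2n mulrDl mul1r.
    by rewrite lerD// P_le.
  by rewrite (le_trans (P_le _)).
Qed.

Let P_adjoint : exists P' : X -> X, forall x y, dot (P x) y = dot x (P' y).
Proof. by apply: (adjoint_map hdot (M := 1)) => // x; rewrite mul1r. Qed.

(** For x in D(A), dot ((A + B) x, P' y) = dot (L x, y) = dot (x, L' y). Thus P' y lies in the
    domain of the adjoint of A + B, with image L' y, and the scalar time factor passes through. *)
Let lifted_adjoint_cut (P' L' : X -> X) tau y :
  (forall x y, dot (P x) y = dot x (P' y)) ->
  (forall x y, dot (L x) y = dot x (L' y)) -> 0 <= tau <= T ->
  adjoint dot T (lifted (perturb A B) T)
    (fun t => (cut tau t * kap tau t) *: P' y)
    (fun t => (cut tau t * kap tau t) *: L' y).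
Proof.
move=> hP hL /andP[tau0 tauT].
have h1 z := L2_cutkap z tauT.
split => // v w [[dv [s [hs cs]] _] hw vw].
have mv : smeas `]0, T[ v.
  exists s; split.
    by move=> n; case: (hs n) => f1 _ f3; split.
  move=> t It; apply: (@cvg_dist_squeeze _ R^o _ _ (fun n =>
    graph_norm (perturb A B) (s n t - v t))) => [n|]; last exact: cs.
  by rewrite subr0 normr_id lerDl.
rewrite /L2_dot; apply: Rintegral_ae_eq => //.
- by apply: (smeas_dot hdot (L2_smeas hw)); exact: (L2_smeas (h1 _)).
- by apply: (smeas_dot hdot mv); exact: (L2_smeas (h1 _)).
apply: (@filterS _ _ (ae_filter_ringOfSetsType mu) _ _ _ vw) => t vwt It.
rewrite (vwt It) !dotZr//= -hP -hL PD P_op//; last exact: dv.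
Qed.

(** Both weak formulations are tested with the same pair, so the initial value cancels. Moved to the
    other side by adjointness, the identity reads P W(tau) = L V(tau) for the two integrals of the
    difference; it is stated before these vectors exist. *)
Lemma weak_solution_diff u u' a : weak_solution dot al T (perturb A B) a u ->
  weak_solution dot al T (perturb A B) a u' ->
  exists P' L' : X -> X,
  [/\ forall x y, dot (resolvent A 1 x) y = dot x (P' y),
      forall x y, dot (resolvent A 1 x - x + resolvent A 1 (B x)) y = dot x (L' y) &
      forall tau y, 0 <= tau <= T ->
        \int[mu]_(t in `]0, tau[) dot (u t - u' t) (P' y) =
        \int[mu]_(t in `]0, tau[)
          ((Gamma al)^-1 * ((tau - t) `^ al / al) * dot (u t - u' t) (L' y))].
Proof.
move=> [hu su] [hu' su'].
have [P' hP] := P_adjoint; have [L' hL] := L_adjoint.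
exists P', L'; split => // tau y tauT.
have [tau0 tauT'] := andP tauT.
have hw : L2 T (fun t => u t - u' t) by exact: L2_sub.
have ha : L2 T (fun t => u' t - a).
  apply: (L2_sub hu'); apply: (L2_bounded (S := `|a|)) => //; exact: smeas_cst.
have p1 := frac_deriv_adjoint_cut (P' y) tauT.
have p2 := lifted_adjoint_cut y hP hL tauT.
have h1 := L2_cut tau (P' y); have h2 := L2_cutkap (L' y) tauT'.
have := su _ _ _ p1 p2; have := su' _ _ _ p1 p2.
have -> : L2_dot dot T (fun t => u t - a) (fun t => cut tau t *: P' y) =
    L2_dot dot T (fun t => u' t - a) (fun t => cut tau t *: P' y) +
    L2_dot dot T (fun t => u t - u' t) (fun t => cut tau t *: P' y).
  rewrite -(L2_dotD hdot)//; congr L2_dot; apply/funext => t.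
  by rewrite [RHS]addrC addrA subrK.
have -> : L2_dot dot T u (fun t => (cut tau t * kap tau t) *: L' y) =
    L2_dot dot T u' (fun t => (cut tau t * kap tau t) *: L' y) +
    L2_dot dot T (fun t => u t - u' t) (fun t => (cut tau t * kap tau t) *: L' y).
  rewrite -(L2_dotD hdot)//; congr L2_dot; apply/funext => t.
  by rewrite [RHS]addrC subrK.
move=> -> /addrI.
rewrite /L2_dot (@Rintegral_support _ tau)//; last 2 first.
- exact: (L2_dot_integrable hdot hw h1).
- by move=> t ht; rewrite cut_ge// scale0r linear0r.
rewrite [RHS](@Rintegral_support _ tau)//; last 2 first.
- exact: (L2_dot_integrable hdot hw h2).
- by move=> t ht; rewrite cut_ge// mul0r scale0r linear0r.
move=> e; transitivity (\int[mu]_(t in `]0, tau[) dot (u t - u' t) (cut tau t *: P' y)).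
  apply: eq_Rintegral => t /set_mem; rewrite /= in_itv/= => ht.
  by rewrite cut_lt// scale1r.
rewrite e; apply: eq_Rintegral => t /set_mem; rewrite /= in_itv/= => ht.
by rewrite cut_lt// mul1r dotZr.
Qed.

End WeakUniqueness.

(** * Functions all of whose integrals vanish *)

Section VanishingIntegrals.
Context {R : realType} (T : R).
Notation mu := (@lebesgue_measure R).

(** By Lebesgue differentiation f is almost everywhere the derivative of its primitive, extended by
    zero outside ]0, T[, and this primitive is constant near every interior point. *)
Lemma Rintegral_eq0_ae (f : R -> R) : mu.-integrable `]0, T[ (EFin \o f) ->
  (forall t, 0 < t < T -> \int[mu]_(s in `]0, t[) f s = 0) ->
  {ae mu, forall t, 0 < t < T -> f t = 0}.
Proof.
move=> hf f0.
have hg : mu.-integrable setT (EFin \o (f \_ `]0, T[)).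
  by move: hf; rewrite integrable_mkcond//= (restrict_EFin f).
have lg : locally_integrable [set: R] (f \_ `]0, T[).
  exact: integrable_locally_restrict.
have ig y : mu.-integrable `]-oo, y] (EFin \o (f \_ `]0, T[)).
  by apply: integrableS hg.
have := FTC1Ny ig lg; apply: (@filterS _ _ (ae_filter_ringOfSetsType mu)).
move=> t [_ +] ht; rewrite patchE mem_set; last by rewrite /= in_itv.
move=> <-; rewrite derive1E (near_eq_derive (g := cst 0)) ?derive_cst//.
have : t \in `]0, T[ by rewrite in_itv.
move/near_in_itvoo; apply: filterS => s; rewrite in_itv/= => hs.
rewrite -Rintegral_mkcondr.
have -> : (`]-oo, s]%classic : set R) `&` `]0, T[ = `]0, s]%classic.
  by apply/seteqP; split => r /=; rewrite !in_itv/=; lra.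
rewrite -Rintegral_itv_bndo_bndc; first exact: f0.
by apply: integrableS hf => // r; rewrite /= !in_itv/=; lra.
Qed.

Context {X : completeNormedModType R}.
Context (dot : {dot X for @idfun R}) (hdot : forall x, dot x x = `|x| ^+ 2).

(* A strongly measurable function takes its values in the closed span of a
   countable set, so that countably many test vectors suffice. *)
Lemma weak_eq0_ae (w : R -> X) : smeas `]0, T[ w ->
  (forall y, {ae mu, forall t, 0 < t < T -> dot (w t) y = 0}) ->
  {ae mu, forall t, 0 < t < T -> w t = 0}.
Proof.
move=> /smeasP[s [hs cs]] hw.
(* The enumeration of all values of the simple functions gives countably many test vectors; the
   default 0 only adds a trivial condition. *)
pose y n i := nth 0 (fset_set (range (s n))) i.
have : {ae mu, forall t, forall n : nat, 0 < t < T -> dot (w t) (s n t) = 0}.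
  apply: ae_foralln => n.
  have := ae_foralln (fun i => hw (y n i)).
  apply: (@filterS _ _ (ae_filter_ringOfSetsType mu)) => t h ht.
  have fr : finite_set (range (s n)) by case: (hs n).
  have : s n t \in fset_set (range (s n)).
    by rewrite in_fset_set//; apply/mem_set; exists t.
  by move=> /(nthP 0)[i _ <-]; exact: h.
apply: (@filterS _ _ (ae_filter_ringOfSetsType mu)) => t h ht.
(* The vanishing numbers dot (w t, s n t) converge to |w t|^2. *)
apply/eqP; rewrite -normr_eq0 -sqrf_eq0 -hdot; apply/eqP.
have c1 : dot (s n t) (w t) @[n --> \oo] --> dot (w t) (w t).
  by apply: dot_cvgl => //; apply: cs; rewrite /= in_itv.
have : dot (s n t) (w t) @[n --> \oo] --> (0 : R).
  under eq_fun do rewrite (dotC dot) h//.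
  exact: cvg_cst.
exact: (cvg_unique _ c1).
Qed.

End VanishingIntegrals.

(** * The integrated difference of two weak solutions *)

Section Uniqueness.
Context {R : realType} (al : R) (al01 : 0 < al < 1) (T : R) (T0 : 0 < T).
Context {X : completeNormedModType R}.
Context (dot : {dot X for @idfun R}) (hdot : forall x, dot x x = `|x| ^+ 2).
Notation mu := (@lebesgue_measure R).
Let al0 : 0 < al. Proof. by case/andP : al01. Qed.
Let c := (Gamma al)^-1.
Let c0 : 0 < c. Proof. by rewrite invr_gt0 Gamma_gt0. Qed.

Section Primitive.
Context (w : R -> X) (hw : L2 T w).
Context (W : R -> X) (hW : forall tau y, 0 <= tau <= T ->
  dot (W tau) y = \int[mu]_(t in `]0, tau[) dot (w t) y).

Let sub r s : 0 <= r -> s <= T -> (`]r, s[%classic : set R) `<=` `]0, T[.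
Proof. by move=> r0 sT t; rewrite /= !in_itv/=; lra. Qed.

Let iwn r s : 0 <= r -> s <= T -> mu.-integrable `]r, s[ (EFin \o (fun t => `|w t|)).
Proof. by move=> r0 sT; apply: integrableS (L2_integrable_norm hw) => //; exact: sub. Qed.

Let iw r s y : 0 <= r -> s <= T -> mu.-integrable `]r, s[ (EFin \o (fun t => dot (w t) y)).
Proof.
move=> r0 sT; apply: (integrable_dotl hdot) => //; last exact: iwn.
by apply: smeas_subset (L2_smeas hw); exact: sub.
Qed.

Let W_diff r s : 0 <= r -> r <= s -> s <= T ->
  `|W s - W r| <= \int[mu]_(t in `]r, s[) `|w t|.
Proof.
move=> r0 rs sT; apply: (norm_le_dot hdot).
  by apply: Rintegral_ge0.
move=> z; rewrite (dotBl dot) !hW; [|lra|lra].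
rewrite (Rintegral_itvoo_split r0 rs); last exact: iw.
rewrite addrAC subrr add0r mulrC -RintegralZl//; last exact: iwn.
apply: le_Rintegral => //; first exact: iw.
  by apply: integrable_scale => //; exact: iwn.
by move=> t _; rewrite mulrC (le_trans (ler_norm _))// (dot_CS hdot).
Qed.

Let W0 : W 0 = 0.
Proof.
apply: (dot_eqP hdot) => y; rewrite hW ?lexx ?ltW// set_itvE Rintegral_set0.
by rewrite linear0l.
Qed.

Lemma primitive_bounded t : 0 <= t <= T -> `|W t| <= \int[mu]_(t in `]0, T[) `|w t|.
Proof.
move=> /andP[t0 tT]; have := W_diff (lexx 0) t0 tT; rewrite W0 subr0 => h.
apply: le_trans h _; rewrite (Rintegral_itvoo_split t0 tT); last exact: iwn.
by rewrite lerDl; apply: Rintegral_ge0.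
Qed.

(** Young's inequality |w| <= eta |w|^2 + 1 / (4 eta) controls the increment of W by eta N plus a
    multiple of the length of the interval. The result supplies the continuous data that the
    quadratic inequality demands and that w itself lacks. *)
Lemma primitive_ucont : ucont T W.
Proof.
pose N := \int[mu]_(t in `]0, T[) `|w t| ^+ 2.
have N0 : 0 <= N by apply: Rintegral_ge0 => // t _; exact: sqr_ge0.
have key (r s eta : R) : 0 < eta -> 0 <= r -> r <= s -> s <= T ->
    `|W s - W r| <= eta * N + (s - r) / (4 * eta).
  move=> e0 r0 rs sT.
  have i2 : mu.-integrable `]r, s[ (EFin \o (fun t => `|w t| ^+ 2)).
    by apply: integrableS (L2_integrable_sqr hw) => //; exact: sub.
  have i1 : mu.-integrable `]r, s[ (EFin \o (fun=> (4 * eta)^-1)).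
    apply: (@integrable_bounded _ _ _ (4 * eta)^-1) => //; first exact: lebesgue_itvoo_lty.
    by move=> t _; rewrite ger0_norm// invr_ge0; lra.
  apply: (le_trans (W_diff r0 rs sT)).
  apply: (@le_trans _ _ (\int[mu]_(t in `]r, s[) (eta * `|w t| ^+ 2 + (4 * eta)^-1))).
    apply: le_Rintegral => //; first exact: iwn.
      by apply: integrable_add => //; apply: integrable_scale.
    move=> t _; have p : 0 <= (eta * `|w t| - 2^-1) ^+ 2 / eta.
      by rewrite divr_ge0 ?sqr_ge0// ltW.
    have q : (eta * `|w t| - 2^-1) ^+ 2 / eta = eta * `|w t| ^+ 2 + (4 * eta)^-1 - `|w t|.
      by field; rewrite gt_eqF.
    by rewrite -subr_ge0 -q.
  rewrite RintegralD//; last exact: integrable_scale.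
  apply: lerD.
    rewrite RintegralZl// ler_wpM2l ?(ltW e0)//.
    have i3 : mu.-integrable `]0, s[ (EFin \o (fun t => `|w t| ^+ 2)).
      by apply: integrableS (L2_integrable_sqr hw) => //; exact: sub.
    rewrite /N (Rintegral_itvoo_split (le_trans r0 rs) sT); last exact: L2_integrable_sqr.
    rewrite (Rintegral_itvoo_split r0 rs i3) -addrA addrCA lerDl.
    by rewrite addr_ge0// Rintegral_ge0// => t _; exact: sqr_ge0.
  have -> : \int[mu]_(t in `]r, s[) (4 * eta)^-1 = (4 * eta)^-1 * (s - r).
    rewrite Rintegral_cst//=; congr (_ * _); transitivity (fine (s - r)%:E) => //.
    by congr fine; rewrite lebesgue_measure_itv/= lte_fin; case: ltgtP rs => // -> _; rewrite subrr.
  by rewrite mulrC.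
(* This [eta] makes the first term at most e / 2; intervals of length at most 2 eta e then keep the
   second below e / 2. *)
move=> e e0; pose eta := e / (2 * (N + 1)).
have eta0 : 0 < eta by rewrite divr_gt0//; lra.
have b1 : eta * N <= e / 2.
  have -> : eta * N = e / 2 - eta by rewrite /eta; field; rewrite gt_eqF//; lra.
  by lra.
exists (2 * eta * e); first by apply: mulr_gt0 => //; apply: mulr_gt0.
have k2 (r s : R) : 0 <= r -> r <= s -> s <= T -> s - r <= 2 * eta * e -> `|W s - W r| <= e.
  move=> r0 rs sT d; apply: le_trans (key r s eta eta0 r0 rs sT) _.
  have : (s - r) / (4 * eta) <= e / 2.
    rewrite ler_pdivrMr; last lra.
    by apply: le_trans d _; lra.
  by lra.
move=> s t /andP[s0 sT] /andP[t0 tT] d; have [st|ts] := leP s t.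
  by rewrite distrC k2// (le_trans _ d)// distrC ler_norm.
by rewrite k2 ?(ltW ts)// (le_trans _ d)// ler_norm.
Qed.

(** The weight (t - s)^al / al is the integral of (t - r)^(al-1) over ]s, t[. Exchanging the two
    integrations turns w into its primitive under the singular kernel. *)
Lemma primitive_Jint (V : R -> X) y t : 0 <= t <= T ->
  dot (V t) y = \int[mu]_(s in `]0, t[) (c * ((t - s) `^ al / al) * dot (w s) y) ->
  dot (V t) y = Jint al (fun s => dot (c *: W s) y) t.
Proof.
move=> /andP[t0 tT] ->.
have mp : measurable_fun (setT : set (measurableTypeR R)) (fun s : R => (t - s) `^ (al - 1)).
  exact: measurable_powR_subr.
have m1 : measurable_fun (setT : set (measurableTypeR R)) (fun=> 1 : R) by exact: measurable_cst.
have p0 (s : R) : 0 <= (t - s) `^ (al - 1) by exact: powR_ge0.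
have hc s : 0 < s < t -> (\int[mu]_(r in `]s, t[) ((t - r) `^ (al - 1) * 1)%:E =
    ((t - s) `^ al / al)%:E)%E.
  move=> hs; under eq_integral do rewrite mulr1.
  rewrite integral_powR_subr//; last lra.
  by rewrite subrr powR0 ?subr0// gt_eqF.
have cC s : 0 < s < t -> (t - s) `^ al / al <= T `^ al / al.
  move=> hs; rewrite ler_wpM2r ?invr_ge0 ?(ltW al0)//.
  by apply: powR_le_pos; [exact: ltW|lra|lra].
have F1 := convolution_Fubini (iw y (lexx 0) tT) mp m1 p0 (fun=> ler01) hc cC.
have I1 := convolution_integrable (iw y (lexx 0) tT) mp m1 p0 (fun=> ler01) hc cC.
transitivity (c * \int[mu]_(s in `]0, t[) ((t - s) `^ al / al * dot (w s) y)).
  rewrite -RintegralZl//.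
    by apply: eq_Rintegral => s _; rewrite mulrA.
  apply: (@integrable_dominated _ _ _ (fun s => T `^ al / al * `|dot (w s) y|)) => //.
  - apply: measurable_funM; last exact: integrable_measurable (iw y (lexx 0) tT).
    by apply: measurable_funM; [exact: measurable_powR_subr|exact: measurable_cst].
  - move=> s; rewrite /= in_itv/= => hs; rewrite normrM ler_wpM2r//.
    by rewrite ger0_norm ?cC// divr_ge0 ?powR_ge0// ltW.
  - by apply: integrable_scale => //; apply: integrable_norm; exact: iw.
rewrite -F1 -RintegralZl//.
apply: eq_Rintegral => s /set_mem; rewrite /= in_itv/= => hs.
rewrite (dotZl dot) mulrCA; congr (_ * _); rewrite hW; last lra.
rewrite -RintegralZl//; last by apply: iw => //; lra.
by apply: eq_Rintegral => r _; rewrite mulr1.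
Qed.

End Primitive.

Context (A : operator X) (hAlin : linear_operator A)
  (hAres : [set l : R | 0 < l] `<=` resolvent_set A)
  (hAbound : forall l : R, 0 < l -> l * opnorm (resolvent A l) <= 1).
Context (B : {linear X -> X}) (hB : bounded_map B).

Lemma weak_solution_unique u u' a : weak_solution dot al T (perturb A B) a u ->
  weak_solution dot al T (perturb A B) a u' -> u' = u %[ae mu in `]0, T[%classic].
Proof.
move=> su su'; have [P' [L' [hP hL hid]]] :=
  weak_solution_diff al01 hdot hAlin hAres hAbound hB su su'.
pose w t := u t - u' t; have hw : L2 T w by exact: L2_sub su.1 su'.1.
have mw tau : tau <= T -> smeas `]0, tau[ w.
  by move=> h; apply: smeas_subset (L2_smeas hw) => t; rewrite /= !in_itv/=; lra.
have iw tau : tau <= T -> mu.-integrable `]0, tau[ (EFin \o (fun t => `|w t|)).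
  move=> h; apply: integrableS (L2_integrable_norm hw) => // t.
  by rewrite /= !in_itv/=; lra.
have /choice[W hW] : forall tau, exists z, 0 <= tau <= T -> forall y,
    dot z y = \int[mu]_(t in `]0, tau[) dot (w t) y.
  move=> tau; have [/andP[h0 hT]|_] := boolP (0 <= tau <= T); last by exists 0.
  have [|z hz] := weak_integral hdot _ (mw _ hT) (iw _ hT); first by [].
  by exists z.
have /choice[V hV] : forall tau, exists z, 0 <= tau <= T -> forall y,
    dot z y = \int[mu]_(t in `]0, tau[) (c * ((tau - t) `^ al / al) * dot (w t) y).
  move=> tau; have [/andP[h0 hT]|_] := boolP (0 <= tau <= T); last by exists 0.
  pose k t := c * ((tau - t) `^ al / al).
  have mk : measurable_fun (`]0, tau[%classic : set (measurableTypeR R)) k.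
    apply: measurable_funM; first exact: measurable_cst.
    apply: measurable_funM; last exact: measurable_cst.
    exact: measurable_powR_subr.
  have mkw : smeas `]0, tau[ (fun t => k t *: w t) by apply: smeas_scale => //; exact: mw.
  have ikw : mu.-integrable `]0, tau[ (EFin \o (fun t => `|k t *: w t|)).
    apply: (@integrable_dominated _ _ _ (fun t => c * (T `^ al / al) * `|w t|)) => //.
    - exact: smeas_norm mkw.
    - move=> t; rewrite /= in_itv/= => ht; rewrite normr_id normrZ ler_wpM2r//.
      rewrite ger0_norm; last by rewrite mulr_ge0 ?(ltW c0)// divr_ge0 ?powR_ge0// ltW.
      rewrite ler_wpM2l ?(ltW c0)// ler_wpM2r ?invr_ge0 ?(ltW al0)//.
      by apply: powR_le_pos; [exact: ltW|lra|lra].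
    - by apply: integrable_scale => //; exact: iw.
  have [|z hz] := weak_integral hdot _ mkw ikw; first by [].
  by exists z => _ y; rewrite hz; apply: eq_Rintegral => t _; rewrite (dotZl dot).
(* The tested identity says P W = P V - V + P B V. Solved for V, it exhibits V as a value of the
   resolvent, which puts V in D(A). *)
have VR t : 0 <= t <= T -> V t = resolvent A 1 (V t + B (V t) - W t).
  move=> ht; rewrite (resolventB hAlin hAres)// (resolventD hAlin hAres)//.
  suff -> : resolvent A 1 (W t) = resolvent A 1 (V t) - V t + resolvent A 1 (B (V t)).
    by rewrite [X in _ - X]addrAC subKr.
  apply: (dot_eqP hdot) => y.
  by rewrite hP hL hW// hV// hid.
have AV t : 0 <= t <= T -> dom A (V t) /\ A (V t) = W t - B (V t).
  move=> ht; have [+ +] := resolventP hAres (V t + B (V t) - W t) (@ltr01 R).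
  rewrite -VR// scale1r => dV e; split => //.
  have -> : A (V t) = V t - (V t - A (V t)) by rewrite subKr.
  by rewrite e opprB addrCA opprD addNKr.
have [C C0 hC] := Jint_apriori al01 T0 (mulr_ge0 (ltW c0) (opnorm_ge0 hB)).
(* W = (A + B) V and dissipativity give dot (c W, V) <= c |B| |V|^2, so the a priori bound applies
   with zero initial value and zero slack. *)
have V0 t : 0 <= t <= T -> V t = 0.
  move=> ht; apply/eqP; rewrite -normr_eq0 -sqrf_eq0 eq_le sqr_ge0 andbT.
  have := hC X dot hdot (fun s => c *: W s) V 0 (c * \int[mu]_(t in `]0, T[) `|w t|) 0.
  rewrite normr0 expr0n/= addr0 mulr0; apply => //.
  - apply: (ucont_lip (F := fun x => c *: x) (L := c)).
      by move=> x y; rewrite -scalerBr normrZ ger0_norm// ltW.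
    exact: (primitive_ucont hw (fun t y h => hW t h y)).
  - move=> s hs; rewrite normrZ ger0_norm ?(ltW c0)// ler_wpM2l ?(ltW c0)//.
    exact: (primitive_bounded hw (fun t y h => hW t h y)).
  - move=> s y hs; rewrite linear0l add0r.
    by apply: (primitive_Jint hw (fun t y h => hW t h y) hs); exact: hV.
  - move=> s hs; have [dV e] := AV s hs; rewrite addr0 (dotZl dot) -!mulrA.
    rewrite ler_wpM2l ?(ltW c0)//.
    have -> : W s = A (V s) + B (V s) by rewrite e subrK.
    rewrite (dotDl dot) -[leRHS]add0r; apply: lerD; first exact: (dissipative hdot).
    rewrite (le_trans (ler_norm _))// (le_trans (dot_CS hdot _ _))// expr2 mulrA ler_wpM2r//.
    by apply: le_opnorm => // k x; exact: linearZ.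
have W0 t : 0 <= t <= T -> W t = 0.
  by move=> ht; have [_] := AV t ht; rewrite V0// linear0 subr0 op0// => <-.
have : {ae mu, forall t, 0 < t < T -> w t = 0}.
  apply: (weak_eq0_ae hdot (L2_smeas hw)) => y.
  apply: Rintegral_eq0_ae; first exact: (integrable_dotl hdot y _ (L2_smeas hw) (L2_integrable_norm hw)).
  by move=> t ht; rewrite -hW ?W0 ?linear0l//; lra.
apply: (@filterS _ _ (ae_filter_ringOfSetsType mu)) => t h.
by rewrite /= in_itv/= => /h /subr0_eq.
Qed.

End Uniqueness.

(** * Well-posedness with a constant independent of the space *)

Theorem theorem2p7 (R : realType) (alpha T : R)
    (halpha : 0 < alpha < 1) (hT : 0 < T) :
  exists C : R -> R, (forall b, 0 < C b) /\
  forall (X : completeNormedModType R) (dot : {dot X for @idfun R})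
    (hdot : forall x, dot x x = `|x| ^+ 2)
    (A : operator X) (hAlin : linear_operator A)
    (hAclosed : closed_operator A) (hAdense : densely_defined A)
    (hAres : [set l : R | 0 < l] `<=` resolvent_set A)
    (hAbound : forall l : R, 0 < l -> l * opnorm (resolvent A l) <= 1)
    (B : {linear X -> X}) (hB : bounded_map B) (a : X),
  exists u : R -> X,
    [/\ weak_solution dot alpha T (perturb A B) a u,
        forall u', weak_solution dot alpha T (perturb A B) a u' ->
          u' = u %[ae lebesgue_measure in `]0, T[%classic] &
        L2_norm dot T u <= C (opnorm B) * `|a|].
Proof.
pose c := (Gamma alpha)^-1.
have c0 : 0 < c by rewrite invr_gt0 Gamma_gt0.
(* The a priori constant is selected as a function of a real b before any space is given. For
   negative b, which is never the norm of an operator, the value 1 only keeps it positive. *)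
have /choice[K hK] : forall b : R, exists K : R, 0 < K /\ (0 <= b ->
    forall (X : completeNormedModType R) (dot : {dot X for @idfun R})
      (hdot : forall x, dot x x = `|x| ^+ 2) (f d : R -> X) (a : X) (S e : R),
    ucont T f -> (forall t : R, 0 <= t <= T -> `|f t| <= S) ->
    (forall (t : R) y, 0 <= t <= T ->
       dot (d t) y = dot a y + Jint alpha (fun s => dot (f s) y) t) ->
    0 <= e ->
    (forall t, 0 <= t <= T -> dot (f t) (d t) <= c * b * `|d t| ^+ 2 + e) ->
    forall t, 0 <= t <= T -> `|d t| ^+ 2 <= K * (`|a| ^+ 2 + e)).
  move=> b; have [b0|b0] := leP 0 b; last by exists 1; split => //; lra.
  have [K K0 h] := Jint_apriori halpha hT (mulr_ge0 (ltW c0) b0).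
  by exists K.
(* The pointwise bound |u t|^2 <= K |a|^2, integrated over ]0, T[, gives the factor K T under the
   root. *)
exists (fun b => Num.sqrt (K b * T)); split.
  by move=> b; rewrite sqrtr_gt0; apply: mulr_gt0 => //; case: (hK b).
move=> X dot hdot A hAlin _ hAdense hAres hAbound B hB a.
have [K0 /(_ (opnorm_ge0 hB) X dot hdot) hC] := hK (opnorm B).
have [U [u [uU uu un cU eU]]] :=
  yosida_limit halpha hT c0 hdot hAlin hAdense hAres hAbound hB K0 hC a.
set C := K (opnorm B) in K0 hC un *.
have un' t : 0 <= t <= T -> `|u t| <= Num.sqrt C * `|a|.
  move=> ht; rewrite -(@ler_sqr _ `|u t|) ?nnegrE ?mulr_ge0 ?sqrtr_ge0//.
  by rewrite exprMn sqr_sqrtr ?(ltW K0)// un.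
have su : weak_solution dot alpha T (perturb A B) a u.
  exact: (yosida_limit_weak halpha hdot hAlin hAdense hAres hAbound hB uU uu un' cU eU).
exists u; split => //.
  by move=> u' su'; exact: (weak_solution_unique halpha hT hdot hAlin hAres hAbound hB su su').
rewrite /L2_norm -[(`|a|)]ger0_norm// -sqrtr_sqr -sqrtrM; last by rewrite mulr_ge0// ltW.
rewrite ler_sqrt; last by rewrite !mulr_ge0 ?sqr_ge0// ltW.
have -> : C * T * `|a| ^+ 2 = \int[lebesgue_measure]_(t in `]0, T[) (C * `|a| ^+ 2).
  rewrite Rintegral_cst//= lebesgue_measure_itv/= lte_fin hT/= oppr0 addr0.
  by rewrite mulrAC.
have hu := su.1.
apply: le_Rintegral => //.
- exact: (L2_dot_integrable hdot hu hu).
- apply: (@integrable_bounded _ _ _ (C * `|a| ^+ 2)) => //; first exact: lebesgue_itvoo_lty.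
  by move=> t _; rewrite ger0_norm// mulr_ge0 ?sqr_ge0// ltW.
- by move=> t; rewrite /= in_itv/= => ht; rewrite hdot un//; lra.
Qed.
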